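(* Let $(X,d,\mathfrak m)$ be a metric measure space such that the Sobolev space $W^{1,2}(X)$ is separable. Let $\mathbb B$ be a universal separable Banach space. Then there exists a unique couple $(\mathrm T^*X,\mathrm d)$, where $\mathrm T^*X$ is a separable Banach $\mathbb B$-bundle over $X$ (called the cotangent bundle of $(X,d,\mathfrak m)$) and $\mathrm d\colon W^{1,2}(X)\to\Gamma(\mathrm T^*X)$ is a linear operator (called the differential), such that the following properties are satisfied: (i) $|\mathrm df|=|Df|$ holds $\mathfrak m$-a.e. for every $f\in W^{1,2}(X)$. (ii) Given any dense sequence $(f_n)_n$ in $W^{1,2}(X)$, the set $\{\mathrm df_n(x):n\in\mathbb N\}$ is dense in $\mathrm T^*_xX:=\mathrm T^*X(x)$ for $\mathfrak m$-a.e. $x\in X$. Uniqueness is intended up to unique isomorphism: given any other couple $(\mathbf E,\mathrm d')$ with the same properties, there exists a unique isomorphism $\varphi\colon\mathrm T^*X\to\mathbf E$ (of separable Banach $\mathbb B$-bundles) such that $\Gamma(\varphi)\circ\mathrm d=\mathrm d'$.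
   Context: A metric measure space $(X,d,\mathfrak m)$ is a complete separable metric space $(X,d)$ with a non-negative Radon measure $\mathfrak m$. Let $\Sigma$ be the completion of the Borel $\sigma$-algebra with respect to $\mathfrak m$; the completion of $\mathfrak m$ is still denoted $\mathfrak m$, so that $(X,\Sigma,\mathfrak m)$ is a complete $\sigma$-finite measure space. Sobolev space. $\mathrm{LIP}(X)$ is the space of real-valued Lipschitz functions on $X$. For $f\in\mathrm{LIP}(X)$, $\mathrm{lip}(f)(x):=\limsup_{y\to x}|f(x)-f(y)|/d(x,y)$ if $x$ is an accumulation point, and $0$ otherwise. For $f\in L^2(\mathfrak m)$, the Cheeger energy is $\mathrm{Ch}(f):=\inf\liminf_n\int\mathrm{lip}^2(f_n)\,d\mathfrak m$, the infimum over all sequences $(f_n)_n\subseteq\mathrm{LIP}(X)$ with $[f_n]_{\mathfrak m}\in L^2(\mathfrak m)$ and $[f_n]_{\mathfrak m}\to f$ in $L^2(\mathfrak m)$. $W^{1,2}(X):=\{f\in L^2(\mathfrak m):\mathrm{Ch}(f)<\infty\}$, a Banach space with norm $\|f\|=(\int|f|^2\,d\mathfrak m+\mathrm{Ch}(f))^{1/2}$. For $f\in W^{1,2}(X)$, $|Df|\in L^2(\mathfrak m)$ denotes the minimal relaxed slope of $f$, which satisfies $\mathrm{Ch}(f)=\int|Df|^2\,d\mathfrak m$: a relaxed slope of $f$ is a $G\in L^2(\mathfrak m)$ such that there are $f_n\in\mathrm{LIP}(X)$ with $f_n\to f$ in $L^2(\mathfrak m)$, $\mathrm{lip}(f_n)\rightharpoonup\tilde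 G$ weakly in $L^2(\mathfrak m)$ and $\tilde G\le G$ $\mathfrak m$-a.e., and $|Df|$ is the relaxed slope of minimal $L^2(\mathfrak m)$-norm. Bundles. Banach spaces are real. A universal separable Banach space is a separable Banach space $\mathbb B$ into which every separable Banach space embeds linearly and isometrically. $\mathrm{Gr}(\mathbb B)$ is the family of closed linear subspaces of $\mathbb B$. A separable Banach $\mathbb B$-bundle over $X$ is a map $\mathbf E\colon X\to\mathrm{Gr}(\mathbb B)$ such that $\{x\in X:\mathbf E(x)\cap U\ne\emptyset\}\in\Sigma$ for every open $U\subseteq\mathbb B$. $\Gamma(\mathbf E)$ is the space of $\Sigma$-measurable maps $\bar s\colon X\to\mathbb B$ with $\bar s(x)\in\mathbf E(x)$ for all $x$, modulo $\mathfrak m$-a.e. equality; for $s\in\Gamma(\mathbf E)$, $|s|(x):=\|s(x)\|_{\mathbb B}$. Set $\mathrm T\mathbf E:=\bigcup_{x}\{x\}\times\mathbf E(x)\subseteq X\times\mathbb B$. A morphism $\varphi\colon\mathbf E\to\mathbf F$ is an equivalence class of measurable maps $\bar\varphi\colon\mathrm T\mathbf E\to\mathrm T\mathbf F$ (for the $\sigma$-algebras induced by $\Sigma\otimes\mathscr B(\mathbb B)$) with $\bar\varphi(\{x\}\times\mathbf E(x))\subseteq\{x\}\times\mathbf F(x)\cong\mathbf F(x)$ and $\bar\varphi(x,\cdot)\colon\mathbf E(x)\to\mathbf F(x)$ a linear contraction (norm $\le1$) for all $x$, where two such maps are equivalent if they agree on the fibers over all $x$ outside some $\mathfrak m$-null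 set. Isomorphisms are the invertible morphisms. $\Gamma(\varphi)\colon\Gamma(\mathbf E)\to\Gamma(\mathbf F)$ sends the class of $\bar s$ to the class of $x\mapsto\bar\varphi(x,\bar s(x))$. *)

(* Defs.v *)
From HB Require Import structures.
From mathcomp Require Import all_boot all_order all_algebra.
From mathcomp Require Import all_classical all_reals all_analysis measurable_realfun.
Set Implicit Arguments.
Unset Strict Implicit.
Unset Printing Implicit Defensive.
Import Order.TTheory GRing.Theory Num.Theory.
Import numFieldNormedType.Exports.
Local Open Scope classical_set_scope.
Local Open Scope ring_scope.
Local Open Scope quotient_scope.

#[short(type="completeMetricType")]
HB.structure Definition CompleteMetric (K : numDomainType) :=
  {T of Complete T & Metric K T}.

Definition separable (T : topologicalType) : Prop :=
  exists2 D : set T, countable D & dense D.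

Definition universal_separable_banach (R : realType)
    (B : completeNormedModType R) : Prop :=
  separable B /\
  forall V : completeNormedModType R, separable V ->
    exists i : {linear V -> B}, forall v, `|i v| = `|v|.

Definition borel (T : ptopologicalType) : measurableType (@open T).-sigma :=
  g_sigma_algebraType (@open T).

Section completion.
Context d (T : measurableType d) (R : realType).
Variable m : {measure set T -> \bar R}.

(* The generator [completed_algebra_gen m], i.e., the sets [A `|` N] with [A]
   measurable and [N] negligible, is already a sigma-algebra. *)
Definition completion : measurableType (completed_algebra_gen m).-sigma :=
  g_sigma_algebraType (completed_algebra_gen m).

Lemma measurable_completionE :
  (measurable : set (set completion)) = completed_algebra_gen m.
Proof.
apply/seteqP; split; last first.
  by move=> A mA; apply: sub_sigma_algebra.
apply: smallest_sub => //=; split => /=.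
- by exists set0 => //; exists set0; [exact: negligible_set0|rewrite setU0].
- move=> G [/= A mA [N negN ANG]]; case: negN => /= F [mF F0 NF].
  have GANA : ~` G = ~` A `\` (N `&` ~` A).
    by rewrite -ANG setCU setDE setCI setCK setIUr setICl setU0.
  pose AA := ~` A `\` (F `&` ~` A).
  pose NN := (F `&` ~` A) `\` (N `&` ~` A).
  have GAANN : ~` G = AA `|` NN.
    rewrite (_ : ~` G = ~` A `\` (N `&` ~` A))//.
    by apply: setDU; [exact: setSI|exact: subIsetr].
  rewrite setTD.
  exists AA.
    apply: measurableI => //=; first exact: measurableC.
    by apply: measurableC; apply: measurableI => //; exact: measurableC.
  by exists NN; [exists F; split => // x [] []|rewrite GAANN].
- move=> F mF/=.
  pose A n := projT1 (cid2 (mF n)).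
  pose N n := projT1 (cid2 (projT2 (cid2 (mF n))).2).
  exists (\bigcup_k A k).
    by apply: bigcupT_measurable => i; rewrite /A; case: cid2.
  exists (\bigcup_k N k).
    apply: negligible_bigcup => /= k.
    by rewrite /N; case: (cid2 (mF k)) => //= *; case: cid2.
  rewrite -bigcupU; apply: eq_bigcup => // i _.
  by rewrite /A /N; case: (cid2 (mF i)) => //= *; case: cid2.
Qed.

Lemma sub_completion_caratheodory (A : set completion) :
  measurable A -> (m^*)%mu.-cara.-measurable A.
Proof.
rewrite measurable_completionE => -[X mX] [N [F [mF F0 NF]]] <-.
apply: (@measurableU _ (caratheodory_type (m^*)%mu)).
  by apply: sub_caratheodory; exact: sub_sigma_algebra.
have N0 : (m^*)%mu N = 0%E.
  apply/eqP; rewrite eq_le outer_measure_ge0 andbT.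
  rewrite -F0 -(measurable_mu_extE m mF); exact: le_outer_measure.
apply: le_caratheodory_measurable => /= Y.
apply: (@le_trans _ _ ((m^*)%mu N + (m^*)%mu (Y `&` ~` N))%E).
  by rewrite leeD2r// le_outer_measure//; exact: subIsetr.
by rewrite N0 add0e le_outer_measure//; exact: subIsetl.
Qed.

(* The outer measure of [m] agrees with [m] on the measurable sets and
   vanishes on the negligible ones. *)
Definition completed_fun (A : set completion) : \bar R := ((m^*)%mu A)%E.

Fact cmeas0 : completed_fun set0 = 0%E. Proof. exact: outer_measure0. Qed.

Fact cmeas_ge0 A : (0 <= completed_fun A)%E. Proof. exact: outer_measure_ge0. Qed.

Fact cmeas_semi_sigma_additive : semi_sigma_additive completed_fun.
Proof.
move=> F mF tF mUF; apply: caratheodory_measure_sigma_additive => //.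
- by move=> n; apply: sub_completion_caratheodory.
- exact: sub_completion_caratheodory.
Qed.

HB.instance Definition _ := isMeasure.Build _ _ _ completed_fun
  cmeas0 cmeas_ge0 cmeas_semi_sigma_additive.

Definition completed : {measure set completion -> \bar R} := completed_fun.

Lemma completedE (A : set T) : measurable A -> completed A = m A.
Proof.
by move=> mA; rewrite /completed /= /completed_fun measurable_mu_extE.
Qed.

End completion.
Arguments completed {d T R} m.

Definition radon (R : realType) (X : completeMetricType R)
    (m : {measure set (borel X) -> \bar R}) : Prop :=
  (forall x : X, exists2 U : set X, open_nbhs x U & (m U < +oo)%E) /\
  (forall A : set (borel X), measurable A ->
    m A = ereal_sup [set m K | K in [set K : set X | compact K /\ K `<=` A]]).

Section sobolev.
Context (R : realType) (X : completeMetricType R).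
Variable m : {measure set (borel X) -> \bar R}.
Local Notation Xm := (completion m).
Local Notation mu := (completed m).

Definition LIP : set (X -> R) :=
  [set f | exists L : R, forall x y, `|f x - f y| <= L * mdist x y].

Definition lip (f : X -> R) (x : X) : R :=
  if `[< limit_point [set: X] x >] then
    fine (limf_esup (fun y => (`|f x - f y| / mdist x y)%:E) x^')
  else 0.

Definition L2 : set (X -> R) := [set f | (f : Xm -> R) \in Lfun mu 2%:E].

Definition L2_norm (f : X -> R) : \bar R := Lnorm mu 2%:E (EFin \o (f : Xm -> R)).

Definition L2_cvg (g : nat -> X -> R) (f : X -> R) : Prop :=
  L2_norm (g n \- f) @[n --> \oo] --> 0%E.

Definition L2_weak_cvg (g : nat -> X -> R) (f : X -> R) : Prop :=
  forall h : X -> R, L2 h ->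
    (\int[mu]_x (g n x * h x)) @[n --> \oo] --> \int[mu]_x (f x * h x).

(* The Lipschitz sequences, with values in L^2, converging to [f] in L^2. *)
Definition lip_approx (f : X -> R) : set (nat -> X -> R) :=
  [set g | (forall n, LIP (g n) /\ L2 (g n)) /\ L2_cvg g f].

Definition Ch (f : X -> R) : \bar R :=
  ereal_inf [set limn_einf (fun n => \int[mu]_x ((lip (g n) x) ^+ 2)%:E)%E
            | g in lip_approx f].

Definition W12 : Type :=
  {f : LspaceType mu (lee1n 2) | (Ch (f : Xm -> R) < +oo)%E}.

Definition W12_fun (f : W12) : X -> R := (sval f : Xm -> R).
Coercion W12_fun : W12 >-> Funclass.

Definition W12_norm (f : X -> R) : \bar R :=
  ((\int[mu]_x ((f x) ^+ 2)%:E + Ch f) `^ 2^-1)%E.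

Definition W12_dense (D : set W12) : Prop :=
  forall (f : W12) (e : R), 0 < e ->
    exists2 g, D g & (W12_norm (f \- g)%R < e%:E)%E.

Definition W12_separable : Prop :=
  exists2 D : set W12, countable D & W12_dense D.

Definition relaxed_slope (f G : X -> R) : Prop :=
  L2 G /\
  exists g G', [/\ lip_approx f g, forall n, L2 (lip (g n)), L2 G',
    L2_weak_cvg (fun n => lip (g n)) G' &
    {ae mu, forall x : Xm, G' x <= G x}].

(* A representative of the minimal relaxed slope |Df|, which is unique up to
   a.e. equality; the default value is irrelevant when f is in W^{1,2}. *)
Definition minimal_slope (f : X -> R) : X -> R :=
  xget (fun=> 0) [set G | relaxed_slope f G /\
    forall H, relaxed_slope f H -> (L2_norm G <= L2_norm H)%E].

End sobolev.

Record Gr (R : realType) (B : completeNormedModType R) := {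
  gr_set :> B -> Prop;
  gr_closed : closed (gr_set : set B);
  gr_0 : gr_set 0;
  gr_linear : forall (a : R) u v, gr_set u -> gr_set v -> gr_set (a *: u + v)
}.

Section bundles.
Context (R : realType) (X : completeMetricType R).
Variable m : {measure set (borel X) -> \bar R}.
Variable B : completeNormedModType R.
Local Notation Xm := (completion m).
Local Notation mu := (completed m).

Record bundle := {
  fiber :> X -> Gr B;
  bundle_measurable : forall U : set B, open U ->
    measurable ([set x | (gr_set (fiber x) `&` U !=set0)] : set Xm)
}.

Record bsection (E : bundle) := {
  bsection_fun :> X -> B;
  bsection_measurable : measurable_fun setT (bsection_fun : Xm -> borel B);
  bsection_in : forall x, E x (bsection_fun x)
}.

HB.instance Definition _ E := gen_eqMixin (bsection E).
HB.instance Definition _ E := gen_choiceMixin (bsection E).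

Definition section_eq E (s t : bsection E) : bool :=
  `[< {ae mu, forall x : Xm, s x = t x} >].

Fact section_eq_refl E : reflexive (@section_eq E).
Proof. by move=> s; apply/asboolP; exact: aeW. Qed.

Fact section_eq_sym E : symmetric (@section_eq E).
Proof.
by move=> s t; apply/asboolP/asboolP; apply: filterS => x ->.
Qed.

Fact section_eq_trans E : transitive (@section_eq E).
Proof.
move=> t s u /asboolP st /asboolP tu; apply/asboolP.
by apply: filterS2 st tu => x -> ->.
Qed.

Canonical section_eq_equiv E := EquivRel (@section_eq E)
  (@section_eq_refl E) (@section_eq_sym E) (@section_eq_trans E).

Definition Gamma E : Type := {eq_quot @section_eq E}.
HB.instance Definition _ E := Choice.on (Gamma E).
HB.instance Definition _ E := EqQuotient.on (Gamma E).

Definition Gamma_fun E (s : Gamma E) : bsection E := repr s.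
Coercion Gamma_fun : Gamma >-> bsection.

Lemma Gamma_eqP E (s t : Gamma E) : s = t <-> {ae mu, forall x : Xm, s x = t x}.
Proof.
split=> [->|st]; first exact: aeW.
by rewrite -[s]reprK -[t]reprK; apply/eqmodP/asboolP.
Qed.

Lemma Gamma_pi E (s : bsection E) :
  {ae mu, forall x : Xm, (\pi_(Gamma E) s : Gamma E) x = s x}.
Proof. by apply/asboolP; rewrite -[asbool _]/(section_eq _ _) -eqmodE reprK. Qed.

Definition total_space (E : bundle) : Type :=
  {p : (Xm * borel B)%type | E p.1 p.2}.
HB.instance Definition _ E := gen_eqMixin (total_space E).
HB.instance Definition _ E := gen_choiceMixin (total_space E).
HB.instance Definition _ E := isPointed.Build (total_space E)
  (exist _ (point : Xm, 0 : borel B) (gr_0 (E point)) : total_space E).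

Definition proj E (p : total_space E) : X := (sval p).1.
Definition vect E (p : total_space E) : B := (sval p).2.

(* T E with the sigma-algebra induced by the product one on X * B. *)
Definition total_measurable E : Type :=
  g_sigma_algebra_preimageType (sval : total_space E -> (Xm * borel B)%type).

(* [bmap_linear] is the linearity of the maps E(x) -> F(x): if p, q and r lie in
   the same fiber and r = a p + q there, then phi r = a (phi p) + phi q. *)
Record bundle_map (E F : bundle) := {
  bmap_fun :> total_space E -> total_space F;
  bmap_measurable :
    measurable_fun setT (bmap_fun : total_measurable E -> total_measurable F);
  bmap_proj : forall p, proj (bmap_fun p) = proj p;
  bmap_linear : forall (a : R) (p q r : total_space E),
    proj p = proj r -> proj q = proj r -> vect r = a *: vect p + vect q ->
    vect (bmap_fun r) = a *: vect (bmap_fun p) + vect (bmap_fun q);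
  bmap_contraction : forall p, `|vect (bmap_fun p)| <= `|vect p|
}.

HB.instance Definition _ E F := gen_eqMixin (bundle_map E F).
HB.instance Definition _ E F := gen_choiceMixin (bundle_map E F).

Definition bmap_eq E F (phi psi : bundle_map E F) : bool :=
  `[< {ae mu, forall x : Xm, forall p, proj p = x -> phi p = psi p} >].

Fact bmap_eq_refl E F : reflexive (@bmap_eq E F).
Proof. by move=> phi; apply/asboolP; exact: aeW. Qed.

Fact bmap_eq_sym E F : symmetric (@bmap_eq E F).
Proof.
by move=> phi psi; apply/asboolP/asboolP; apply: filterS => x + p px => ->.
Qed.

Fact bmap_eq_trans E F : transitive (@bmap_eq E F).
Proof.
move=> t s u /asboolP st /asboolP tu; apply/asboolP.
by apply: filterS2 st tu => x h1 h2 p px; rewrite h1 ?h2.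
Qed.

Canonical bmap_eq_equiv E F := EquivRel (@bmap_eq E F)
  (@bmap_eq_refl E F) (@bmap_eq_sym E F) (@bmap_eq_trans E F).

Definition bundle_morphism E F : Type := {eq_quot @bmap_eq E F}.
HB.instance Definition _ E F := Choice.on (bundle_morphism E F).
HB.instance Definition _ E F := EqQuotient.on (bundle_morphism E F).

Definition morphism_fun E F (phi : bundle_morphism E F) : bundle_map E F :=
  repr phi.
Coercion morphism_fun : bundle_morphism >-> bundle_map.

Lemma morphism_eqP E F (phi psi : bundle_morphism E F) :
  phi = psi <-> {ae mu, forall x : Xm, forall p, proj p = x -> phi p = psi p}.
Proof.
split=> [->|st]; first exact: aeW.
by rewrite -[phi]reprK -[psi]reprK; apply/eqmodP/asboolP.
Qed.

Lemma morphism_pi E F (phi : bundle_map E F) : {ae mu, forall x : Xm,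
  forall p, proj p = x ->
    (\pi_(bundle_morphism E F) phi : bundle_morphism E F) p = phi p}.
Proof. by apply/asboolP; rewrite -[asbool _]/(bmap_eq _ _) -eqmodE reprK. Qed.

Definition bmap_id E : bundle_map E E.
Proof.
by refine (@Build_bundle_map E E id _ _ _ _) => //; exact: measurable_id.
Defined.

Definition bmap_comp E F G (psi : bundle_map F G) (phi : bundle_map E F) :
  bundle_map E G.
Proof.
refine (@Build_bundle_map E G (psi \o phi) _ _ _ _).
- exact: (measurableT_comp (bmap_measurable psi) (bmap_measurable phi)).
- by move=> p /=; rewrite !bmap_proj.
- by move=> a p q r pr qr rE; apply: bmap_linear; rewrite ?bmap_proj//;
    exact: bmap_linear.
- by move=> p; exact: le_trans (bmap_contraction _ _) (bmap_contraction _ _).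
Defined.

Definition morphism_id E : bundle_morphism E E :=
  \pi_(bundle_morphism E E) (bmap_id E).

Definition morphism_comp E F G (psi : bundle_morphism F G)
    (phi : bundle_morphism E F) : bundle_morphism E G :=
  \pi_(bundle_morphism E G) (bmap_comp psi phi).

Definition isomorphism E F (phi : bundle_morphism E F) : Prop :=
  exists psi : bundle_morphism F E,
    morphism_comp psi phi = morphism_id E /\ morphism_comp phi psi = morphism_id F.

Definition graph E (s : bsection E) (x : X) : total_space E :=
  exist _ (x : Xm, s x : borel B) (bsection_in s x).

Lemma measurable_graph E (s : bsection E) :
  measurable_fun setT (graph s : Xm -> total_measurable E).
Proof.
move=> _ _ [Y mY <-]; rewrite !setTI.
have mg : measurable_fun setT (fun x : Xm => (x, s x : borel B)).
  apply/measurable_fun_pairP; split; first exact: measurable_id.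
  exact: (bsection_measurable s).
by have := mg measurableT _ mY; rewrite setTI.
Qed.

Lemma measurable_vect E :
  measurable_fun setT (@vect E : total_measurable E -> borel B).
Proof.
move=> _ Y mY; rewrite setTI; exists (setT `*` Y); first exact: measurableX.
by rewrite setTI; apply/seteqP; split => [p []|p].
Qed.

Lemma vect_in E (p : total_space E) x : proj p = x -> E x (vect p).
Proof. by move=> <-; exact: (svalP p). Qed.

Definition bsection_map E F (phi : bundle_map E F) (s : bsection E) :
  bsection F.
Proof.
refine (@Build_bsection F (fun x => vect (phi (graph s x))) _ _).
- apply: (measurableT_comp (@measurable_vect F)).
  exact: (measurableT_comp (bmap_measurable phi) (measurable_graph s)).
- by move=> x; apply: vect_in; rewrite bmap_proj.
Defined.

Definition Gamma_map E F (phi : bundle_morphism E F) (s : Gamma E) : Gamma F :=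
  \pi_(Gamma F) (bsection_map phi s).

(* The operations of W^{1,2} and of the sections are the pointwise ones, up to
   a.e. equality. *)
Definition linear_operator E (d : W12 m -> Gamma E) : Prop :=
  forall (a : R) (f g h : W12 m),
    {ae mu, forall x : Xm, h x = a * f x + g x} ->
    {ae mu, forall x : Xm, d h x = a *: d f x + d g x}.

Definition cotangent_couple E (d : W12 m -> Gamma E) : Prop :=
  [/\ linear_operator d,
      forall f : W12 m, {ae mu, forall x : Xm, `|d f x| = minimal_slope m f x} &
      forall f_ : nat -> W12 m, W12_dense (range f_) ->
        {ae mu, forall x : Xm,
          gr_set (E x) `<=` closure (range (fun n => d (f_ n) x))}].

End bundles.

(* Main.v *)
(* The cotangent fibers have to realise, measurably in [x] and inside [B], the
   seminorms [P x c := |D(\sum_i c_i f_i)|(x)] on the rational combinations of a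
   dense sequence [(f_i)] of W^{1,2}; once additive maps [u _ x] into [B] with
   [`|u c x| = P x c] are chosen, T*X(x) is the closure of the range of [u _ x],
   and [d f] is the a.e. limit of [u (c_k)] along rational combinations that
   converge fast to [f].

   The maps [u] are obtained without measurable selection. The seminorm [P x] is
   recorded up to precision 2^-k on finitely many combinations by a code with
   countably many values. The codes of all levels form a forest whose vertices
   carry a representative seminorm. By Hahn-Banach, a functional dominated by
   the seminorm of one vertex extends to a family of functionals along the
   whole forest that varies as little as the seminorms do. The evaluations on
   such families span a separable Banach space of bounded functions, which
   universality embeds in [B]; each of them depends on [x] through a code, hence
   measurably, and they converge along the codes of [x].

   The calculus of |Df| (it is a seminorm in [f], a.e.) rests on the fact that it
   is the pointwise smallest relaxed slope. Weak limits are strong limits of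
   convex combinations (Mazur), and mixing two slopes with a Lipschitz cutoff
   gives again a slope, so the minimality of the norm can be localised.

   For uniqueness, [|a df + dg - dk| = |D(a f + g - k)| = |a d'f + d'g - d'k|], so
   that [df_n |-> d'f_n] extends to a linear isometry on almost every fiber. *)

From HB Require Import structures.
Require Import Defs.
From mathcomp Require Import all_boot all_order all_algebra.
From mathcomp Require Import all_classical all_reals all_analysis measurable_realfun.
From mathcomp Require Import ring lra.
Set Implicit Arguments.
Unset Strict Implicit.
Unset Printing Implicit Defensive.
Import Order.TTheory GRing.Theory Num.Theory.
Import numFieldNormedType.Exports.
Local Open Scope classical_set_scope.
Local Open Scope ring_scope.

(** * Functionals dominated by rational seminorms *)

(** Embedding each fiber separately by universality would give no control on the dependence on [x].
    Universality is therefore used once, for a single space that contains approximations of all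
    fibers, and [x] only selects vertices. This space is separable because each level has countably
    many codes, whereas the seminorms [P x] may be uncountably many. The forest shape is what makes
    Hahn-Banach sufficient: a vertex has one parent, so a functional can be carried from vertex to
    vertex without meeting two constraints at once; a general graph of close seminorms could have
    cycles. Codes of level [k] only control the first [k.+1] generators, hence for a fixed
    combination the estimates start at its size.

    Coefficients are rational because almost everywhere identities can be combined only countably
    many at a time; real scalars are recovered by density.

    On the analytic side, a cutoff [chi] costs a term [lip chi * |g - f|], harmless only because
    both approximations tend to the same function, and a mixture of Lipschitz functions is Lipschitz
    when they are bounded, whence the truncations. *)

Section rational_hahn_banach.
Context (R : realType).
Implicit Types V W : lmodType rat.

Definition qsublinear V (r : V -> R) : Prop :=
  (forall u v, r (u + v) <= r u + r v) /\
  (forall (a : rat) v, 0 < a -> r (a *: v) = ratr a * r v).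

Lemma qsublinear0 V (r : V -> R) : qsublinear r -> r 0 = 0.
Proof.
move=> [_ rZ]; have := rZ 2%:R 0 isT; rewrite scaler0 ratr_nat => h.
lra.
Qed.

Lemma qsublinear_opp V (r : V -> R) v : qsublinear r -> - r (- v) <= r v.
Proof.
move=> rS; have := rS.1 v (- v); rewrite subrr (qsublinear0 rS) => h; lra.
Qed.

(** Admissible [s] for [u] and [t] for [v] add up to an admissible [s + t] for [u + v]. Both the
    lowering of a sublinear function along a ray and the inf-convolution of two of them are infima
    of this kind. *)
Lemma qsublinear_inf V W (C : set W) (phi : V -> W -> R) :
  C 0 -> (forall s t, C s -> C t -> C (s + t)) ->
  (forall (a : rat) s, 0 < a -> C s -> C (a *: s)) ->
  (forall u v s t, phi (u + v) (s + t) <= phi u s + phi v t) ->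
  (forall (a : rat) u s, 0 < a -> phi (a *: u) (a *: s) = ratr a * phi u s) ->
  (forall v, has_lbound [set phi v s | s in C]) ->
  qsublinear (fun v => inf [set phi v s | s in C]).
Proof.
move=> C0 CD CZ phiD phiZ lb.
set r := fun v => _.
have rle v s : C s -> r v <= phi v s.
  by move=> Cs; apply: ge_inf => //; exists s.
have lbr v x : (forall s, C s -> x <= phi v s) -> x <= r v.
  move=> h; apply: lb_le_inf; first by exists (phi v 0), 0.
  by move=> _ [s Cs <-]; exact: h.
(* One inequality is enough: the converse is the same one for [a^-1] and [a *: v]. *)
have rZ (a : rat) v : 0 < a -> r (a *: v) <= ratr a * r v.
  move=> a0; have ra0 : 0 < ratr a :> R by rewrite ltr0q.
  rewrite mulrC -ler_pdivrMr//; apply: (lbr) => s Cs.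
  rewrite ler_pdivrMr// mulrC -phiZ//; apply: (rle); exact: CZ.
split.
- move=> u v; rewrite -lerBlDr; apply: (lbr) => s Cs.
  rewrite lerBlDr [_ + r v]addrC -lerBlDr; apply: (lbr) => t Ct.
  rewrite lerBlDr [_ + phi u s]addrC; apply: (le_trans _ (phiD _ _ _ _)).
  by apply: (rle); exact: CD.
- move=> a v a0; apply/eqP; rewrite eq_le rZ//=.
  have ra0 : 0 < ratr a :> R by rewrite ltr0q.
  have := rZ a^-1 (a *: v); rewrite invr_gt0 => /(_ a0).
  rewrite scalerA mulVf ?gt_eqF// scale1r fmorphV.
  by rewrite mulrC ler_pdivlMr// mulrC.
Qed.

(** For [s] and [t] in the chain, the smaller of the two bounds the infimum at [u + v] by
    [s u + t v]. The common bound [r0] keeps the infimum finite, through [- r0 (- v) <= s v]. *)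
Lemma qsublinear_chain_inf V (r0 : V -> R) (A : set (V -> R)) :
  A !=set0 -> (forall s, A s -> qsublinear s /\ forall v, s v <= r0 v) ->
  (forall s t, A s -> A t ->
    (forall v, s v <= t v) \/ (forall v, t v <= s v)) ->
  qsublinear (fun v => inf [set s v | s in A]).
Proof.
move=> [s0 As0] AS tot.
have lb v : has_lbound [set s v | s in A].
  exists (- r0 (- v)) => _ [s As <-].
  apply: (le_trans _ (qsublinear_opp v (AS _ As).1)).
  by rewrite lerN2; exact: (AS _ As).2.
set r := fun v => _.
have rle v s : A s -> r v <= s v by move=> As; apply: ge_inf => //; exists s.
have lbr v x : (forall s, A s -> x <= s v) -> x <= r v.
  move=> h; apply: lb_le_inf; first by exists (s0 v), s0.
  by move=> _ [s As <-]; exact: h.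
split.
- move=> u v; rewrite -lerBlDr; apply: (lbr) => s As.
  rewrite lerBlDr [_ + r v]addrC -lerBlDr; apply: (lbr) => t At.
  rewrite lerBlDr [_ + s u]addrC.
  case: (tot _ _ As At) => h.
    apply: (le_trans (rle _ _ As)); apply: (le_trans ((AS _ As).1.1 u v)).
    by rewrite lerD2l.
  apply: (le_trans (rle _ _ At)); apply: (le_trans ((AS _ At).1.1 u v)).
  by rewrite lerD2r.
- move=> a v a0; have ra0 : 0 < ratr a :> R by rewrite ltr0q.
  apply/eqP; rewrite eq_le; apply/andP; split.
    rewrite mulrC -ler_pdivrMr//; apply: (lbr) => s As.
    by rewrite ler_pdivrMr// mulrC -(AS _ As).1.2//; exact: rle.
  apply: (lbr) => s As; rewrite (AS _ As).1.2// ler_pM2l//; exact: rle.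
Qed.

(** Take the infimum over [t >= 0] of [p (v + t b) - t p b]; the bound at [- b] is read off at
    [t = 1]. *)
Lemma qsublinear_ray V (p : V -> R) (b : V) : qsublinear p ->
  exists q : V -> R, [/\ qsublinear q, forall v, q v <= p v & q (- b) <= - p b].
Proof.
move=> pS.
pose C := [set t : rat^o | 0 <= (t : rat)].
pose phi (x : V) (t : rat^o) := p (x + t *: b) - ratr t * p b.
have pZ (t : rat) : 0 <= t -> p (t *: b) = ratr t * p b.
  rewrite le_eqVlt => /predU1P[<-|t0'].
    by rewrite scale0r (qsublinear0 pS) rmorph0 mul0r.
  exact: pS.2.
have lb x : has_lbound [set phi x s | s in C].
  exists (- p (- x)) => _ [t t0' <-]; rewrite /phi.
  have := pS.1 (x + t *: b) (- x); rewrite addrAC subrr add0r.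
  by rewrite pZ// => h; lra.
exists (fun v => inf [set phi v s | s in C]); split.
- apply: qsublinear_inf => //.
  + by move=> s t; exact: addr_ge0.
  + by move=> a s a0 s0; apply: mulr_ge0 => //; exact: ltW.
  + move=> u v s t; rewrite /phi scalerDl addrACA rmorphD mulrDl.
    by have := pS.1 (u + s *: b) (v + t *: b) => h; lra.
  + move=> a u s a0; rewrite /phi -scalerA -scalerDr pS.2// mulrBr.
    by rewrite mulrA -rmorphM.
- move=> v; apply: ge_inf => //; exists 0; first exact: lexx.
  by rewrite /phi scale0r addr0 rmorph0 mul0r subr0.
- apply: ge_inf => //; exists 1; first exact: ler01.
  by rewrite /phi scale1r addNr (qsublinear0 pS) rmorph1 mul1r sub0r.
Qed.

(** A minimal sublinear function is additive: lowering it along the ray of [- y] or [y] changes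
    nothing, so it is odd, and an odd sublinear function is additive. *)
Lemma hahn_banach V (r0 : V -> R) : qsublinear r0 ->
  exists l : V -> R, (forall u v, l (u + v) = l u + l v) /\
    forall v, l v <= r0 v.
Proof.
move=> r0S.
pose T := {r : V -> R | qsublinear r /\ forall v, r v <= r0 v}.
pose t0 : T := exist _ r0 (conj r0S (fun v => lexx _)).
(* The order is reversed, so that the maximal element given by Zorn's lemma is a minimal
   function. *)
pose le (s t : T) := `[< forall v, sval t v <= sval s v >].
have [||A tot|[p [pS pr0]] pmin] := @ZL_preorder T t0 le.
- by move=> t; apply/asboolP.
- move=> r s t /asboolP rs /asboolP st; apply/asboolP => v.
  exact: le_trans (st v) (rs v).
- have [->|/set0P[s1 As1]] := eqVneq A set0; first by exists t0.
  pose A' := [set sval s | s in A].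
  have A'S s : A' s -> qsublinear s /\ forall v, s v <= r0 v.
    by move=> [t _ <-]; exact: (svalP t).
  have A's1 : A' (sval s1) by exists s1.
  have rS : qsublinear (fun v => inf [set s v | s in A']).
    apply: (@qsublinear_chain_inf _ r0 A') => //; first by exists (sval s1).
    move=> _ _ [s As <-] [t At <-].
    by case: (tot s t As At) => /asboolP h; [right|left].
  have rle v s : A' s -> inf [set s v | s in A'] <= s v.
    move=> As; apply: ge_inf; last by exists s.
    exists (- r0 (- v)) => _ [t At <-].
    apply: (le_trans _ (qsublinear_opp v (A'S _ At).1)).
    by rewrite lerN2; exact: (A'S _ At).2.
  have rr0 v : inf [set s v | s in A'] <= r0 v.
    exact: le_trans (rle v _ A's1) ((svalP s1).2 v).
  exists (exist (fun r : V -> R => qsublinear r /\ forall v, r v <= r0 v)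
    (fun v => inf [set s v | s in A']) (conj rS rr0)) => s As; apply/asboolP => v /=.
  by apply: (rle); exists s.
have pN y : p (- y) = - p y.
  have [r [rS rp rN]] := qsublinear_ray y pS.
  pose q : T := exist (fun r : V -> R => qsublinear r /\ forall v, r v <= r0 v)
    r (conj rS (fun v => le_trans (rp v) (pr0 v))).
  have /pmin/asboolP/(_ (- y))/= h : le (exist (fun r : V -> R =>
      qsublinear r /\ forall v, r v <= r0 v) p (conj pS pr0)) q.
    by apply/asboolP.
  apply/eqP; rewrite eq_le (le_trans h rN)/= lerNl; exact: qsublinear_opp.
exists p; split => // u v; apply/eqP; rewrite eq_le pS.1/=.
by have := pS.1 (u + v) (- v); rewrite addrK pN => h; lra.
Qed.

Definition qseminorm V (p : V -> R) : Prop :=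
  qsublinear p /\ forall v, p (- v) = p v.

Lemma qseminorm_ge0 V (p : V -> R) v : qseminorm p -> 0 <= p v.
Proof.
by move=> [pS pN]; have := qsublinear_opp v pS; rewrite pN => h; lra.
Qed.

(** The functional is taken below the inf-convolution of [p1] and [p2], which the hypothesis keeps
    bounded below. *)
Lemma qsublinear_sandwich V (p1 p2 : V -> R) :
  qsublinear p1 -> qsublinear p2 -> (forall v, 0 <= p1 v + p2 (- v)) ->
  exists l : V -> R, [/\ forall u v, l (u + v) = l u + l v,
    forall v, l v <= p1 v & forall v, l v <= p2 v].
Proof.
move=> p1S p2S p12.
pose phi (v c : V) := p1 (v - c) + p2 c.
have lb v : has_lbound [set phi v s | s in setT].
  exists (- p1 (- v)) => _ [c _ <-]; rewrite /phi.
  have := p1S.1 (v - c) (- v); rewrite addrAC subrr add0r => h.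
  by have := p12 (- c); rewrite opprK => h'; lra.
have [l [lD lr]] : exists l : V -> R, (forall u v, l (u + v) = l u + l v) /\
    forall v, l v <= inf [set phi v s | s in setT].
  apply/hahn_banach/qsublinear_inf => //.
  - move=> u v s t; rewrite /phi.
    have := p1S.1 (u - s) (v - t); have := p2S.1 s t.
    by rewrite addrACA -opprD => h1 h2; lra.
  - by move=> a u s a0; rewrite /phi -scalerBr p1S.2// p2S.2// mulrDr.
exists l; split => // v; apply: (le_trans (lr v)); apply: ge_inf => //.
  by exists 0 => //; rewrite /phi subr0 (qsublinear0 p2S) addr0.
by exists v => //; rewrite /phi subrr (qsublinear0 p1S) add0r.
Qed.

Lemma additive_opp V (W : zmodType) (l : V -> W) :
  (forall u v, l (u + v) = l u + l v) -> forall v, l (- v) = - l v.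
Proof.
move=> lD v; have l0 : l 0 = 0 by apply: (addrI (l 0)); rewrite -lD !addr0.
by apply: (addrI (l v)); rewrite -lD !subrr.
Qed.

Lemma additive_scale V (W : lmodType R) (l : V -> W) :
  (forall u v, l (u + v) = l u + l v) ->
  forall (a : rat) v, l (a *: v) = ratr a *: l v.
Proof.
move=> lD.
have l0 : l 0 = 0 by apply: (addrI (l 0)); rewrite -lD !addr0.
have lMn n v : l (v *+ n) = l v *+ n.
  by elim: n => [|n IH]; rewrite ?mulr0n// !mulrS lD IH.
have lMz (n : int) v : l (n%:~R *: v) = n%:~R *: l v.
  case: n => n; rewrite ?NegzE ?mulrNz ?scaleNr ?(additive_opp lD);
    by rewrite -!pmulrn !scaler_nat lMn.
move=> a v.
have d0 : (denq a)%:~R != 0 :> R by rewrite intr_eq0 denq_neq0.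
have d0' : (denq a)%:~R != 0 :> rat by rewrite intr_eq0 denq_neq0.
apply: (scalerI d0); rewrite -lMz !scalerA.
have e1 : (denq a)%:~R * a = (numq a)%:~R.
  by rewrite -[a in _ * a]divq_num_den mulrCA divff// mulr1.
rewrite e1 lMz; congr (_ *: _).
by rewrite -[in LHS](ratr_int _ (numq a)) -e1 rmorphM/= ratr_int.
Qed.

(** Every functional below the lowering of [p] along the ray of [b] is at least [p b] at [b]. *)
Lemma qseminorm_norming V (p : V -> R) (b : V) : qseminorm p ->
  exists l : V -> R, [/\ forall u v, l (u + v) = l u + l v,
    forall v, `|l v| <= p v & l b = p b].
Proof.
move=> pS; have [q [qS qp qN]] := qsublinear_ray b pS.1.
have [l [lD lq]] := hahn_banach qS.
have lp v : l v <= p v := le_trans (lq v) (qp v).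
have lb' : l (- b) <= - p b := le_trans (lq _) qN.
exists l; split => //.
- move=> v; rewrite ler_norml lp andbT.
  by have := lp (- v); rewrite pS.2 (additive_opp lD) => h; lra.
- by apply/eqP; rewrite eq_le lp/=; move: lb'; rewrite (additive_opp lD); lra.
Qed.

(** One edge of the forest. The new functional lies below both [t] and [l + D]; the condition for
    this, [l v <= t v + D v], comes from [l <= p]. *)
Lemma qseminorm_extension V (p t D : V -> R) (l : V -> R) :
  qseminorm t -> qseminorm D -> (forall v, p v <= t v + D v) ->
  (forall u v, l (u + v) = l u + l v) -> (forall v, l v <= p v) ->
  exists l' : V -> R, [/\ forall u v, l' (u + v) = l' u + l' v,
    forall v, `|l' v| <= t v & forall v, `|l' v - l v| <= D v].
Proof.
move=> tS DS ptD lD lp.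
have [||l' [l'D l't l'D']] :=
  @qsublinear_sandwich V t (fun v => l v + D v) tS.1.
- split => [u v|a v a0].
    by rewrite lD; have := DS.1.1 u v => h; lra.
  by rewrite (additive_scale (W := R^o) lD) DS.1.2// mulrDr.
- move=> v; rewrite DS.2 (additive_opp lD).
  by have := lp v; have := ptD v => h1 h2; lra.
exists l'; split => //.
- move=> v; rewrite ler_norml l't andbT.
  by have := l't (- v); rewrite tS.2 (additive_opp l'D) => h; lra.
- move=> v; rewrite ler_norml; have := l'D' v; have := l'D' (- v).
  rewrite DS.2 (additive_opp l'D) (additive_opp lD) => h1 h2.
  by apply/andP; split; lra.
Qed.

End rational_hahn_banach.

(** * Banach spaces spanned by bounded functions *)

Lemma cauchy_rate (R : realType) (V : completeNormedModType R)
    (u : nat -> V) (e : nat -> R) :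
  e n @[n --> \oo] --> 0 -> (forall n k, `|u n - u k| <= e n + e k) ->
  exists l : V, u n @[n --> \oo] --> l /\ forall n, `|u n - l| <= e n.
Proof.
move=> e0 ue.
have cu : cvg (u n @[n --> \oo]).
  apply/cauchy_cvgP/cauchyP => eps eps0.
  have he : \forall n \near \oo, e n < eps / 2.
    have /cvgrPdist_lt/(_ (eps / 2)) := e0.
    rewrite divr_gt0// => /(_ isT); apply: filterS => n.
    by rewrite sub0r normrN; apply: le_lt_trans; exact: ler_norm.
  have [n en] := filter_ex he.
  exists (u n); apply: filterS he => k ek.
  rewrite /= -ball_normE /=; apply: (le_lt_trans (ue _ _)); lra.
exists (lim (u n @[n --> \oo])); split => // n.
have h : `|u n - u k| @[k --> \oo] --> `|u n - lim (u n @[n --> \oo])|.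
  by apply: cvg_norm; apply: cvgB => //; exact: cvg_cst.
have h' : e n + e k @[k --> \oo] --> e n.
  by rewrite -[X in _ --> X]addr0; apply: cvgD => //; exact: cvg_cst.
apply: (ler_cvg_to h h'); apply: nearW => k; exact: ue.
Unshelve. all: by end_near. Qed.

Section span_closure.
Context (R : realType) (L : Type) (I : countType) (g : I -> L -> R).

Definition span_comb (s : seq (R * I)) (l : L) : R :=
  \sum_(p <- s) p.1 * g p.2 l.

(** The uniform closure of the span of the [g i] inside the bounded functions. [L] may be
    arbitrarily large; separability will come from [I] being countable. *)
Definition span_closure_set : set (L -> R^o) :=
  [set f | (exists M : R, forall l, `|f l| <= M) /\
    forall e : R, 0 < e -> exists s, forall l, `|f l - span_comb s l| <= e].

Definition span_closure : {pred L -> R^o} := mem span_closure_set.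

Lemma span_closureP f : reflect (span_closure_set f) (f \in span_closure).
Proof. by apply: (iffP idP); rewrite ?inE. Qed.

Lemma span_comb_scale a s l :
  span_comb [seq (a * p.1, p.2) | p <- s] l = a * span_comb s l.
Proof.
rewrite /span_comb big_map mulr_sumr; apply: eq_bigr => p _ /=.
by rewrite mulrA.
Qed.

Lemma span_comb_cat s t l :
  span_comb (s ++ t) l = span_comb s l + span_comb t l.
Proof. by rewrite /span_comb big_cat. Qed.

Fact span_closure_submod_closed : submod_closed span_closure.
Proof.
split.
  apply/span_closureP; split.
    by exists 0 => l; rewrite normr0.
  move=> e e0; exists [::] => l.
  by rewrite /span_comb big_nil subr0 normr0 ltW.
move=> a f h /span_closureP[[M fM] fs] /span_closureP[[N hN] hs].
apply/span_closureP; split.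
  exists (`|a| * M + N) => l; apply: (le_trans (ler_normD _ _)).
  by rewrite lerD// normrM ler_wpM2l.
move=> e e0.
have a0 : 0 < `|a| + 1 by rewrite ltr_wpDl.
have [s sP] := fs (e / 2 / (`|a| + 1)) (divr_gt0 (divr_gt0 e0 (ltr0Sn _ 1)) a0).
have [t tP] := hs (e / 2) (divr_gt0 e0 (ltr0Sn _ 1)).
exists ([seq (a * p.1, p.2) | p <- s] ++ t) => l.
rewrite span_comb_cat span_comb_scale.
have -> : (a *: f + h) l - (a * span_comb s l + span_comb t l) =
  a * (f l - span_comb s l) + (h l - span_comb t l).
  by rewrite /= -[(a *: f + h) l]/(a * f l + h l); ring.
apply: (le_trans (ler_normD _ _)).
rewrite [leRHS](splitr e) lerD// normrM.
apply: (@le_trans _ _ (`|a| * (e / 2 / (`|a| + 1)))); first exact: ler_wpM2l.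
rewrite mulrCA -[leRHS]mulr1 ler_wpM2l ?divr_ge0 ?(ltW e0)//.
by rewrite ler_pdivrMr// mul1r lerDl.
Qed.

HB.instance Definition _ := GRing.isSubmodClosed.Build R (L -> R^o)
  span_closure span_closure_submod_closed.

Record span_space := SpanSpace {
  span_val :> L -> R^o;
  span_valP : span_val \in span_closure
}.

HB.instance Definition _ := [isSub for span_val].
HB.instance Definition _ := [Choice of span_space by <:].
HB.instance Definition _ := [SubChoice_isSubLmodule of span_space by <:].

Definition span_norm (f : span_space) : R := sup [set `|f l| | l in setT].

Lemma span_norm_ge (f : span_space) l : `|f l| <= span_norm f.
Proof.
apply: ub_le_sup; last by exists l.
have /span_closureP[[M fM] _] := span_valP f.
by exists M => _ [k _ <-].
Qed.

Lemma span_norm_le (f : span_space) M : 0 <= M ->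
  (forall l, `|f l| <= M) -> span_norm f <= M.
Proof.
move=> M0 fM; rewrite /span_norm.
(* If [L] is empty the supremum is [0] by convention; only here does [0 <= M] matter. *)
have [->|/set0P A0] := eqVneq [set `|f l| | l in setT] set0.
  by rewrite sup0.
by apply: ge_sup => // _ [l _ <-].
Qed.

Lemma span_norm_ge0 (f : span_space) : 0 <= span_norm f.
Proof.
rewrite /span_norm; have [->|/set0P[_ [l _ _]]] :=
  eqVneq [set `|f l| | l in setT] set0; first by rewrite sup0.
exact: le_trans (span_norm_ge f l).
Qed.

Fact span_normD (x y : span_space) :
  span_norm (x + y) <= span_norm x + span_norm y.
Proof.
apply: span_norm_le; first by rewrite addr_ge0 ?span_norm_ge0.
move=> l; apply: (le_trans (ler_normD _ _)).
by apply: lerD; exact: span_norm_ge.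
Qed.

Fact span_normZ (a : R) (x : span_space) :
  span_norm (a *: x) = `|a| * span_norm x.
Proof.
have le b y : span_norm (b *: y) <= `|b| * span_norm y.
  apply: span_norm_le; first by rewrite mulr_ge0 ?span_norm_ge0.
  move=> l; rewrite [X in `|X|](_ : _ = b * y l)// normrM ler_wpM2l//.
  exact: span_norm_ge.
apply/eqP; rewrite eq_le le/=.
have [->|a0] := eqVneq a 0; first by rewrite normr0 mul0r span_norm_ge0.
have := le a^-1 (a *: x); rewrite scalerA mulVf// scale1r normfV.
by rewrite mulrC ler_pdivlMr ?normr_gt0// mulrC.
Qed.

Fact span_norm_eq0 (x : span_space) : span_norm x = 0 -> x = 0.
Proof.
move=> x0; apply/val_inj/funext => l /=.
have := span_norm_ge x l; rewrite x0 normr_le0 => /eqP ->.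
by [].
Qed.

HB.instance Definition _ := Lmodule_isNormed.Build R span_space
  span_normD span_normZ span_norm_eq0.

Lemma span_norm_le_iff (f : span_space) M : 0 <= M ->
  `|f| <= M <-> forall l, `|f l| <= M.
Proof.
move=> M0; split => [fM l|]; last exact: span_norm_le.
exact: le_trans (span_norm_ge f l) fM.
Qed.

Fact span_space_complete (F : set_system span_space) :
  ProperFilter F -> cauchy F -> cvg F.
Proof.
move=> FF /cauchyP Fc.
pose e n : R := 2^-1 ^+ n.
have e_gt0 n : 0 < e n by rewrite exprn_gt0// invr_gt0.
(* The Cauchy filter is replaced by centers of small balls that belong to it; any two of these balls
   meet, so the centers form a Cauchy sequence. *)
have /choice[x xP] : forall n, exists x, F (ball x (e n)) by move=> n; exact: Fc.
have xe n k l : `|x n l - x k l| <= e n + e k.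
  have [y [xny xky]] := filter_ex (filterI (xP n) (xP k)).
  move: xny xky; rewrite -!ball_normE/= => xny xky.
  have -> : x n l - x k l = (x n - y) l - (x k - y) l.
    rewrite -[(x n - y) l]/(x n l - y l) -[(x k - y) l]/(x k l - y l).
    by rewrite opprB addrA subrK.
  apply: (le_trans (ler_normB _ _)); apply: lerD.
    exact: (le_trans (span_norm_ge _ _) (ltW xny)).
  exact: (le_trans (span_norm_ge _ _) (ltW xky)).
have e0 : e n @[n --> \oo] --> 0.
  by apply: cvg_expr; rewrite ger0_norm ?invr_ge0// invf_lt1// ltr1n.
have /choice[h hP] : forall l, exists y : R, forall n, `|x n l - y| <= e n.
  move=> l.
  have [//|y [_ yP]] := @cauchy_rate R R^o (fun n => x n l) e e0 _.
  by exists y.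
have hS : (h : L -> R^o) \in span_closure.
  apply/span_closureP; split.
    have /span_closureP[[M xM] _] := span_valP (x 0%N).
    exists (M + e 0%N) => l.
    have -> : h l = x 0%N l - (x 0%N l - h l) by rewrite opprB addrC subrK.
    by apply: (le_trans (ler_normB _ _)); apply: lerD.
  move=> eps eps0.
  have [n en] : exists n, e n <= eps / 2.
    have /cvgrPdist_lt/(_ (eps / 2)) := e0.
    rewrite divr_gt0// => /(_ isT) [n _ /(_ n (leqnn n))].
    rewrite sub0r normrN ger0_norm ?ltW// => en; exists n; exact: ltW.
  have /span_closureP[_ /(_ (eps / 2))] := span_valP (x n).
  rewrite divr_gt0// => /(_ isT)[s sP]; exists s => l.
  have -> : h l - span_comb s l = (x n l - span_comb s l) - (x n l - h l).
    by ring.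
  apply: (le_trans (ler_normB _ _)); rewrite [leRHS]splitr lerD//.
  exact: le_trans en.
pose hh := SpanSpace hS.
apply/cvg_ex; exists hh; apply/cvgrPdist_lt => eps eps0.
have [n en] : exists n, e n < eps / 2.
  have /cvgrPdist_lt/(_ (eps / 2)) := e0.
  rewrite divr_gt0// => /(_ isT) [n _ /(_ n (leqnn n))].
  by rewrite sub0r normrN ger0_norm ?ltW// => en; exists n.
near=> y.
have : ball (x n) (e n) y by near: y; exact: xP.
rewrite -ball_normE/= => xny.
have xh : `|x n - hh| <= e n by apply/span_norm_le_iff; [exact: ltW|move=> l; exact: hP].
have -> : hh - y = (x n - y) - (x n - hh) by rewrite opprB [RHS]addrC subrKA.
apply: (le_lt_trans (ler_normB _ _)); lra.
Unshelve. all: by end_near. Qed.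

HB.instance Definition _ := Uniform_isComplete.Build span_space
  span_space_complete.

Hypothesis g_bounded : forall i, exists M : R, forall l, `|g i l| <= M.

Lemma span_comb_bounded s : exists M : R, forall l, `|span_comb s l| <= M.
Proof.
elim: s => [|[a i] s [M sM]].
  by exists 0 => l; rewrite /span_comb big_nil normr0.
have [N gN] := g_bounded i; exists (`|a| * N + M) => l.
rewrite /span_comb big_cons; apply: (le_trans (ler_normD _ _)).
by apply: lerD; [rewrite normrM ler_wpM2l|exact: sM].
Qed.

Fact span_comb_in s : (span_comb s : L -> R^o) \in span_closure.
Proof.
apply/span_closureP; split; first exact: span_comb_bounded.
by move=> e e0; exists s => l; rewrite subrr normr0 ltW.
Qed.

Definition span_gen (i : I) : span_space := SpanSpace (span_comb_in [:: (1, i)]).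

Lemma span_gen_sum s l :
  (\sum_(p <- s) p.1 *: span_gen p.2 : span_space) l = span_comb s l.
Proof.
elim: s => [|[a i] s IH]; first by rewrite /span_comb !big_nil.
rewrite big_cons [span_comb _ _]big_cons.
rewrite -[LHS]/(a * span_comb [:: (1, i)] l +
  (\sum_(p <- s) p.1 *: span_gen p.2 : span_space) l) IH.
by rewrite /span_comb big_cons big_nil mul1r addr0.
Qed.

Lemma span_space_separable : separable span_space.
Proof.
pose q (s : seq (rat * I)) : span_space :=
  \sum_(p <- [seq (ratr p.1 : R, p.2) | p <- s]) p.1 *: span_gen p.2.
exists (range q); first exact: (sub_countable (card_image_le _ _)).
move=> U [f Uf] Uo.
have [e /= e0 eU] : nbhs_ball f U by rewrite nbhs_ballE; exact: open_nbhs_nbhs.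
have /span_closureP[_ /(_ (e / 4))] := span_valP f.
rewrite divr_gt0// => /(_ isT)[s sP].
have [t tP] : exists t : seq (rat * I), forall l,
   `|span_comb s l - span_comb [seq (ratr p.1 : R, p.2) | p <- t] l| <= e / 4.
  have : 0 < e / 4 by rewrite divr_gt0.
  move: (e / 4) {sP}; elim: s => [|[a i] s IH] d d0.
    by exists [::] => l; rewrite subrr normr0 ltW.
  have [t tP] := IH (d / 2) (divr_gt0 d0 (ltr0Sn _ 1)).
  have [N gN] := g_bounded i.
  have N0 : 0 < `|N| + 1 by rewrite ltr_wpDl.
  pose d' := d / 2 / (`|N| + 1).
  have d'0 : 0 < d' by rewrite /d' !divr_gt0.
  have [b] : exists b : rat, ratr b \in `]a - d', a + d'[.
    by apply: rat_in_itvoo; lra.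
  rewrite in_itv/= => /andP[b1 b2].
  have ab : `|a - ratr b| <= d' by rewrite ler_norml; apply/andP; split; lra.
  exists ((b, i) :: t) => l /=.
  rewrite /span_comb !big_cons/= opprD addrACA -mulrBl.
  apply: (le_trans (ler_normD _ _)); rewrite [leRHS](splitr d) lerD//.
    rewrite normrM; apply: (@le_trans _ _ (d' * (`|N| + 1))).
      apply: ler_pM => //; apply: (le_trans (gN l)).
      by apply: (le_trans (ler_norm _)); rewrite lerDl.
    by rewrite /d' divfK// gt_eqF.
  exact: tP.
exists (q t); split; last by exists t.
apply: eU; rewrite -ball_normE/=.
apply: (@le_lt_trans _ _ (e / 2)); last by lra.
apply/span_norm_le_iff; first by lra.
move=> l; rewrite -[X in `|X|]/(f l - q t l) span_gen_sum.
rewrite -(subrKA (span_comb s l)); apply: (le_trans (ler_normD _ _)).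
have := sP l; have := tP l; lra.
Qed.

(** All that is needed later about the embedded space: the supremum norm is hidden in an equivalence
    of bounds, and only finite sums of the images [z i] occur. *)
Lemma universal_functions (B : completeNormedModType R) :
  universal_separable_banach B ->
  exists z : I -> B, forall (s : seq (R * I)) (M : R), 0 <= M ->
    `|\sum_(p <- s) p.1 *: z p.2| <= M <-> forall l, `|span_comb s l| <= M.
Proof.
move=> [_ /(_ _ span_space_separable)[i iP]].
exists (fun k => i (span_gen k)) => s M M0.
under eq_bigr do rewrite -linearZ.
rewrite -linear_sum iP span_norm_le_iff//.
by split => h l; have := h l; rewrite span_gen_sum.
Qed.

End span_closure.

(** * Measurable isometric embedding of a field of seminorms *)

Section compatible_families.
Context (R : realType) (V : lmodType rat) (X : Type).
Variables (P : X -> V -> R) (rep : nat -> X -> X) (E : nat -> X -> V -> R).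

Definition dual_ball (p : V -> R) : set (V -> R) :=
  [set l | (forall u v, l (u + v) = l u + l v) /\ forall v, `|l v| <= p v].

(* The pairs [(k, z)] are the vertices of a forest in which [(k, rep k z)] is
   the parent of [(k.+1, z)]. *)
Definition compatible_family (l : nat -> X -> V -> R) : Prop :=
  (forall k z, dual_ball (P z) (l k z)) /\
  (forall k z v, `|l k.+1 z v - l k (rep k z) v| <= E k z v).

Hypothesis PS : forall x, qseminorm (P x).
Hypothesis ES : forall k z, qseminorm (E k z).
Hypothesis P_down : forall k z v, P z v <= P (rep k z) v + E k z v.
Hypothesis P_up : forall k z v, P (rep k z) v <= P z v + E k z v.

Lemma dual_ball0 p : qseminorm p -> dual_ball p (fun=> 0).
Proof.
move=> pS; split => [u v|v]; first by rewrite addr0.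
by rewrite normr0; exact: qseminorm_ge0.
Qed.

Lemma dual_ball_extension (p t D : V -> R) (l : V -> R) :
  qseminorm t -> qseminorm D -> (forall v, p v <= t v + D v) ->
  dual_ball p l ->
  exists2 l', dual_ball t l' & forall v, `|l' v - l v| <= D v.
Proof.
move=> tS DS ptD [lD lp].
have [v|l' [l'D l't l'l]] := qseminorm_extension tS DS ptD lD.
  exact: le_trans (ler_norm _) (lp v).
by exists l'.
Qed.

(** Downwards, each value is obtained from the one at the parent only, so the choices never
    conflict. [G j] lives on level [n + j]. *)
Lemma family_below n (F : X -> V -> R) : (forall z, dual_ball (P z) (F z)) ->
  exists G : nat -> X -> V -> R, [/\ G 0%N = F,
    forall j z, dual_ball (P z) (G j z) &
    forall j z v, `|G j.+1 z v - G j (rep (n + j) z) v| <= E (n + j) z v].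
Proof.
move=> FP.
(* Outside the dual ball the choice is arbitrary; the recursion never gets there. *)
have /choice[ext extP] : forall kzl : nat * X * (V -> R), exists l',
    dual_ball (P (rep kzl.1.1 kzl.1.2)) kzl.2 -> dual_ball (P kzl.1.2) l' /\
      forall v, `|l' v - kzl.2 v| <= E kzl.1.1 kzl.1.2 v.
  move=> [[k z] l] /=.
  have [lP|nlP] := pselect (dual_ball (P (rep k z)) l); last by exists l.
  have [l' l'P l'E] :=
    dual_ball_extension (PS z) (ES k z) (P_up k z) lP.
  by exists l'.
pose G := fix G j : X -> V -> R := match j with
  | 0%N => F
  | j'.+1 => fun z => ext (n + j', z, G j' (rep (n + j') z))%N
  end.
have GP j z : dual_ball (P z) (G j z).
  elim: j z => [//|j IH] z.
  by have [] := extP (n + j, z, G j (rep (n + j) z))%N (IH _).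
exists G; split => // j z.
by have [] := extP (n + j, z, G j (rep (n + j) z))%N (GP _ _).
Qed.

(** Induction on the level: carry [l] to the parent of [z], take a family through it, replace its
    value at [z] by [l] and rebuild everything below that level. *)
Lemma compatible_family_extension k z l : dual_ball (P z) l ->
  exists2 f, compatible_family f & f k z = l.
Proof.
elim: k z l => [|k IH] z l lP.
  pose F x := if `[< x = z >] then l else fun=> 0.
  have FP x : dual_ball (P x) (F x).
    rewrite /F; case: asboolP => [->//|_]; exact: dual_ball0.
  have [G [G0 GP GE]] := family_below 0 FP.
  exists G; last by rewrite G0 /F; case: asboolP.
  by split => // j x v; have := GE j x v; rewrite add0n.
have [l' l'P l'l] :=
  dual_ball_extension (PS (rep k z)) (ES k z) (P_down k z) lP.
have [f [fP fE] fl] := IH _ _ l'P.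
pose F x := if `[< x = z >] then l else f k.+1 x.
have FP x : dual_ball (P x) (F x).
  by rewrite /F; case: asboolP => [->//|_].
have [G [G0 GP GE]] := family_below k.+1 FP.
exists (fun j => if (j <= k)%N then f j else G (j - k.+1)%N); last first.
  by rewrite ltnn subnn G0 /F; case: asboolP.
split => [j x|j x v].
  by case: ifP => _.
case: (ltngtP j k) => [jk|jk|->].
- exact: fE.
- by rewrite subSn//; have := GE (j - k.+1)%N x v; rewrite subnKC.
- rewrite subnn G0 /F; case: asboolP => [->|_]; last exact: fE.
  by rewrite fl distrC.
Qed.

End compatible_families.

(** * Seminorms on finitely supported rational sequences, encoded as polynomials *)

Section polynomial_seminorms.
Context (R : realType).
Implicit Types (p q : {poly rat} -> R) (b c : {poly rat}).

Lemma qseminormZ (V : lmodType rat) (p : V -> R) (a : rat) v :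
  qseminorm p -> p (a *: v) = ratr `|a| * p v.
Proof.
move=> pS; case: (ltrgt0P a) => [a0|a0|->]; first exact: pS.1.2.
  by rewrite -pS.2 -scaleNr pS.1.2// oppr_gt0.
by rewrite scale0r (qsublinear0 pS.1) rmorph0 mul0r.
Qed.

Lemma qseminorm_sum (V : lmodType rat) (p : V -> R) I (s : seq I) (F : I -> V) :
  qseminorm p -> p (\sum_(i <- s) F i) <= \sum_(i <- s) p (F i).
Proof.
move=> pS; elim: s => [|i s IH]; first by rewrite !big_nil (qsublinear0 pS.1).
by rewrite !big_cons; apply: (le_trans (pS.1.1 _ _)); rewrite lerD2l.
Qed.

Lemma qseminorm_poly_le p b n : qseminorm p -> (size b <= n)%N ->
  p b <= \sum_(i < n) ratr `|b`_i| * p 'X^i.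
Proof.
move=> pS bn.
have {1}-> : b = \sum_(i < n) b`_i *: 'X^i.
  rewrite -poly_def; apply/polyP => i; rewrite coef_poly.
  by case: ltnP => // ni; rewrite nth_default// (leq_trans bn).
apply: (le_trans (qseminorm_sum _ _ pS)); apply: ler_sum => i _.
by rewrite qseminormZ.
Qed.

Definition weighted_norm (w : nat -> R) b : R :=
  \sum_(i < size b) ratr `|b`_i| * w i.

Lemma weighted_normE w b n : (size b <= n)%N ->
  weighted_norm w b = \sum_(i < n) ratr `|b`_i| * w i.
Proof.
move=> bn; rewrite /weighted_norm.
rewrite (big_ord_widen n (fun i => ratr `|b`_i| * w i) bn).
rewrite [RHS](bigID (fun i : 'I_n => (i < size b)%N))/=.
rewrite [X in _ = _ + X]big1 ?addr0// => i; rewrite -leqNgt => bi.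
by rewrite nth_default// normr0 rmorph0 mul0r.
Qed.

Lemma weighted_norm_qseminorm w : (forall i, 0 <= w i) ->
  qseminorm (weighted_norm w).
Proof.
move=> w0; split; [split|].
- move=> u v; pose n := maxn (size u) (size v).
  rewrite (@weighted_normE _ u n) ?leq_maxl// (@weighted_normE _ v n) ?leq_maxr//.
  rewrite (@weighted_normE _ (u + v) n); last exact: size_polyD.
  rewrite -big_split/=; apply: ler_sum => i _.
  rewrite -mulrDl ler_wpM2r// -rmorphD/= ler_rat coefD; exact: ler_normD.
- move=> a v a0; rewrite (@weighted_normE _ (a *: v) (size v)).
    rewrite mulr_sumr; apply: eq_bigr => i _.
    by rewrite coefZ normrM gtr0_norm// rmorphM/= mulrA.
  exact: size_scale_leq.
- move=> v; rewrite /weighted_norm size_polyN; apply: eq_bigr => i _.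
  by rewrite coefN normrN.
Qed.

(** Coefficients range over the mesh of step [1 / M] in [[-1, 1]], as the values of [f] run from [0]
    to [2 M]. *)
Definition grid (k M : nat) : seq {poly rat} :=
  [seq \poly_(i < k.+1) ((f (inord i))%:R / M%:R - 1)
  | f : {ffun 'I_k.+1 -> 'I_(M + M).+1}].

Lemma grid_approx k M b : (0 < M)%N -> (size b <= k.+1)%N ->
  (forall i, `|b`_i| <= 1) ->
  exists2 c, c \in grid k M &
    (size c <= k.+1)%N /\ forall i, `|(b - c)`_i| <= M%:R^-1.
Proof.
move=> M0 bk b1.
have M0' : 0 < M%:R :> rat by rewrite ltr0n.
pose f : {ffun 'I_k.+1 -> 'I_(M + M).+1} :=
  [ffun i : 'I_k.+1 => inord (Num.truncn ((b`_i + 1) * M%:R))].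
exists (\poly_(i < k.+1) ((f (inord i))%:R / M%:R - 1)).
  by apply/fintype.imageP; exists f.
split=> [|i]; first exact: size_poly.
rewrite coefB coef_poly; case: ltnP => ik; last first.
  rewrite nth_default; last exact: leq_trans ik.
  by rewrite subrr normr0 invr_ge0 ltW.
have ii : (inord i : 'I_k.+1) = i :> nat by rewrite inordK.
rewrite ffunE ii; have := b1 i; rewrite ler_norml => /andP[bl bu].
have x0 : 0 <= (b`_i + 1) * M%:R by apply: mulr_ge0; [lra|exact: ltW].
have /andP[tl tu] := truncn_itv x0.
set t := Num.truncn _ in tl tu *.
have tM : (t <= M + M)%N.
  rewrite -(ler_nat rat) natrD; apply: (le_trans tl).
  have := ler_wpM2r (ltW M0') bu; rewrite mulrDl !mul1r => h; lra.
rewrite inordK//.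
have -> : b`_i - (t%:R / M%:R - 1) = ((b`_i + 1) * M%:R - t%:R) / M%:R.
  by field; rewrite gt_eqF.
rewrite normrM normfV (gtr0_norm M0') -[leRHS]mul1r ler_wpM2r ?invr_ge0 ?ltW//.
rewrite ger0_norm ?subr_ge0//; move: tu; rewrite -natr1 => tu; lra.
Qed.

(** Normalise [b] so that its coefficients have absolute sum [1], and round them to the grid. As [m]
    bounds the seminorms of the generators, the mesh [1 / (m 2^(k+2))] makes rounding cost
    [2^-(k+2)] for each of [p] and [q]. The comparison on the grid costs as much again, and three
    times this is below [2^-k]. *)
Lemma qseminorm_grid_le p q k m b : qseminorm p -> qseminorm q -> (0 < m)%N ->
  \sum_(i < k.+1) p 'X^i <= m%:R -> \sum_(i < k.+1) q 'X^i <= m%:R ->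
  (forall c, c \in grid k (m * 2 ^ k.+2) -> `|p c - q c| <= 2^-1 ^+ k.+2) ->
  (size b <= k.+1)%N ->
  p b <= q b + 2^-1 ^+ k * \sum_(i < k.+1) ratr `|b`_i|.
Proof.
move=> pS qS m0 pm qm pq bk.
set e := 2^-1 ^+ k.+2 in pq.
have e0 : 0 < e by rewrite exprn_gt0.
have e4 : 2^-1 ^+ k = 4 * e by rewrite /e !exprS; lra.
pose s := \sum_(i < k.+1) `|b`_i|.
have s0 : 0 <= s by apply: sumr_ge0.
have -> : \sum_(i < k.+1) ratr `|b`_i| = ratr s :> R by rewrite rmorph_sum.
have [seq0|sneq0] := eqVneq s 0.
  rewrite seq0 rmorph0 mulr0 addr0.
  apply: (@le_trans _ _ 0); last exact: qseminorm_ge0.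
  apply: (le_trans (qseminorm_poly_le pS bk)); rewrite big1// => i _.
  move: seq0 => /eqP; rewrite psumr_eq0// => /allP/(_ i).
  by rewrite mem_index_enum => /(_ isT)/= /eqP ->; rewrite rmorph0 mul0r.
have sgt0 : 0 < s by rewrite lt_neqAle eq_sym sneq0.
pose b' := s^-1 *: b.
have b'k : (size b' <= k.+1)%N by apply: leq_trans bk; exact: size_scale_leq.
have b'1 i : `|b'`_i| <= 1.
  rewrite coefZ normrM normfV (gtr0_norm sgt0) mulrC ler_pdivrMr// mul1r.
  have [ik|ki] := ltnP i k.+1; last first.
    by rewrite nth_default ?normr0//; exact: leq_trans ki.
  by rewrite /s (bigD1 (Ordinal ik))//= lerDl sumr_ge0.
have M0 : (0 < m * 2 ^ k.+2)%N by rewrite muln_gt0 m0 expn_gt0.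
have [c cg [ck cb]] := grid_approx M0 b'k b'1.
have small r : qseminorm r -> \sum_(i < k.+1) r 'X^i <= m%:R -> r (b' - c) <= e.
  move=> rS rm.
  have bck : (size (b' - c)%R <= k.+1)%N.
    by apply: (leq_trans (size_polyD _ _)); rewrite size_polyN geq_max b'k ck.
  apply: (le_trans (qseminorm_poly_le rS bck)).
  apply: (@le_trans _ _ (\sum_(i < k.+1) (m * 2 ^ k.+2)%:R^-1 * r 'X^i)).
    apply: ler_sum => i _; apply: ler_wpM2r; first exact: qseminorm_ge0.
    apply: (@le_trans _ _ (ratr ((m * 2 ^ k.+2)%:R^-1))); first by rewrite ler_rat.
    by rewrite fmorphV/= ratr_nat.
  rewrite -mulr_sumr natrM invfM -mulrA mulrCA natrX -exprVn.
  rewrite -[leRHS]mulr1 ler_wpM2l ?(ltW e0)// mulrC ler_pdivrMr ?ltr0n//.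
  by rewrite mul1r.
have h : p b' <= q b' + 2^-1 ^+ k.
  have h1 : p b' <= p c + e.
    rewrite -{1}(subrK c b') addrC; apply: (le_trans (pS.1.1 _ _)).
    by rewrite lerD2l small.
  have h2 : q c <= q b' + e.
    have -> : c = b' + - (b' - c) by rewrite opprB addrC subrK.
    apply: (le_trans (qS.1.1 _ _)); rewrite lerD2l qS.2; exact: small.
  have := pq c cg; rewrite ler_norml => /andP[_ h3].
  rewrite e4; lra.
have -> : b = s *: b' by rewrite /b' scalerA divff// scale1r.
rewrite (qseminormZ s b' pS) (qseminormZ s b' qS) (gtr0_norm sgt0) [X in _ + X]mulrC -mulrDr.
by rewrite ler_pM2l// ltr0q.
Qed.

End polynomial_seminorms.

(** * Borel measurability of limits and of functions of countable codes *)

Section borel_functions.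
Context (R : realType) d (X : measurableType d) (B : normedModType R).

Lemma measurable_fun_borel (h : X -> B) :
  (forall U : set B, open U -> measurable (h @^-1` U)) ->
  measurable_fun setT (h : X -> borel B).
Proof.
move=> hU; apply: (@measurability _ _ X (borel B) setT _ (@open B)) => //.
by move=> _ [U oU <-]; rewrite setTI; exact: hU.
Qed.

Lemma measurable_borel_preimage (h : X -> B) (U : set B) :
  measurable_fun setT (h : X -> borel B) -> open U -> measurable (h @^-1` U).
Proof.
move=> mh oU; rewrite -[_ @^-1` _]setTI; apply: mh => //.
exact: sub_sigma_algebra.
Qed.

(** With [F i] the open neighbourhood of radius [1 / (i + 1)] of the complement of [U], the limit
    lies in [U] if and only if, for some [i], the sequence eventually avoids [F i]. *)
Lemma measurable_fun_cvg_borel (f : nat -> X -> B) (h : X -> B) :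
  (forall n, measurable_fun setT (f n : X -> borel B)) ->
  (forall x, f n x @[n --> \oo] --> h x) ->
  measurable_fun setT (h : X -> borel B).
Proof.
move=> mf fh; apply: measurable_fun_borel => U oU.
pose F i : set B := [set y | exists2 z, ~ U z & `|y - z| < i.+1%:R^-1].
have oF i : open (F i).
  rewrite openE => y [z nUz yz]; rewrite /interior -nbhs_ballE/=.
  exists (i.+1%:R^-1 - `|y - z|); first by rewrite /= subr_gt0.
  move=> t; rewrite -ball_normE/= => yt; exists z => //.
  rewrite -(subrKA y); apply: (le_lt_trans (ler_normD _ _)).
  by rewrite distrC -ltrBrDr.
have -> : h @^-1` U = \bigcup_i \bigcup_n \bigcap_(k in [set k | (n <= k)%N])
    (f k @^-1` (~` F i)).
  apply/seteqP; split => x /=.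
    move=> Uhx; have : nbhs (h x) U by exact: open_nbhs_nbhs.
    rewrite -nbhs_ballE => -[e /= e0 eU].
    have e2 : 0 < e / 2 by rewrite divr_gt0.
    have [i iP] : exists i : nat, i.+1%:R^-1 < e / 2.
      have [i _ /(_ i (leqnn i))] := near_infty_natSinv_lt (PosNum e2).
      by exists i.
    have /cvgrPdist_lt/(_ _ e2)[n _ nP] := fh x.
    exists i => //; exists n => // k /= nk [z nUz kz]; apply: nUz; apply: eU.
    rewrite -ball_normE/= -(subrKA (f k x)); apply: (le_lt_trans (ler_normD _ _)).
    by rewrite (splitr e); apply: ltrD; [exact: nP|exact: lt_trans iP].
  move=> [i _ [n _ nP]]; apply: contrapT => nUhx.
  have /cvgrPdist_lt/(_ i.+1%:R^-1) := fh x.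
  rewrite invr_gt0 ltr0n => /(_ isT)[k _ kP].
  apply: (nP (maxn n k)); first exact: leq_maxl.
  by exists (h x) => //; rewrite distrC; apply: kP; exact: leq_maxr.
apply: bigcupT_measurable => i; apply: bigcupT_measurable => n.
apply: bigcap_measurable; first by exists n => /=.
move=> k _; rewrite preimage_setC; apply: measurableC.
exact: (measurable_borel_preimage (mf k) (oF i)).
Qed.

End borel_functions.

Section measurable_codes.
Context (R : realType) d (X : measurableType d).

Lemma measurable_truncn_eq (f : X -> R) n : measurable_fun setT f ->
  (forall x, 0 <= f x) -> measurable [set x | Num.truncn (f x) = n].
Proof.
move=> mf f0.
have -> : [set x | Num.truncn (f x) = n] = f @^-1` `[n%:R, n.+1%:R[%classic.
  apply/seteqP; split => x /=; rewrite in_itv/=.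
    by move=> <-; exact: truncn_itv.
  exact: truncn_def.
by rewrite -[_ @^-1` _]setTI; apply: mf => //; exact: measurable_itv.
Qed.

Lemma measurable_map_eq (I T : eqType) (h : I -> X -> T) (s : seq I) (t : seq T) :
  (forall i u, measurable [set x | h i x = u]) ->
  measurable [set x | [seq h i x | i <- s] = t].
Proof.
move=> mh; elim: s t => [|i s IH] [|u t] /=.
- by rewrite [X in measurable X](_ : _ = setT)//; apply/seteqP; split.
- by rewrite [X in measurable X](_ : _ = set0)//; apply/seteqP; split.
- by rewrite [X in measurable X](_ : _ = set0)//; apply/seteqP; split.
- rewrite [X in measurable X](_ : _ =
    [set x | h i x = u] `&` [set x | [seq h i x | i <- s] = t]).
    exact: measurableI.
  by apply/seteqP; split => x /= [-> ->].
Qed.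

Lemma measurable_countable_preimage (T : countType) (h : X -> T) (A : set T) :
  (forall t, measurable [set x | h x = t]) -> measurable (h @^-1` A).
Proof.
move=> mh.
have -> : h @^-1` A = \bigcup_t ([set x | h x = t] `&` [set _ | A t]).
  apply/seteqP; split => x /=; first by move=> Ah; exists (h x).
  by move=> [t _ [/= -> ?]].
apply: countable_bigcupT_measurable; first exact: countableP.
move=> t; have [At|nAt] := pselect (A t).
  rewrite [X in _ `&` X](_ : _ = setT) ?setIT//.
  by apply/seteqP; split.
rewrite [X in _ `&` X](_ : _ = set0) ?setI0//.
by apply/seteqP; split.
Qed.

End measurable_codes.

Section measurable_embedding.
Context (R : realType) d (X : measurableType d) (B : completeNormedModType R).
Variable P : X -> {poly rat} -> R.
Hypothesis PS : forall x, qseminorm (P x).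
Hypothesis mP : forall c, measurable_fun setT (fun x => P x c).
Hypothesis univ : universal_separable_banach B.

Let bound k x : nat := (Num.truncn (\sum_(i < k.+1) P x 'X^i)).+1.

(** The bound is part of the code because it fixes the mesh: points with the same code are compared
    on the same grid, with values rounded down to multiples of [2^-(k+2)]. *)
Let code k x : nat * seq nat := (bound k x,
  [seq Num.truncn (P x c * 2 ^+ k.+2) | c <- grid k (bound k x * 2 ^ k.+2)]).

(** All levels up to [k] are recorded, so that the classes of level [k.+1] refine those of level
    [k]; this is what makes the vertices a forest. *)
Let codes k x := [seq code j x | j <- iota 0 k.+1].

Let node k s : X := xget point [set y | codes k y = s].

Let rep k x := node k (codes k x).

(* Points with the same code of level [k] have seminorms that differ by about
   [2^-1 ^+ k] on 'X^0, ..., 'X^k; nothing is known on the higher powers, where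
   the weight is the trivial bound. *)
Let weight k x y (i : nat) : R :=
  if (i <= k)%N then 2^-1 ^+ k else P x 'X^i + P y 'X^i.

Let E k z := weighted_norm (weight k z (rep k z)).

Let codesP k x y :
  codes k x = codes k y <-> forall j, (j <= k)%N -> code j x = code j y.
Proof.
rewrite /codes; split => [/eq_in_map h j jk|h].
  by apply: h; rewrite mem_iota.
by apply/eq_in_map => j; rewrite mem_iota ltnS => /andP[_ /h].
Qed.

Let codes_rep k x : codes k (rep k x) = codes k x.
Proof. exact: (@xgetPex _ point [set y | codes k y = codes k x] (ex_intro _ x erefl)). Qed.

Let rep_rep k x : rep k (rep k.+1 x) = rep k x.
Proof.
congr (node k _); apply/codesP => j jk.
by have /codesP/(_ j (leqW jk)) := codes_rep k.+1 x.
Qed.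

Let weight_ge0 k x y i : 0 <= weight k x y i.
Proof.
rewrite /weight; case: ifP => _; first by rewrite exprn_ge0.
by rewrite addr_ge0// qseminorm_ge0.
Qed.

Let weightC k x y : weight k x y = weight k y x.
Proof. by apply/funext => i; rewrite /weight addrC. Qed.

Let weighted_norm_small k x y (c : {poly rat}) : (size c <= k.+1)%N ->
  weighted_norm (weight k x y) c = 2^-1 ^+ k * \sum_(i < size c) ratr `|c`_i|.
Proof.
move=> ck; rewrite /weighted_norm mulr_sumr; apply: eq_bigr => i _.
by rewrite /weight -ltnS (leq_trans (ltn_ord i) ck) mulrC.
Qed.

(** The part of degree at most [k] is compared on the grid. The rest is bounded by its size for
    [P x] plus its size for [P y], which is what the weight of the higher powers charges. *)
Let code_close k x y (b : {poly rat}) : code k x = code k y ->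
  P x b <= P y b + weighted_norm (weight k x y) b.
Proof.
move=> cxy; have bxy : bound k x = bound k y := congr1 fst cxy.
have := congr1 snd cxy; rewrite /= -bxy => /eq_in_map gxy.
have small (c : {poly rat}) : (size c <= k.+1)%N -> P x c <= P y c + weighted_norm (weight k x y) c.
  move=> ck; rewrite weighted_norm_small//.
  have -> : \sum_(i < size c) ratr `|c`_i| = \sum_(i < k.+1) ratr `|c`_i| :> R.
    have := weighted_normE (fun=> 1 : R) ck; rewrite /weighted_norm.
    by under eq_bigr do rewrite mulr1; under [in RHS]eq_bigr do rewrite mulr1.
  apply: (@qseminorm_grid_le _ _ _ _ (bound k x)) => //.
  - by rewrite /bound; apply: ltW; exact: truncnS_gt.
  - by rewrite bxy; apply: ltW; exact: truncnS_gt.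
  - move=> e /gxy; set s := (2 ^+ k.+2 : R) => es.
    have s0 : 0 < s by rewrite exprn_gt0.
    have /truncn_itv/andP[l1 u1] : 0 <= P x e * s.
      by rewrite mulr_ge0 ?(ltW s0)// qseminorm_ge0.
    have /truncn_itv/andP[l2 u2] : 0 <= P y e * s.
      by rewrite mulr_ge0 ?(ltW s0)// qseminorm_ge0.
    rewrite exprVn -/s -[leRHS]mul1r ler_pdivlMr// -{1}(gtr0_norm s0).
    rewrite -normrM mulrBl ler_norml; move: l2 u1 u2 l1.
    by rewrite es -!natr1 => *; apply/andP; split; lra.
pose b1 := take_poly k.+1 b.
have b1k : (size b1 <= k.+1)%N by exact: size_take_poly.
have nb : (size b <= maxn (size b) k.+1)%N := leq_maxl _ _.
have -> : P x b = P x (b1 + (b - b1)) by rewrite addrC subrK.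
apply: (le_trans ((PS x).1.1 _ _)).
have h1 : P y b1 <= P y b + P y (b - b1).
  rewrite -{1}(subrK b b1) addrC -((PS y).2 (b - b1)) opprB.
  exact: (PS y).1.1.
have h2 : weighted_norm (weight k x y) b1 + P x (b - b1) + P y (b - b1) <=
    weighted_norm (weight k x y) b.
  have bb1 : (size (b - b1)%R <= maxn (size b) k.+1)%N.
    apply: (leq_trans (size_polyD _ _)); rewrite size_polyN geq_max leq_maxl/=.
    exact: (leq_trans b1k (leq_maxr _ _)).
  have := lerD (qseminorm_poly_le (PS x) bb1) (qseminorm_poly_le (PS y) bb1).
  rewrite (weighted_normE _ nb) (weighted_normE _ (leq_trans b1k (leq_maxr (size b) _))).
  rewrite -big_split/= => h; rewrite -addrA; apply: (le_trans (lerD (lexx _) h)).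
  rewrite -big_split/=; apply: ler_sum => i _; rewrite coefB coef_take_poly ltnS /weight.
  case: ifP => ik; first by rewrite subrr normr0 rmorph0 !mul0r !addr0.
  by rewrite normr0 rmorph0 mul0r add0r subr0 -mulrDr.
have := small _ b1k; lra.
Qed.

Let P_down k z c : P z c <= P (rep k z) c + E k z c.
Proof.
apply: code_close.
by have /codesP/(_ k (leqnn k)) := codes_rep k z.
Qed.

Let P_up k z c : P (rep k z) c <= P z c + E k z c.
Proof.
rewrite /E weightC; apply: code_close.
by have /codesP/(_ k (leqnn k)) := codes_rep k z.
Qed.

Let ES k z : qseminorm (E k z).
Proof. by apply: weighted_norm_qseminorm => i; exact: weight_ge0. Qed.

Let measurable_codes_eq k s : measurable [set x | codes k x = s].
Proof.
apply: measurable_map_eq => j [n t].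
(* The grid depends on [x] only through the bound; once this is fixed to [n], the values are taken
   along a constant list. *)
rewrite [X in measurable X](_ : _ = [set x | bound j x = n] `&`
  [set x | [seq Num.truncn (P x c * 2 ^+ j.+2) | c <- grid j (n * 2 ^ j.+2)] = t]).
  apply: measurableI.
    case: n => [|n].
      by rewrite [X in measurable X](_ : _ = set0)//; apply/seteqP; split.
    rewrite [X in measurable X](_ : _ =
      [set x | Num.truncn (\sum_(i < j.+1) P x 'X^i) = n]); last first.
      by apply/seteqP; split => x /=; rewrite /bound; [case|move=> ->].
    apply: measurable_truncn_eq; first exact: measurable_sum.
    by move=> x; apply: sumr_ge0 => i _; exact: qseminorm_ge0.
  apply: measurable_map_eq => c u; apply: measurable_truncn_eq.
    by apply: measurable_funM => //; exact: measurable_cst.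
  by move=> x; rewrite mulr_ge0 ?exprn_ge0// qseminorm_ge0.
apply/seteqP; split => x /=; first by move=> [<-].
by rewrite /code => -[-> ->].
Qed.

(* A seminorm [P (node k s)] is the supremum over all compatible families of
   [`|l k (node k s)|], since every functional in its dual ball extends to such
   a family; hence the evaluations [eval (k, s, c)], with the supremum norm,
   realise all these seminorms, and the nodes of consecutive levels are close
   to each other. *)
Let family := {l : nat -> X -> {poly rat} -> R | compatible_family P rep E l}.

Let eval (i : nat * seq (nat * seq nat) * {poly rat}) (l : family) : R :=
  sval l i.1.1 (node i.1.1 i.1.2) i.2.

Let eval_bounded i : exists M : R, forall l, `|eval i l| <= M.
Proof.
exists (P (node i.1.1 i.1.2) i.2) => l; exact: ((svalP l).1 _ _).2.
Qed.

(** [u c x] is the limit over [k] of the images in [B] of the evaluations at the vertex of [x] of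
    level [k]. Each of these is a function of a countable code, hence measurable. *)
Theorem measurable_isometric_embedding : exists u : {poly rat} -> X -> B,
  [/\ forall c, measurable_fun setT (u c : X -> borel B),
      forall x c c', u (c + c') x = u c x + u c' x &
      forall x c, `|u c x| = P x c].
Proof.
have [z zP] := universal_functions eval_bounded univ.
pose v k (c : {poly rat}) x := z (k, codes k x, c).
have v_additive k (c c' : {poly rat}) x : v k (c + c') x = v k c x + v k c' x.
  apply/eqP; rewrite -subr_eq0 -normr_le0.
  have := (zP [:: (1, (k, codes k x, c + c')); (-1, (k, codes k x, c));
    (-1, (k, codes k x, c'))] 0 (lexx _)).2.
  rewrite !big_cons big_nil/= !scale1r !scaleN1r addr0 -opprD; apply.
  move=> l; rewrite /span_comb !big_cons big_nil/=.
  rewrite [eval (_, _, c + c') l]((svalP l).1 _ _).1 /eval/=.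
  by rewrite normr_le0; apply/eqP; ring.
have v_norm k (c : {poly rat}) x : `|v k c x| = P (rep k x) c.
  apply/eqP; rewrite eq_le; apply/andP; split.
    have := (zP [:: (1, (k, codes k x, c))] _ (qseminorm_ge0 c (PS (rep k x)))).2.
    rewrite big_cons big_nil/= scale1r addr0; apply => l.
    rewrite /span_comb big_cons big_nil mul1r addr0.
    exact: ((svalP l).1 _ _).2.
  have [l [lD lP lc]] := qseminorm_norming c (PS (rep k x)).
  have lB : dual_ball (P (rep k x)) l by [].
  have [f fC fl] := compatible_family_extension PS ES P_down P_up k lB.
  have := (zP [:: (1, (k, codes k x, c))] _ (normr_ge0 (v k c x))).1.
  rewrite big_cons big_nil/= scale1r addr0 => /(_ (lexx _) (exist _ f fC)).
  rewrite /span_comb big_cons big_nil mul1r addr0 /eval/= -/(rep k x) fl lc.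
  exact/le_trans/ler_norm.
have v_step k (c : {poly rat}) x : `|v k.+1 c x - v k c x| <= E k (rep k.+1 x) c.
  have := (zP [:: (1, (k.+1, codes k.+1 x, c)); (-1, (k, codes k x, c))] _
    (qseminorm_ge0 c (ES k (rep k.+1 x)))).2.
  rewrite !big_cons big_nil/= scale1r scaleN1r addr0; apply => l.
  rewrite /span_comb !big_cons big_nil/= mul1r mulN1r addr0 /eval/=.
  (* [rep k x] is the parent of the vertex [rep k.+1 x]. *)
  rewrite -[node k (codes k x)]/(rep k x) -rep_rep; exact: (svalP l).2.
pose K (c : {poly rat}) : R := \sum_(i < size c) ratr `|c`_i|.
have K0 c : 0 <= K c by apply: sumr_ge0 => i _; rewrite ler0q.
(* The sequence starts at level [size c]: from there on every power in [c] carries the small weight,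
   and the increments are dominated by a geometric series. *)
have vcauchy (c : {poly rat}) x n k : `|v (n + size c)%N c x - v (k + size c)%N c x| <=
    2 * K c * 2^-1 ^+ n + 2 * K c * 2^-1 ^+ k.
  wlog nk : n k / (n <= k)%N.
    move=> h; have [|/ltnW kn] := leqP n k; first exact: h.
    by rewrite distrC [leRHS]addrC; exact: h.
  have ngt j : 0 <= 2 * K c * 2^-1 ^+ j by rewrite !mulr_ge0// exprn_ge0.
  suff : `|v (n + size c)%N c x - v (k + size c)%N c x| <=
    2 * K c * 2^-1 ^+ n - 2 * K c * 2^-1 ^+ k.
    by have := ngt k; lra.
  elim: k nk => [|k IH].
    by rewrite leqn0 => /eqP ->; rewrite !subrr normr0.
  rewrite leq_eqVlt ltnS => /predU1P[->|/IH {}IH]; first by rewrite !subrr normr0.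
  rewrite -(subrKA (v (k + size c)%N c x)) addSn.
  apply: (le_trans (ler_normD _ _)).
  have h := v_step (k + size c)%N c x.
  have cs : (size c <= (k + size c).+1)%N by rewrite leqW// leq_addl.
  rewrite distrC /E weighted_norm_small// -/(K c) in h.
  have h' : 2^-1 ^+ (k + size c) * K c <= 2^-1 ^+ k * K c.
    by rewrite ler_wpM2r// ler_wiXn2l ?leq_addr//; lra.
  by rewrite exprS; have := lerD IH (le_trans h h'); lra.
have e0 (c : {poly rat}) : 2 * K c * 2^-1 ^+ n @[n --> \oo] --> 0.
  rewrite -[X in _ --> X](mulr0 (2 * K c)).
  by apply: cvgM; [exact: cvg_cst|];
    apply: cvg_expr; rewrite ger0_norm ?invr_ge0// invf_lt1// ltr1n.
have /choice[u uP] : forall cx : {poly rat} * X, exists y : B,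
    v n cx.1 cx.2 @[n --> \oo] --> y.
  move=> [c x]; have [y [yP _]] := cauchy_rate (e0 c) (vcauchy c x).
  by exists y; rewrite /= -(cvg_shiftn (size c)).
exists (fun c x => u (c, x)); split.
- move=> c; apply: (@measurable_fun_cvg_borel _ _ _ _ (fun n => v n c)).
    move=> n; apply: measurable_fun_borel => U oU.
    exact: (@measurable_countable_preimage _ _ _ (codes n)
      [set s | U (z (n, s, c))]).
  by move=> x; exact: (uP (c, x)).
- move=> x c c'; apply: (@cvg_unique _ _ (v n (c + c') x @[n --> \oo])) => //.
    exact: (uP (c + c', x)).
  have -> : (fun n => v n (c + c') x) = (fun n => v n c x + v n c' x).
    by apply/funext => n; exact: v_additive.
  by apply: cvgD; [exact: (uP (c, x))|exact: (uP (c', x))].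
- move=> x c; apply: (@cvg_unique _ _ (`|v n c x| @[n --> \oo])) => //.
    exact: (cvg_norm (uP (c, x))).
  have -> : (fun n => `|v n c x|) = (fun n => P (rep n x) c).
    by apply/funext => n; exact: v_norm.
  rewrite /= -(cvg_shiftn (size c)).
  apply/cvgrPdist_le => eps eps0.
  have /cvgrPdist_le/(_ eps eps0) := e0 c; apply: filterS => n.
  rewrite sub0r normrN ger0_norm ?mulr_ge0 ?exprn_ge0// => en.
  apply: le_trans en.
  have h1 := P_down (n + size c)%N x c; have h2 := P_up (n + size c)%N x c.
  have cs : (size c <= (n + size c).+1)%N by rewrite leqW// leq_addl.
  rewrite /E weighted_norm_small// -/(K c) in h1 h2.
  have h' : 2^-1 ^+ (n + size c) * K c <= 2^-1 ^+ n * K c.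
    by rewrite ler_wpM2r// ler_wiXn2l ?leq_addr//; lra.
  have h0 : 0 <= 2^-1 ^+ n * K c by rewrite mulr_ge0// exprn_ge0.
  by rewrite /= ler_norml; apply/andP; split; lra.
Qed.

End measurable_embedding.

(** * Square-integrable functions *)

Lemma sqr_abs (R : realType) (x : R) : `|x| ^+ 2 = x ^+ 2.
Proof. by rewrite real_normK// num_real. Qed.

Lemma sqr_le_abs (R : realType) (x y : R) : `|x| <= `|y| -> x ^+ 2 <= y ^+ 2.
Proof. by move=> xy; rewrite -sqr_abs -(sqr_abs y) lerXn2r// nnegrE. Qed.

Section square_integrable.
Context (R : realType) d (T : measurableType d).
Variable mu : {measure set T -> \bar R}.
Implicit Types (f g h u v w : T -> R).

Definition sqint f : Prop := measurable_fun setT f /\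
  mu.-integrable setT (EFin \o (fun x => f x ^+ 2)).

(** The square of the norm. Young's inequality takes the place of the triangle inequality, so that
    most estimates need no square root. *)
Definition n2 f : R := \int[mu]_x (f x ^+ 2).

Definition ip f g : R := \int[mu]_x (f x * g x).

Lemma Lfun2P f : f \in Lfun mu 2%:E <-> sqint f.
Proof.
split => [f2|[mf /integrableP[_ fi]]].
  split; last exact: Lfun2_integrable_sqr.
  by move: f2; rewrite inE => /andP[]; rewrite inE.
rewrite inE; apply/andP; split; rewrite inE//= /finite_norm unlock.
apply: poweR_lty; apply: le_lt_trans fi.
apply: ge0_le_integral => //.
- by move=> x _; exact: poweR_ge0.
- apply/measurable_EFinP.
  by apply/(@measurableT_comp _ _ _ _ _ _ (fun x : R => x `^ 2)%R) => //;
    exact/measurableT_comp.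
- by apply: measurableT_comp => //; apply/measurable_EFinP; exact: measurable_funX.
- by move=> t _/=; rewrite lee_fin normrX powR_mulrn.
Qed.

Lemma n2_ge0 f : 0 <= n2 f.
Proof. by apply: Rintegral_ge0 => x _; exact: sqr_ge0. Qed.

Lemma n2E f : sqint f -> (\int[mu]_x ((f x) ^+ 2)%:E)%E = (n2 f)%:E.
Proof. by move=> [_ fi]; rewrite /n2 /Rintegral fineK//; exact: integrable_fin_num. Qed.

Lemma integrable_le f g : measurable_fun setT f ->
  mu.-integrable setT (EFin \o g) -> (forall x, `|f x| <= g x) ->
  mu.-integrable setT (EFin \o f).
Proof.
move=> mf gi fg; apply: (le_integrable measurableT _ _ gi).
  exact/measurable_EFinP.
by move=> x _ /=; rewrite lee_fin (le_trans (fg x))// ler_norm.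
Qed.

Lemma integrable_fD f g : mu.-integrable setT (EFin \o f) ->
  mu.-integrable setT (EFin \o g) ->
  mu.-integrable setT (EFin \o (fun x => f x + g x)).
Proof. by move=> fi gi; exact: (integrableD measurableT fi gi). Qed.

Lemma integrable_fZ a f : mu.-integrable setT (EFin \o f) ->
  mu.-integrable setT (EFin \o (fun x => a * f x)).
Proof. by move=> fi; exact: (integrableZl measurableT a fi). Qed.

Lemma sqint_le f g : measurable_fun setT f -> sqint g ->
  (forall x, `|f x| <= `|g x|) -> sqint f.
Proof.
move=> mf [mg gi] fg; split => //; apply: (integrable_le _ gi).
  exact: measurable_funX.
by move=> x; rewrite ger0_norm ?sqr_ge0// sqr_le_abs.
Qed.

Lemma sqintZ a f : sqint f -> sqint (fun x => a * f x).
Proof.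
move=> [mf fi]; split; first by apply: measurable_funM => //; exact: measurable_cst.
have := integrable_fZ (a ^+ 2) fi; congr (integrable _ _ _).
by apply/funext => x /=; rewrite exprMn.
Qed.

Lemma sqintD f g : sqint f -> sqint g -> sqint (f \+ g).
Proof.
move=> [mf fi] [mg gi]; split; first exact: measurable_funD.
apply: (integrable_le _ (integrable_fD (integrable_fZ 2 fi) (integrable_fZ 2 gi))).
  by apply: measurable_funX; exact: measurable_funD.
move=> x; rewrite ger0_norm ?sqr_ge0//=.
have := sqr_ge0 (f x - g x); lra.
Qed.

Lemma sqintN f : sqint f -> sqint (\- f).
Proof.
move=> /(sqintZ (-1)); congr sqint.
by apply/funext => x; rewrite mulN1r.
Qed.

Lemma sqintB f g : sqint f -> sqint g -> sqint (f \- g).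
Proof. by move=> fi /sqintN gi; exact: sqintD. Qed.

Lemma sqint0 : sqint (fun=> 0).
Proof.
split; first exact: measurable_cst.
rewrite (_ : _ \o _ = cst 0%E); first exact: integrable0.
by apply/funext => x /=; rewrite expr0n.
Qed.

Lemma sqint_mul f g : sqint f -> sqint g ->
  mu.-integrable setT (EFin \o (fun x => f x * g x)).
Proof.
move=> [mf fi] [mg gi].
apply: (integrable_le _ (integrable_fD fi gi)); first exact: measurable_funM.
move=> x /=; rewrite normrM.
have := sqr_ge0 (`|f x| - `|g x|); rewrite sqrrB !sqr_abs => h.
have : 0 <= `|f x| * `|g x| by rewrite mulr_ge0.
lra.
Qed.

Lemma ipC f g : ip f g = ip g f.
Proof. by rewrite /ip; under eq_Rintegral do rewrite mulrC. Qed.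

Lemma ipDr f g h : sqint f -> sqint g -> sqint h ->
  ip f (g \+ h) = ip f g + ip f h.
Proof.
move=> fi gi hi; rewrite /ip -RintegralD//; [|exact: sqint_mul|exact: sqint_mul].
by apply: eq_Rintegral => x _ /=; rewrite mulrDr.
Qed.

Lemma ipZr a f g : sqint f -> sqint g -> ip f (fun x => a * g x) = a * ip f g.
Proof.
move=> fi gi; rewrite /ip -RintegralZl//; last exact: sqint_mul.
by apply: eq_Rintegral => x _ /=; rewrite mulrCA.
Qed.

Lemma ipNr f g : sqint f -> sqint g -> ip f (\- g) = - ip f g.
Proof.
move=> fi gi; rewrite -mulN1r -ipZr//.
by congr ip; apply/funext => x; rewrite mulN1r.
Qed.

Lemma ipBr f g h : sqint f -> sqint g -> sqint h ->
  ip f (g \- h) = ip f g - ip f h.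
Proof.
move=> fi gi hi; rewrite -[RHS]/(_ + - _) -ipNr// -ipDr//.
exact: sqintN.
Qed.

Lemma n2_ip f : n2 f = ip f f.
Proof. by apply: eq_Rintegral => x _; rewrite expr2. Qed.

Lemma n2D f g : sqint f -> sqint g ->
  n2 (f \+ g) = n2 f + 2 * ip f g + n2 g.
Proof.
move=> fi gi; have fgi := sqintD fi gi.
rewrite !n2_ip ipDr// ![ip (f \+ g) _]ipC !ipDr// [ip g f]ipC; ring.
Qed.

Lemma n2Z a f : sqint f -> n2 (fun x => a * f x) = a ^+ 2 * n2 f.
Proof.
move=> fi; have afi := sqintZ a fi.
by rewrite !n2_ip ipZr// ipC ipZr// mulrA expr2.
Qed.

Lemma n2N f : n2 (\- f) = n2 f.
Proof. by apply: eq_Rintegral => x _ /=; rewrite sqrrN. Qed.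

Lemma n2C f g : n2 (f \- g) = n2 (g \- f).
Proof. by apply: eq_Rintegral => x _ /=; rewrite -sqrrN opprB. Qed.

Lemma n2B f g : sqint f -> sqint g ->
  n2 (f \- g) = n2 f - 2 * ip f g + n2 g.
Proof.
move=> fi gi; have := n2D fi (sqintN gi); rewrite n2N ipNr// => ->.
by rewrite mulrN.
Qed.

Lemma n2_le f g : sqint f -> sqint g -> (forall x, `|f x| <= `|g x|) ->
  n2 f <= n2 g.
Proof.
move=> [mf fi] [mg gi] fg; apply: le_Rintegral => // x _.
exact: sqr_le_abs.
Qed.

Lemma n2_ae_le f g : sqint f -> sqint g ->
  {ae mu, forall x, `|f x| <= `|g x|} -> n2 f <= n2 g.
Proof.
move=> fi gi fg; rewrite -lee_fin -!n2E//.
apply: ae_ge0_le_integral => //.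
- by move=> x _; rewrite lee_fin sqr_ge0.
- by apply/measurable_EFinP; apply: measurable_funX; exact: fi.1.
- by move=> x _; rewrite lee_fin sqr_ge0.
- by apply/measurable_EFinP; apply: measurable_funX; exact: gi.1.
- apply: filterS fg => x fgx _; rewrite lee_fin.
  exact: sqr_le_abs.
Qed.

Lemma n2_eq0 f : sqint f -> n2 f = 0 -> {ae mu, forall x, f x = 0}.
Proof.
move=> fi f0.
have : (\int[mu]_x `|((f x) ^+ 2)%:E|)%E = 0%E.
  under eq_integral do rewrite gee0_abs ?lee_fin ?sqr_ge0//.
  by rewrite n2E// f0.
move/(ae_eq_integral_abs mu measurableT) => h.
have {h} : ae_eq mu setT (fun x => ((f x) ^+ 2)%:E) (cst 0%E).
  by apply: h; apply/measurable_EFinP; apply: measurable_funX; exact: fi.1.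
apply: filterS => x /(_ I)/= => -[] /eqP.
by rewrite sqrf_eq0 => /eqP.
Qed.

(** Expand [0 <= n2 (e f - g)]. The free parameter keeps the constant of [n2 f] close to [1], which
    limits of norms require. *)
Lemma n2_young (e : R) f g : 0 < e -> sqint f -> sqint g ->
  n2 (f \+ g) <= (1 + e) * n2 f + (1 + e^-1) * n2 g.
Proof.
move=> e0 fi gi; rewrite n2D//.
have efi := sqintZ e fi.
have := n2_ge0 ((fun x => e * f x) \- g); rewrite n2B// n2Z//.
rewrite [ip (fun=> _) g]ipC ipZr// [ip g f]ipC => h.
rewrite -(ler_pM2l e0).
have -> : e * ((1 + e) * n2 f + (1 + e^-1) * n2 g) =
  e * (1 + e) * n2 f + (e + e * e^-1) * n2 g by ring.
rewrite divff ?gt_eqF//; lra.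
Qed.

Lemma n2D_le f g : sqint f -> sqint g -> n2 (f \+ g) <= 2 * n2 f + 2 * n2 g.
Proof.
by move=> fi gi; have := n2_young ltr01 fi gi; rewrite invr1.
Qed.

Lemma n2_triangle f g h : sqint f -> sqint g -> sqint h ->
  n2 (f \- h) <= 2 * n2 (f \- g) + 2 * n2 (g \- h).
Proof.
move=> fi gi hi; have := n2D_le (sqintB fi gi) (sqintB gi hi).
apply: le_trans; rewrite le_eqVlt; apply/orP; left; apply/eqP.
by apply: eq_Rintegral => x _ /=; congr (_ ^+ 2); ring.
Qed.

(** By contradiction: [e] and [eps] are chosen so that each of the error terms [e * b] and
    [eps * (2 + e + e^-1)] is at most a quarter of [a - b]. *)
Lemma young_limit (a b : R) : 0 <= b ->
  (forall e eps, 0 < e -> 0 < eps ->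
    a <= (1 + e) * (b + eps) + (1 + e^-1) * eps) -> a <= b.
Proof.
move=> b0 h; rewrite leNgt; apply/negP => ba.
pose e := (a - b) / (4 * (b + 1)).
have b1 : 0 < 4 * (b + 1) by lra.
have e0 : 0 < e by rewrite divr_gt0// subr_gt0.
have ei : 0 < e^-1 by rewrite invr_gt0.
pose eps := (a - b) / (4 * (2 + e + e^-1)).
have s0 : 0 < 4 * (2 + e + e^-1) by lra.
have eps0 : 0 < eps by rewrite divr_gt0// subr_gt0.
have := h e eps e0 eps0.
have E1 : e * (4 * (b + 1)) = a - b by rewrite divfK// gt_eqF.
have E2 : eps * (4 * (2 + e + e^-1)) = a - b by rewrite divfK// gt_eqF.
lra.
Qed.

Lemma le_n2_approx (c : R) h : sqint h -> (forall eps, 0 < eps ->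
  exists w, [/\ sqint w, n2 (w \- h) <= eps & c <= n2 w]) -> c <= n2 h.
Proof.
move=> hi H; apply: young_limit; first exact: n2_ge0.
move=> e eps e0 eps0; have [w [wi wh cw]] := H eps eps0.
apply: (le_trans cw).
have -> : n2 w = n2 (h \+ (w \- h)).
  by apply: eq_Rintegral => x _ /=; congr (_ ^+ 2); ring.
apply: (le_trans (n2_young e0 hi (sqintB wi hi))).
rewrite lerD// ler_wpM2l//; first lra.
  by rewrite lerDl ltW.
by rewrite addr_ge0// invr_ge0 ltW.
Qed.

Lemma n2_approx_le (c : R) h : 0 <= c -> sqint h -> (forall eps, 0 < eps ->
  exists w, [/\ sqint w, n2 (w \- h) <= eps & n2 w <= c + eps]) -> n2 h <= c.
Proof.
move=> c0 hi H; apply: young_limit => //.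
move=> e eps e0 eps0; have [w [wi wh cw]] := H eps eps0.
have -> : n2 h = n2 (w \+ (h \- w)).
  by apply: eq_Rintegral => x _ /=; congr (_ ^+ 2); ring.
apply: (le_trans (n2_young e0 wi (sqintB hi wi))).
rewrite n2C lerD// ler_wpM2l//; first lra.
by rewrite addr_ge0// invr_ge0 ltW.
Qed.

(* Summable even after multiplication by [4 ^+ k], so that [n2 (v k) <= fast k]
   bounds [2 ^+ k * `|v k x|] for almost every [x]. *)
Definition fast (k : nat) : R := 8^-1 ^+ k.+1.

Lemma fast_gt0 k : 0 < fast k. Proof. by rewrite exprn_gt0. Qed.

(** The series of the [4^k |v k|^2] has finite integral, hence is finite almost everywhere, and [M]
    is the square root of its sum. *)
Lemma fast_ae (v : nat -> T -> R) : (forall k, sqint (v k)) ->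
  (forall k, n2 (v k) <= fast k) ->
  {ae mu, forall x, exists2 M : R, 0 <= M & forall k, `|v k x| <= M * 2^-1 ^+ k}.
Proof.
move=> vi vf.
pose f k x : \bar R := (4 ^+ k * v k x ^+ 2)%:E.
have mf k : measurable_fun setT (f k).
  apply/measurable_EFinP; apply: measurable_funM; first exact: measurable_cst.
  by apply: measurable_funX; exact: (vi k).1.
have f0 k x : (0 <= f k x)%E by rewrite lee_fin mulr_ge0 ?sqr_ge0 ?exprn_ge0.
have fint k : (\int[mu]_x f k x <= (1 / (2 ^ (k + 1))%:R)%:E)%E.
  rewrite /f; under eq_integral do rewrite EFinM.
  rewrite ge0_integralZl//=.
  - rewrite n2E// -EFinM lee_fin.
    apply: (@le_trans _ _ (4 ^+ k * fast k)); first by rewrite ler_wpM2l ?exprn_ge0.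
    rewrite /fast div1r addn1 natrX -exprVn !exprS mulrCA -exprMn.
    have -> : 4 * 8^-1 = 2^-1 :> R by lra.
    by rewrite ler_wpM2r ?exprn_ge0//; lra.
  - apply/measurable_EFinP; apply: measurable_funX; exact: (vi k).1.
  - by move=> x _; rewrite lee_fin sqr_ge0.
have Sint : mu.-integrable setT (fun x => \sum_(0 <= k <oo) f k x)%E.
  apply/integrableP; split.
    by apply: ge0_emeasurable_sum => // k x _ _; exact: f0.
  under eq_integral do rewrite gee0_abs ?nneseries_ge0//.
  rewrite integral_nneseries//.
  apply: (@le_lt_trans _ _ (\sum_(0 <= k <oo) (1 / (2 ^ (k + 1))%:R)%:E)%E).
    apply: lee_nneseries => k _; first by rewrite integral_ge0.
    exact: fint.
  rewrite (cvg_lim _ (@cvg_geometric_eseries_half R 1 0))//.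
  by rewrite ltry.
have := integrable_ae measurableT Sint.
apply: filterS => x /(_ I) Sfin.
pose S := fine (\sum_(0 <= k <oo) f k x)%E.
have S0 : 0 <= S by rewrite fine_ge0// nneseries_ge0.
exists (Num.sqrt S); first exact: sqrtr_ge0.
move=> k; have fkS : 4 ^+ k * v k x ^+ 2 <= S.
  rewrite -lee_fin /S fineK//.
  have := @nneseries_lim_ge R (fun n => f n x) xpredT 0 k.+1 (fun n _ _ => f0 n x).
  apply: le_trans; rewrite big_nat_recr//= leeDr// sume_ge0// => i _; exact: f0.
rewrite -(ler_sqr) ?nnegrE ?mulr_ge0 ?sqrtr_ge0 ?exprn_ge0//.
rewrite exprMn sqr_sqrtr// sqr_abs -exprM mulnC exprM exprVn.
have -> : 2 ^+ 2 = 4 :> R by rewrite expr2; lra.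
by rewrite exprVn ler_pdivlMr ?exprn_gt0// mulrC.
Qed.

Lemma fatou_n2 (w : nat -> T -> R) h (c : R) : (forall k, sqint (w k)) ->
  measurable_fun setT h ->
  {ae mu, forall x, w k x @[k --> \oo] --> h x} ->
  (\forall k \near \oo, n2 (w k) <= c) -> sqint h /\ n2 h <= c.
Proof.
move=> wi mh wh wc.
have mw2 k : measurable_fun setT (fun x => (w k x ^+ 2)%:E).
  by apply/measurable_EFinP; apply: measurable_funX; exact: (wi k).1.
have mh2 : measurable_fun setT (fun x => (h x ^+ 2)%:E).
  by apply/measurable_EFinP; exact: measurable_funX.
have le : (\int[mu]_x (h x ^+ 2)%:E <= c%:E)%E.
  apply: (@le_trans _ _ (limn_einf (fun k => \int[mu]_x (w k x ^+ 2)%:E)%E)).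
    apply: (@le_trans _ _ (\int[mu]_x (limn_einf (fun k => (w k x ^+ 2)%:E)))%E); last first.
      by apply: fatou => // k x _; rewrite lee_fin sqr_ge0.
    apply: ae_ge0_le_integral => //.
    - by move=> x _; rewrite lee_fin sqr_ge0.
    - move=> x _; rewrite limn_einf_lim; apply: lime_ge; first exact: is_cvg_einfs.
      apply: nearW => n; apply: le_ereal_inf_tmp => _ [k _ <-].
      by rewrite lee_fin sqr_ge0.
    - under eq_fun do rewrite -[limn_einf _]oppeK -limn_esupN.
      apply: measurableT_comp => //; apply: measurable_fun_limn_esup => k.
      exact: measurableT_comp.
    - apply: filterS wh => x whx _.
      suff /cvg_limn_einf_sup[-> _] :
        (w k x ^+ 2)%:E @[k --> \oo] --> (h x ^+ 2)%:E by [].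
      by apply: cvg_EFin; [exact: nearW|apply: cvgM].
  rewrite limn_einf_lim; apply: lime_le; first exact: is_cvg_einfs.
  case: wc => N _ wc; apply: nearW => n.
  apply: (@le_trans _ _ (\int[mu]_x (w (maxn n N) x ^+ 2)%:E)%E).
    by apply: ereal_inf_lbound; exists (maxn n N) => //=; exact: leq_maxl.
  by rewrite n2E// lee_fin; apply: wc => /=; exact: leq_maxr.
have hi : sqint h.
  split => //; apply/integrableP; split => //.
  under eq_integral do rewrite gee0_abs ?lee_fin ?sqr_ge0//.
  exact: le_lt_trans le (ltry _).
by split => //; rewrite -lee_fin -n2E.
Qed.

Lemma geometric_cauchy (V : completeNormedModType R) (u : nat -> V) (M : R) :
  0 <= M -> (forall k, `|u k.+1 - u k| <= M * 2^-1 ^+ k) ->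
  exists2 l : V, u k @[k --> \oo] --> l &
    forall k, `|u k - l| <= 2 * M * 2^-1 ^+ k.
Proof.
move=> M0 uM.
have e0 : 2 * M * 2^-1 ^+ n @[n --> \oo] --> 0.
  rewrite -[X in _ --> X](mulr0 (2 * M)).
  by apply: cvgM; [exact: cvg_cst|];
    apply: cvg_expr; rewrite ger0_norm ?invr_ge0// invf_lt1// ltr1n.
have ngt j : 0 <= 2 * M * 2^-1 ^+ j by rewrite !mulr_ge0// exprn_ge0.
have [|l [ul lu]] := cauchy_rate e0 (u := u); last by exists l.
move=> n k; wlog nk : n k / (n <= k)%N.
  move=> h; have [|/ltnW kn] := leqP n k; first exact: h.
  by rewrite distrC [leRHS]addrC; exact: h.
suff : `|u n - u k| <= 2 * M * 2^-1 ^+ n - 2 * M * 2^-1 ^+ k.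
  by have := ngt k; lra.
elim: k nk => [|k IH].
  by rewrite leqn0 => /eqP ->; rewrite !subrr normr0.
rewrite leq_eqVlt ltnS => /predU1P[->|/IH {}IH]; first by rewrite !subrr normr0.
rewrite -(subrKA (u k)); apply: (le_trans (ler_normD _ _)).
have := uM k; rewrite distrC exprS; lra.
Qed.

(** Riesz-Fischer: a subsequence with fast differences converges almost everywhere, and Fatou's
    lemma gives both the square-integrability of the limit and the convergence of the whole
    sequence. *)
Lemma n2_complete (u : nat -> T -> R) : (forall n, sqint (u n)) ->
  (forall e, 0 < e -> exists N, forall n k, (N <= n)%N -> (N <= k)%N ->
    n2 (u n \- u k) <= e) ->
  exists2 h, sqint h & forall e, 0 < e -> exists N, forall n, (N <= n)%N ->
    n2 (u n \- h) <= e.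
Proof.
move=> ui uc.
have /choice[N NP] : forall k, exists N, forall n j, (N <= n)%N -> (N <= j)%N ->
    n2 (u n \- u j) <= fast k by move=> k; apply: uc; exact: fast_gt0.
(* The sums make [phi] nondecreasing, with [phi k >= N k] and [phi k >= k]. *)
pose phi k := (\sum_(i < k.+1) (N i).+1)%N.
have phi_mono k : (phi k <= phi k.+1)%N.
  by rewrite /phi [leqRHS]big_ord_recr/= leq_addr.
have phiN k : (N k <= phi k)%N.
  by rewrite /phi big_ord_recr/=; apply: leq_trans (leq_addl _ _).
have phi_ge k : (k <= phi k)%N.
  elim: k => // k IH; rewrite /phi big_ord_recr/= addnS ltnS.
  exact: leq_trans IH (leq_addr _ _).
have := @fast_ae (fun k => u (phi k.+1) \- u (phi k)) _ _.
move=> /(_ (fun k => sqintB (ui _) (ui _))).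
move=> /(_ (fun k => NP k _ _ (leq_trans (phiN k) (phi_mono k)) (phiN k))) ae.
(* The upper limit is a representative that is defined and measurable everywhere. *)
pose h x := fine (limn_esup (fun k => (u (phi k) x)%:E)).
have mh : measurable_fun setT h.
  apply: (measurableT_comp (fine_measurable _)) => //.
  by apply: measurable_fun_limn_esup => k; apply/measurable_EFinP; exact: (ui _).1.
have uh : {ae mu, forall x, u (phi k) x @[k --> \oo] --> h x}.
  apply: filterS ae => x [M M0 xM].
  have [l ul _] := @geometric_cauchy R^o (fun k => u (phi k) x) M M0 xM.
  have /cvg_limn_einf_sup[_] : (u (phi k) x)%:E @[k --> \oo] --> l%:E.
    by apply: cvg_EFin => //; exact: nearW.
  by rewrite /h => ->.
have key n e : (\forall k \near \oo, n2 (u n \- u (phi k)) <= e) ->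
    sqint (u n \- h) /\ n2 (u n \- h) <= e.
  apply: fatou_n2 => //.
  - by move=> k; exact: sqintB.
  - by apply: measurable_funB => //; exact: (ui n).1.
  - by apply: filterS uh => x uhx; apply: cvgB => //; exact: cvg_cst.
have phi_mon K k : (K <= k)%N -> (phi K <= phi k)%N.
  elim: k => [|k IH]; first by rewrite leqn0 => /eqP ->.
  rewrite leq_eqVlt ltnS => /predU1P[->//|/IH h']; exact: leq_trans h' (phi_mono k).
have hi : sqint h.
  have [|h0 _] := key (N 0%N) (fast 0).
    exists 0%N => // k _; apply: NP => //.
    exact: leq_trans (phiN 0%N) (phi_mon _ _ (leq0n k)).
  have := sqintB (ui (N 0%N)) h0; congr sqint.
  by apply/funext => x /=; ring.
exists h => // e e0; have [K KP] := uc e e0.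
exists K => n Kn; have [|//] := key n e.
by exists K => // k /= Kk; apply: KP => //; exact: leq_trans Kk (phi_ge k).
Qed.

End square_integrable.

Definition fmix (R : realType) (T : Type) (chi f g : T -> R) : T -> R :=
  fun x => (1 - chi x) * f x + chi x * g x.

Definition mix (R : realType) (T : Type) (t : R) (f g : T -> R) : T -> R :=
  fmix (fun=> t) f g.

(** * Projection onto convex sets of square-integrable functions *)

Section convex_projection.
Context (R : realType) d (T : measurableType d).
Variable mu : {measure set T -> \bar R}.
Implicit Types (f g h u v w : T -> R).
Local Notation sqint := (sqint mu).
Local Notation n2 := (n2 mu).
Local Notation ip := (ip mu).

Lemma sqint_mix t f g : sqint f -> sqint g -> sqint (mix t f g).
Proof. by move=> fi gi; apply: sqintD; exact: sqintZ. Qed.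

Definition convex_L2 (C : set (T -> R)) : Prop :=
  C `<=` sqint /\ forall t f g, 0 <= t <= 1 -> C f -> C g -> C (mix t f g).

Definition closure_L2 (C : set (T -> R)) : set (T -> R) :=
  [set f | sqint f /\ forall e, 0 < e -> exists2 w, C w & n2 (w \- f) <= e].

(** The parallelogram identity for [f - h] and [g - h]. *)
Lemma mid_identity f g h : sqint f -> sqint g -> sqint h ->
  n2 (f \- g) = 2 * n2 (f \- h) + 2 * n2 (g \- h) -
    4 * n2 (mix 2^-1 f g \- h).
Proof.
move=> fi gi hi; have fh := sqintB fi hi; have gh := sqintB gi hi.
have -> : n2 (f \- g) = n2 ((f \- h) \- (g \- h)).
  by apply: eq_Rintegral => x _ /=; congr (_ ^+ 2); ring.
have -> : n2 (mix 2^-1 f g \- h) =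
    n2 (fun x => 2^-1 * ((f \- h) \+ (g \- h)) x).
  by apply: eq_Rintegral => x _ /=; congr (_ ^+ 2); rewrite /mix /fmix; field.
rewrite n2Z; last exact: sqintD.
have E : 2^-1 ^+ 2 = 4^-1 :> R by rewrite expr2; lra.
rewrite (n2B fh gh) (n2D fh gh) E; lra.
Qed.

Lemma natSinv_lt (e : R) : 0 < e ->
  exists N, forall n, (N <= n)%N -> n.+1%:R^-1 < e.
Proof.
move=> e0; have [N _ NP] := near_infty_natSinv_lt (PosNum e0).
by exists N => n /NP.
Qed.

(** The infima [c n] of the squared distance to [g] over [C n] increase and are bounded, so by the
    parallelogram identity near-minimisers form a Cauchy sequence. A constant [C] gives the
    projection used for weak limits, the shrinking slope sets give the minimal slope. *)
Lemma decreasing_convex_min (C : nat -> set (T -> R)) g (M : R) :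
  (forall n, convex_L2 (C n)) -> (forall n, C n.+1 `<=` C n) -> sqint g ->
  (forall n, exists2 w, C n w & n2 (w \- g) <= M) ->
  exists (w : nat -> T -> R) P, [/\ sqint P,
    forall n, C n (w n) /\
      forall v, C n v -> n2 (w n \- g) <= n2 (v \- g) + n.+1%:R^-1,
    forall e, 0 < e -> exists N, forall n, (N <= n)%N -> n2 (w n \- P) <= e &
    forall M', 0 <= M' -> (forall n, exists2 v, C n v & n2 (v \- g) <= M') ->
      n2 (P \- g) <= M'].
Proof.
move=> Cc Cd gi CM.
have Cdec n k : (n <= k)%N -> C k `<=` C n.
  elim: k => [|k IH]; first by rewrite leqn0 => /eqP ->.
  rewrite leq_eqVlt ltnS => /predU1P[->//|/IH h]; exact: subset_trans (Cd k) h.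
pose A n := [set n2 (w \- g) | w in C n].
have Alb n : has_lbound (A n) by exists 0 => _ [w _ <-]; exact: n2_ge0.
have A0 n : A n !=set0 by have [w Cw _] := CM n; exists (n2 (w \- g)), w.
pose c n := inf (A n).
have cle n v : C n v -> c n <= n2 (v \- g).
  by move=> Cv; apply: ge_inf => //; exists v.
have c_mono n k : (n <= k)%N -> c n <= c k.
  move=> nk; apply: lb_le_inf => // _ [w Cw <-]; apply: cle; exact: Cdec Cw.
have cM n : c n <= M.
  by have [w Cw wM] := CM n; exact: le_trans (cle _ _ Cw) wM.
have /choice[w wP] : forall n, exists w, C n w /\ n2 (w \- g) <= c n + n.+1%:R^-1.
  move=> n; have n1 : 0 < n.+1%:R^-1 :> R by rewrite invr_gt0.
  have [_ [w Cw <-] wc] := inf_adherent n1 (conj (A0 n) (Alb n)).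
  by exists w; split => //; exact: ltW.
have wi n : sqint (w n) := (Cc n).1 _ (wP n).1.
have h01 : 0 <= (2^-1 : R) <= 1 by apply/andP; split; lra.
(* The midpoint of [w n] and [w k] lies in [C n], so its squared distance to [g] is at least
   [c n]. *)
have wnk n k : (n <= k)%N -> n2 (w n \- w k) <=
    2 * (c k - c n) + 2 * n.+1%:R^-1 + 2 * k.+1%:R^-1.
  move=> nk; rewrite (mid_identity (wi n) (wi k) gi).
  have := cle n _ ((Cc n).2 _ _ _ h01 (wP n).1 (Cdec _ _ nk _ (wP k).1)).
  have := (wP n).2; have := (wP k).2.
  by set a := n.+1%:R^-1; set b := k.+1%:R^-1; lra.
pose s := sup (range c).
have cub : has_ubound (range c) by exists M => _ [n _ <-].
have cs n : c n <= s by apply: ub_le_sup => //; exists n.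
have [|P Pi Plim] := n2_complete wi.
  move=> e e0; have e8 : 0 < e / 8 by rewrite divr_gt0.
  have [_ [N1 _ <-] N1P] := sup_adherent e8 (conj (ex_intro _ (c 0%N) (ex_intro2 _ _ 0%N I erefl)) cub : has_sup (range c)).
  have [N2 N2P] := natSinv_lt e8.
  exists (maxn N1 N2) => n k; rewrite !geq_max => /andP[n1 n2'] /andP[k1 k2].
  wlog nk : n k n1 n2' k1 k2 / (n <= k)%N.
    move=> h; have [nk|/ltnW kn] := leqP n k; first exact: h.
    by rewrite n2C; exact: h.
  apply: (le_trans (wnk n k nk)).
  have := N2P _ n2'; have := N2P _ k2; have := cs k; have := c_mono _ _ n1.
  move: N1P; rewrite -/s; set a := n.+1%:R^-1; set b := k.+1%:R^-1; lra.
exists w, P; split => //.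
- move=> n; split; first exact: (wP n).1.
  move=> v Cv; apply: (le_trans (wP n).2); rewrite lerD2r; exact: cle.
- move=> M' M'0 CM'; apply: (n2_approx_le M'0 (sqintB Pi gi)) => eps eps0.
  have [N1 N1P] := Plim eps eps0; have [N2 N2P] := natSinv_lt eps0.
  pose n := maxn N1 N2; exists (w n \- g); split.
  + exact: sqintB.
  + apply: le_trans (N1P n (leq_maxl _ _)); rewrite le_eqVlt; apply/orP; left.
    by apply/eqP; apply: eq_Rintegral => x _ /=; congr (_ ^+ 2); ring.
  + apply: (le_trans (wP n).2); apply: lerD; last exact: ltW (N2P n (leq_maxr _ _)).
    by have [v Cv] := CM' n; exact: le_trans (cle _ _ Cv).
Qed.

Lemma quadratic_min (a b : R) :
  (forall t, 0 < t <= 1 -> 0 <= 2 * t * a + t ^+ 2 * b) -> 0 <= a.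
Proof.
move=> h; rewrite leNgt; apply/negP => a0.
have b0 : 0 < `|b| + `|a| + 1 by rewrite addrC ltr_pwDl// addr_ge0.
(* The summand [|a|] gives [t <= 1], and [t * b <= - a] leaves [2 a + t b <= a < 0]. *)
pose t := - a / (`|b| + `|a| + 1).
have t0 : 0 < t by rewrite divr_gt0// oppr_gt0.
have t1 : t <= 1.
  rewrite ler_pdivrMr// mul1r (ltr0_norm a0).
  by have := normr_ge0 b; lra.
have tb : t * (`|b| + `|a| + 1) = - a by rewrite divfK// gt_eqF.
have := h t; rewrite t0 t1 => /(_ isT).
have -> : 2 * t * a + t ^+ 2 * b = t * (2 * a + t * b) by ring.
rewrite pmulr_rge0// => h'.
have : t * b <= t * (`|b| + `|a| + 1).
  rewrite ler_wpM2l ?ltW//; have := ler_norm b; have := normr_ge0 a; lra.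
by rewrite tb; lra.
Qed.

(** First variation of the squared distance to [g] along the segment from [P] to [Q]. *)
Lemma variational_inequality (S : set (T -> R)) P g : convex_L2 S -> S P ->
  sqint g -> (forall Q, S Q -> n2 (P \- g) <= n2 (Q \- g)) ->
  forall Q, S Q -> 0 <= ip (P \- g) (Q \- P).
Proof.
move=> [Si Sc] SP gi Pmin Q SQ; have Pi := Si _ SP; have Qi := Si _ SQ.
apply: (@quadratic_min _ (n2 (Q \- P))) => t /andP[t0 t1].
have t01 : 0 <= t <= 1 by rewrite ltW.
have := Pmin _ (Sc _ _ _ t01 SP SQ).
have -> : n2 (mix t P Q \- g) = n2 ((P \- g) \+ (fun x => t * (Q \- P) x)).
  by apply: eq_Rintegral => x _ /=; congr (_ ^+ 2); rewrite /mix /fmix; ring.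
have Pg := sqintB Pi gi; have QP := sqintB Qi Pi.
rewrite (n2D Pg (sqintZ t QP)).
by rewrite ipZr// n2Z//; lra.
Qed.

Lemma closure_L2_convex C : convex_L2 C -> convex_L2 (closure_L2 C).
Proof.
move=> [Ci Cc]; split; first by move=> f [].
move=> t f g t01 [fi fC] [gi gC]; split; first exact: sqint_mix.
move=> e e0; have e4 : 0 < e / 4 by rewrite divr_gt0.
have [u Cu uf] := fC _ e4; have [v Cv vg] := gC _ e4.
exists (mix t u v); first exact: Cc.
have ui := Ci _ Cu; have vi := Ci _ Cv.
have uf' := sqintB ui fi; have vg' := sqintB vi gi.
have -> : n2 (mix t u v \- mix t f g) =
    n2 ((fun x => (1 - t) * (u \- f) x) \+ (fun x => t * (v \- g) x)).
  by apply: eq_Rintegral => x _ /=; congr (_ ^+ 2); rewrite /mix /fmix; ring.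
apply: (le_trans (n2D_le (sqintZ _ uf') (sqintZ _ vg'))).
rewrite !n2Z//; move: t01 => /andP[t0 t1].
have h1 : (1 - t) ^+ 2 <= 1 by rewrite expr_le1//; lra.
have h2 : t ^+ 2 <= 1 by rewrite expr_le1//; lra.
have := ler_wpM2r (n2_ge0 mu (u \- f)) h1; rewrite mul1r.
have := ler_wpM2r (n2_ge0 mu (v \- g)) h2; rewrite mul1r; lra.
Qed.

(* Mazur's lemma, through the projection onto the closure of [C]. *)
Lemma weak_limit_in_closure C (u : nat -> T -> R) g : convex_L2 C -> sqint g ->
  (forall n, sqint (u n)) -> (\forall n \near \oo, C (u n)) ->
  (forall h, sqint h -> ip (u n) h @[n --> \oo] --> ip g h) ->
  closure_L2 C g.
Proof.
move=> Cc gi ui uC ug; split => //.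
have [N _ CN] := uC.
have CuN : C (u N) by exact: (CN N (leqnn N)).
have CuN' : exists2 w, C w & n2 (w \- g) <= n2 (u N \- g) by exists (u N).
have [w [P [Pi wP wlim Pmin]]] := @decreasing_convex_min (fun=> C) g
  (n2 (u N \- g)) (fun=> Cc) (fun=> @subset_refl _ C) gi (fun=> CuN').
have CP : closure_L2 C P.
  split => // e /wlim[K KP]; exists (w K); first exact: (wP K).1.
  exact: KP.
have CsubC v : C v -> closure_L2 C v.
  move=> Cv; split; first exact: Cc.1.
  move=> e e0; exists v => //.
  have -> : n2 (v \- v) = 0.
    rewrite /n2; under eq_Rintegral do rewrite /= subrr expr0n/=.
    by rewrite Rintegral_cst// mul0r.
  exact: ltW.
have Pmin' Q : closure_L2 C Q -> n2 (P \- g) <= n2 (Q \- g).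
  move=> [Qi CQ]; apply: le_n2_approx; first exact: sqintB.
  move=> e e0; have [v Cv vQ] := CQ e e0; exists (v \- g); split.
  - exact: sqintB (Cc.1 _ Cv) gi.
  - apply: le_trans vQ; rewrite le_eqVlt; apply/orP; left.
    by apply/eqP; apply: eq_Rintegral => x _ /=; congr (_ ^+ 2); ring.
  - by apply: Pmin; [exact: n2_ge0|exists v].
(* The variational inequality for [Q = u n] passes to the weak limit and holds for [Q = g], where it
   reads [0 <= - n2 (P - g)]. *)
have key : 0 <= ip (P \- g) (g \- P).
  have := variational_inequality (closure_L2_convex Cc) CP gi Pmin'.
  move=> var; have lim : ip (P \- g) (u n \- P) @[n --> \oo] -->
      ip (P \- g) (g \- P).
    have Pg := sqintB Pi gi.
    have -> : (fun n => ip (P \- g) (u n \- P)) =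
        (fun n => ip (u n) (P \- g) - ip (P \- g) P).
      by apply/funext => n; rewrite ipBr// [ip _ (u n)]ipC.
    rewrite ipBr// [ip _ g]ipC; apply: cvgB; last exact: cvg_cst.
    exact: ug.
  apply: (ler_cvg_to (cvg_cst 0) lim); exists N => // n Nn.
  by apply/var/CsubC/CN.
have Pg0 : n2 (P \- g) <= 0.
  have -> : n2 (P \- g) = - ip (P \- g) (g \- P).
    rewrite -ipNr; [|exact: sqintB|exact: sqintB].
    by rewrite n2_ip; congr ip; apply/funext => x /=; ring.
  by rewrite oppr_le0.
move=> e e0; have e2 : 0 < e / 2 by rewrite divr_gt0.
have [K KP] := wlim _ e2; exists (w K); first exact: (wP K).1.
have := n2_triangle (Cc.1 _ (wP K).1) Pi gi; have := KP K (leqnn K); lra.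
Qed.

End convex_projection.

(** * Pointwise Lipschitz constants *)

Section local_lipschitz_constant.
Context (R : realType) (X : completeMetricType R).
Implicit Types (f g chi : X -> R) (x y : X).

Lemma LIP_pos f : LIP f ->
  exists2 L : R, 0 <= L & forall x y, `|f x - f y| <= L * mdist x y.
Proof.
move=> [L fL]; exists `|L| => // x y; apply: (le_trans (fL x y)).
by rewrite ler_wpM2r ?mdist_ge0// ler_norm.
Qed.

(** A bound on the upper limit in epsilon form. It is trivial at isolated points, in accordance with
    the value [0] of [lip] there. *)
Definition slope_le f x (c : R) : Prop := forall e, 0 < e ->
  exists2 r, 0 < r & forall y, mdist x y < r -> `|f x - f y| <= (c + e) * mdist x y.

Lemma dnbhs_ball x (V : set X) : (x^') V <->
  exists2 r, 0 < r & forall y, mdist x y < r -> y != x -> V y.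
Proof.
rewrite /dnbhs /within/= -metricType_numDomainType.filter_from_mdist_nbhs; split.
  by move=> [r r0 rV]; exists r => // y xy yx; exact: rV.
by move=> [r r0 rV]; exists r => // y /= xy yx; exact: rV.
Qed.

Lemma limit_point_ball x : limit_point [set: X] x <->
  forall r, 0 < r -> exists2 y, y != x & mdist x y < r.
Proof.
split => [lx r r0|h U].
  have [|y [yx _ xy]] := lx [set y | mdist x y < r]; last by exists y.
  by rewrite -metricType_numDomainType.filter_from_mdist_nbhs; exists r.
rewrite -metricType_numDomainType.filter_from_mdist_nbhs => -[r /= r0 rU].
by have [y yx xy] := h r r0; exists y; split => //; exact: rU.
Qed.

Lemma lipE f x : LIP f -> limit_point [set: X] x ->
  0 <= lip f x /\
  limf_esup (fun y => (`|f x - f y| / mdist x y)%:E) x^' = (lip f x)%:E.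
Proof.
move=> /LIP_pos[L L0 fL] lx.
set s := limf_esup _ _.
have s0 : (0 <= s)%E.
  apply: le_ereal_inf_tmp => _ [V /dnbhs_ball[r r0 rV] <-].
  have [y yx xy] := (limit_point_ball x).1 lx r r0.
  apply: (@le_trans _ _ (`|f x - f y| / mdist x y)%:E).
    by rewrite lee_fin divr_ge0 ?mdist_ge0.
  by apply: ereal_sup_ubound; exists y => //; exact: rV.
have sL : (s <= L%:E)%E.
  apply: (@le_trans _ _ (ereal_sup
      [set (`|f x - f y| / mdist x y)%:E | y in [set y | y != x]])).
    by apply: ereal_inf_lbound; eexists; [|reflexivity]; apply/dnbhs_ball; exists 1.
  apply: ge_ereal_sup => _ [y /= yx <-].
  by rewrite lee_fin ler_pdivrMr// mdist_gt0 eq_sym.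
have -> : lip f x = fine s by rewrite /lip asboolT.
split; first exact: fine_ge0.
rewrite fineK// fin_numElt (lt_le_trans _ s0)//=; exact: le_lt_trans sL (ltry _).
Qed.

Lemma lip_ge0 f x : LIP f -> 0 <= lip f x.
Proof.
move=> fL; have [lx|nlx] := pselect (limit_point [set: X] x).
  exact: (lipE fL lx).1.
by rewrite /lip asboolF.
Qed.

Lemma lip_leP f x c : LIP f -> 0 <= c -> lip f x <= c <-> slope_le f x c.
Proof.
move=> fL c0; have [lx|nlx] := pselect (limit_point [set: X] x); last first.
  rewrite /lip asboolF//; split => // _ e e0.
  have [r [r0 rP]] : exists r, 0 < r /\ forall y, mdist x y < r -> y = x.
    apply: contrapT => h; apply: nlx; apply/limit_point_ball => r r0.
    apply: contrapT => h'; apply: h; exists r; split => // y xy.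
    by apply: contrapT => /eqP yx; apply: h'; exists y.
  exists r => // y /rP ->; rewrite subrr normr0 mulr_ge0 ?mdist_ge0//; lra.
have [l0 lE] := lipE fL lx; rewrite -lee_fin -lE; split.
  move=> lc e e0.
  have : (limf_esup (fun y => (`|f x - f y| / mdist x y)%:E) x^' < (c + e)%:E)%E.
    by apply: (le_lt_trans lc); rewrite lte_fin ltrDl.
  move=> /ereal_inf_lt[_ [V /dnbhs_ball[r r0 rV] <-] Vc].
  exists r => // y xy; have [->|yx] := eqVneq y x.
    by rewrite subrr normr0 mulr_ge0 ?mdist_ge0//; lra.
  rewrite -ler_pdivrMr ?mdist_gt0 1?eq_sym// -lee_fin.
  apply: (le_trans _ (ltW Vc)); apply: ereal_sup_ubound; exists y => //.
  exact: rV.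
move=> h; apply/lee_addgt0Pr => e e0; have [r r0 rP] := h e e0.
apply: (@le_trans _ _ (ereal_sup [set (`|f x - f y| / mdist x y)%:E |
    y in [set y | y != x /\ mdist x y < r]])).
  apply: ereal_inf_lbound; eexists; [|reflexivity].
  by apply/dnbhs_ball; exists r.
apply: ge_ereal_sup => _ [y /= [yx xy] <-].
rewrite -EFinD lee_fin ler_pdivrMr ?mdist_gt0 1?eq_sym//; exact: rP.
Qed.

Lemma lip_slope f x : LIP f -> slope_le f x (lip f x).
Proof. by move=> fL; apply/(lip_leP _ fL) => //; exact: lip_ge0. Qed.

Lemma lip_le_const f x L : 0 <= L ->
  (forall x y, `|f x - f y| <= L * mdist x y) -> lip f x <= L.
Proof.
move=> L0 fL; apply/lip_leP => //; first by exists L.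
move=> e e0; exists 1 => // y _; apply: (le_trans (fL x y)).
by rewrite ler_wpM2r ?mdist_ge0// lerDl ltW.
Qed.

Lemma LIP_cst c : LIP (fun _ : X => c).
Proof. by exists 0 => x y; rewrite subrr normr0 mul0r. Qed.

Lemma lip_cst c x : lip (fun _ : X => c) x = 0.
Proof.
apply/eqP; rewrite eq_le lip_ge0 ?andbT; last exact: LIP_cst.
by apply: lip_le_const => // y z; rewrite subrr normr0 mul0r.
Qed.

Lemma LIPD f g : LIP f -> LIP g -> LIP (f \+ g).
Proof.
move=> [L fL] [K gK]; exists (L + K) => x y /=.
rewrite mulrDl opprD addrACA; apply: (le_trans (ler_normD _ _)); exact: lerD.
Qed.

Lemma LIPZ a f : LIP f -> LIP (fun x => a * f x).
Proof.
move=> /LIP_pos[L L0 fL]; exists (`|a| * L) => x y.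
by rewrite -mulrBr normrM -mulrA ler_wpM2l.
Qed.

Lemma lipD f g x : LIP f -> LIP g -> lip (f \+ g) x <= lip f x + lip g x.
Proof.
move=> fL gL; apply/lip_leP; [exact: LIPD|by rewrite addr_ge0 ?lip_ge0|].
move=> e e0; have e2 : 0 < e / 2 by rewrite divr_gt0.
have [r r0 rP] := lip_slope x fL e2; have [s s0 sP] := lip_slope x gL e2.
exists (Num.min r s); first by rewrite lt_min r0.
move=> y; rewrite lt_min => /andP[/rP h1 /sP h2] /=.
rewrite opprD addrACA; apply: (le_trans (ler_normD _ _)).
by move: h1 h2; set D := mdist x y; lra.
Qed.

Lemma lipZ a f x : LIP f -> lip (fun x => a * f x) x <= `|a| * lip f x.
Proof.
move=> fL; apply/lip_leP; [exact: LIPZ|by rewrite mulr_ge0 ?lip_ge0|].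
move=> e e0; have a1 : 0 < `|a| + 1 by rewrite ltr_wpDl.
have [r r0 rP] := lip_slope x fL (divr_gt0 e0 a1).
exists r => // y /rP h; rewrite -mulrBr normrM.
apply: (le_trans (ler_wpM2l (normr_ge0 a) h)).
rewrite mulrA ler_wpM2r ?mdist_ge0// mulrDr lerD2l.
rewrite mulrCA -[leRHS]mulr1 ler_wpM2l ?(ltW e0)// ler_pdivrMr//; lra.
Qed.

Lemma LIP_contraction (phi : R -> R) f :
  (forall s t, `|phi s - phi t| <= `|s - t|) -> LIP f -> LIP (phi \o f).
Proof.
by move=> phiC [L fL]; exists L => x y; exact: le_trans (phiC _ _) (fL x y).
Qed.

Lemma lip_contraction (phi : R -> R) f x :
  (forall s t, `|phi s - phi t| <= `|s - t|) -> LIP f ->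
  lip (phi \o f) x <= lip f x.
Proof.
move=> phiC fL; apply/lip_leP; [exact: LIP_contraction|exact: lip_ge0|].
move=> e e0; have [r r0 rP] := lip_slope x fL e0.
by exists r => // y /rP; exact: le_trans (phiC _ _).
Qed.

(** A discrete Leibniz rule, with the variation of [chi] isolated in the last term. *)
Lemma fmixE chi f g x y : fmix chi f g x - fmix chi f g y =
  (1 - chi x) * (f x - f y) + chi x * (g x - g y) +
  (chi x - chi y) * (g y - f y).
Proof. by rewrite /fmix; ring. Qed.

(** Boundedness serves the last term of the Leibniz rule, where the value [g y - f y] multiplies the
    variation of [chi]. *)
Lemma LIP_mix chi f g : LIP chi -> (forall x, 0 <= chi x <= 1) ->
  LIP f -> LIP g -> (exists M : R, forall x, `|f x| <= M) ->
  (exists M : R, forall x, `|g x| <= M) -> LIP (fmix chi f g).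
Proof.
move=> /LIP_pos[K K0 chiK] chi01 /LIP_pos[L L0 fL] /LIP_pos[L' L'0 gL'] [M fM] [N gN].
exists (L + L' + K * (N + M)) => x y; rewrite fmixE.
have /andP[c0 c1] := chi01 x.
apply: (le_trans (ler_normD _ _)); rewrite [leRHS]mulrDl; apply: lerD.
  apply: (le_trans (ler_normD _ _)); rewrite [leRHS]mulrDl !normrM; apply: lerD.
    rewrite -[leRHS]mul1r; apply: ler_pM => //.
    by rewrite ger0_norm; lra.
  rewrite -[leRHS]mul1r; apply: ler_pM => //.
  by rewrite ger0_norm.
rewrite normrM mulrAC; apply: ler_pM => //.
by apply: (le_trans (ler_normB _ _)); exact: lerD.
Qed.

(** The weights of [lip f] and [lip g] carry no extra constant; the price is a term in [g - f],
    small when both approximate the same function. *)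
Lemma lip_mix_le chi f g x : LIP chi -> (forall x, 0 <= chi x <= 1) ->
  LIP f -> LIP g -> LIP (fmix chi f g) ->
  lip (fmix chi f g) x <=
    (1 - chi x) * lip f x + chi x * lip g x + lip chi x * `|g x - f x|.
Proof.
move=> chiL chi01 fL gL mL.
have /andP[c0 c1] := chi01 x.
have lf := lip_ge0 x fL; have lg := lip_ge0 x gL; have lc := lip_ge0 x chiL.
apply/lip_leP => //.
  by rewrite !addr_ge0// mulr_ge0//; lra.
move=> e e0.
set D := `|g x - f x|.
have D0 : 0 <= D by exact: normr_ge0.
pose k := lip chi x.
have kD : 0 < k + D + 2 by rewrite /k; lra.
(* Chosen so that the errors [t + k t + t D + t^2] add up to at most [e]. *)
pose t := Num.min 1 (e / (k + D + 2)).
have t0 : 0 < t by rewrite lt_min ltr01 divr_gt0.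
have t1 : t <= 1 by rewrite ge_min lexx.
have te : t * (k + D + 2) <= e by rewrite -ler_pdivlMr// ge_min lexx orbT.
have [r1 r10 r1P] := lip_slope x fL t0.
have [r2 r20 r2P] := lip_slope x gL t0.
have [r3 r30 r3P] := lip_slope x chiL t0.
have lfg : 0 < lip f x + lip g x + 2 by lra.
(* The last radius makes [g - f] vary by at most [t]. *)
exists (Num.min (Num.min r1 r2) (Num.min r3 (t / (lip f x + lip g x + 2)))).
  by rewrite !lt_min r10 r20 r30 divr_gt0.
move=> y; rewrite !lt_min => /andP[/andP[/r1P h1 /r2P h2] /andP[/r3P h3]].
rewrite ltr_pdivlMr// => h4.
set d := mdist x y in h1 h2 h3 h4 *.
have d0 : 0 <= d by exact: mdist_ge0.
have dt : 0 <= d * (1 - t) by rewrite mulr_ge0// subr_ge0.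
have gfy : `|g y - f y| <= D + t.
  have -> : g y - f y = (g x - f x) + (f x - f y) - (g x - g y) by ring.
  apply: (le_trans (ler_normB _ _)).
  have := ler_normD (g x - f x) (f x - f y); rewrite -/D; lra.
rewrite fmixE; apply: (le_trans (ler_normD _ _)).
apply: (@le_trans _ _ ((1 - chi x) * ((lip f x + t) * d) +
    chi x * ((lip g x + t) * d) + (k + t) * d * (D + t))).
  apply: lerD; last by rewrite normrM; apply: ler_pM.
  apply: (le_trans (ler_normD _ _)); rewrite !normrM; apply: lerD.
    by rewrite ger0_norm ?ler_wpM2l//; lra.
  by rewrite ger0_norm// ler_wpM2l.
have key : t + k * t + t * D + t * t <= e.
  have : t * t <= t * 1 by rewrite ler_wpM2l// ltW.
  by move: te; lra.
have := ler_wpM2r d0 key; rewrite -/k; lra.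
Qed.

Definition truncate (M t : R) : R := Num.max (- M) (Num.min M t).

Lemma truncate_contraction M s t : `|truncate M s - truncate M t| <= `|s - t|.
Proof.
have maxC (a u v : R) : `|Num.max a u - Num.max a v| <= `|u - v|.
  have := ler_norm (u - v); have := ler_norm (v - u); rewrite distrC.
  have := normr_ge0 (u - v); move: `|u - v| => r h1 h2 h3.
  by rewrite ler_norml /Num.max; case: (ltP a u) => ?; case: (ltP a v) => ?;
    apply/andP; split; lra.
have minC (a u v : R) : `|Num.min a u - Num.min a v| <= `|u - v|.
  have := ler_norm (u - v); have := ler_norm (v - u); rewrite distrC.
  have := normr_ge0 (u - v); move: `|u - v| => r h1 h2 h3.
  by rewrite ler_norml /Num.min; case: (ltP a u) => ?; case: (ltP a v) => ?;
    apply/andP; split; lra.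
exact: le_trans (maxC _ _ _) (minC _ _ _).
Qed.

Lemma truncate_bound M t : 0 <= M -> `|truncate M t| <= M.
Proof.
move=> M0; rewrite ler_norml /truncate le_max lexx/= ge_max ge_min lexx/= andbT.
lra.
Qed.

Lemma truncate_le M t : 0 <= M -> `|truncate M t| <= `|t|.
Proof.
move=> M0; have := truncate_contraction M t 0; rewrite subr0.
suff -> : truncate M 0 = 0 by rewrite subr0.
by rewrite /truncate min_r// max_r// oppr_le0.
Qed.

Lemma truncate_id M t : `|t| <= M -> truncate M t = t.
Proof.
by rewrite ler_norml => /andP[h1 h2]; rewrite /truncate min_r// max_r.
Qed.

(** When [x] moves by [delta], [|f x - f y|] changes by at most [L * delta] and [a * mdist x y] by
    at most [a * delta], so the strict inequality persists for the same [y]. *)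
Lemma lip_sublevel_open f (a r : R) : LIP f -> 0 <= a ->
  open [set x | exists2 y, mdist x y < r & a * mdist x y < `|f x - f y|].
Proof.
move=> /LIP_pos[L L0 fL] a0; rewrite openE => x [y xy h].
rewrite /interior -metricType_numDomainType.filter_from_mdist_nbhs.
have La : 0 < L + a + 1 by lra.
exists (Num.min (r - mdist x y) ((`|f x - f y| - a * mdist x y) / (L + a + 1))).
  by rewrite /= lt_min subr_gt0 xy divr_gt0// subr_gt0.
move=> z; rewrite /= lt_min => /andP[h1]; rewrite ltr_pdivlMr// => h2.
have tr := metric_triangle z x y; rewrite [mdist z x]metric_sym in tr.
exists y; first lra.
have h3 : `|f x - f y| <= L * mdist x z + `|f z - f y|.
  rewrite -(subrKA (f z)); apply: (le_trans (ler_normD _ _)).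
  by rewrite lerD2r.
have := ler_wpM2l a0 tr; have := mdist_ge0 x z; lra.
Qed.

Section measurability.
Variable m : {measure set (borel X) -> \bar R}.

Lemma open_measurable_completion (U : set X) : open U ->
  measurable (U : set (completion m)).
Proof.
move=> oU; rewrite measurable_completionE; exists U.
  exact: sub_sigma_algebra.
by exists set0; [exact: negligible_set0|rewrite setU0].
Qed.

Lemma measurable_fun_le d (T : measurableType d) (f : T -> R) :
  (forall c, measurable [set x | f x <= c]) -> measurable_fun setT f.
Proof.
move=> h; apply: (measurability _ (RGenOInfty.measurableE R)) => //.
move=> _ [_ [c ->] <-]; rewrite setTI.
have -> : f @^-1` `]c, +oo[%classic = ~` [set x | f x <= c].
  by apply/seteqP; split => x /=; rewrite in_itv/= andbT ltNge => /negP.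
exact: measurableC.
Qed.

Lemma measurable_LIP f : LIP f ->
  measurable_fun setT (f : completion m -> R).
Proof.
move=> /LIP_pos[L L0 fL]; apply: measurable_fun_le => c.
rewrite -[X in measurable X]setCK; apply: measurableC.
apply: open_measurable_completion.
suff : open (~` [set x | f x <= c]) by [].
rewrite openE => x /negP; rewrite -ltNge => xc.
rewrite /interior -metricType_numDomainType.filter_from_mdist_nbhs.
have L1 : 0 < L + 1 by lra.
exists ((f x - c) / (L + 1)); first by rewrite /= divr_gt0// subr_gt0.
move=> y /=; rewrite ltr_pdivlMr// => h; apply/negP; rewrite -ltNge.
have := fL x y; rewrite ler_norml => /andP[_ h2].
have := mdist_ge0 x y; lra.
Qed.

(** [lip f x <= c] means that for every [i] some radius [1 / (j + 1)] excludes the quotients above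
    [c + 1 / (i + 1)]; for fixed [i] and [j] the failure of this is an open condition on [x]. *)
Lemma measurable_lip f : LIP f ->
  measurable_fun setT (lip f : completion m -> R).
Proof.
move=> fL; apply: measurable_fun_le => c; have [c0|c0] := ltP c 0.
  rewrite [X in measurable X](_ : _ = set0)//; apply/seteqP; split => // x /=.
  by have := lip_ge0 x fL; lra.
pose U i j := [set x | exists2 y, mdist x y < j.+1%:R^-1 :> R &
  (c + i.+1%:R^-1) * mdist x y < `|f x - f y|].
have -> : [set x | lip f x <= c] = \bigcap_i \bigcup_j ~` U i j.
  apply/seteqP; split => x /=.
    move=> /(lip_leP _ fL c0) h i _; have i0 : 0 < i.+1%:R^-1 :> R by rewrite invr_gt0.
    have [r r0 rP] := h _ i0; have [j jP] := natSinv_lt r0.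
    exists j => // -[y xy]; apply/negP; rewrite -leNgt; apply: rP.
    exact: lt_trans xy (jP j (leqnn j)).
  move=> h; apply/(lip_leP _ fL c0) => e e0.
  have [i iP] := natSinv_lt e0; have [j _ ij] := h i I.
  exists j.+1%:R^-1; first by rewrite invr_gt0.
  move=> y xy; rewrite leNgt; apply/negP => xy'; apply: ij; exists y => //.
  apply: le_lt_trans xy'; rewrite ler_wpM2r ?mdist_ge0// lerD2l ltW//.
  exact: iP.
apply: bigcapT_measurable => i; apply: bigcupT_measurable => j.
apply: measurableC; apply: open_measurable_completion.
by apply: lip_sublevel_open => //; rewrite addr_ge0// invr_ge0.
Qed.

End measurability.

End local_lipschitz_constant.

Section L2_complements.
Context (R : realType) d (T : measurableType d).
Variable mu : {measure set T -> \bar R}.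
Implicit Types (f g h u v w chi : T -> R).
Local Notation sqint := (sqint mu).
Local Notation n2 := (n2 mu).
Local Notation ip := (ip mu).

Lemma sqint_fmix chi f g : measurable_fun setT chi ->
  (forall x, 0 <= chi x <= 1) -> sqint f -> sqint g -> sqint (fmix chi f g).
Proof.
move=> mchi chi01 fi gi; apply: sqintD.
  apply: (sqint_le _ fi) => [|x].
    apply: measurable_funM; last exact: fi.1.
    by apply: measurable_funB => //; exact: measurable_cst.
  have /andP[c0 c1] := chi01 x.
  by rewrite normrM ger0_norm ?subr_ge0// ler_piMl//; lra.
apply: (sqint_le _ gi) => [|x]; first by apply: measurable_funM => //; exact: gi.1.
have /andP[c0 c1] := chi01 x.
by rewrite normrM ger0_norm// ler_piMl.
Qed.

Lemma n2_fmix_le chi f g : measurable_fun setT chi ->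
  (forall x, 0 <= chi x <= 1) -> sqint f -> sqint g ->
  n2 (fmix chi f g) <= n2 f + n2 g.
Proof.
move=> mchi chi01 fi gi; have mi := sqint_fmix mchi chi01 fi gi.
rewrite /n2 -RintegralD//; [|exact: fi.2|exact: gi.2].
apply: le_Rintegral => //; [exact: mi.2|exact: integrable_fD fi.2 gi.2|].
move=> x _; rewrite /fmix; have /andP[c0 c1] := chi01 x.
have h1 : 0 <= (1 - chi x) * chi x by rewrite mulr_ge0//; lra.
have := mulr_ge0 h1 (sqr_ge0 (f x - g x)).
have := mulr_ge0 c0 (sqr_ge0 (f x)).
have h2 : 0 <= 1 - chi x by lra.
have := mulr_ge0 h2 (sqr_ge0 (g x)); lra.
Qed.

Lemma n2_mix_le (t c : R) f g : 0 <= t <= 1 -> sqint f -> sqint g ->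
  n2 f <= c -> n2 g <= c -> n2 (mix t f g) <= c.
Proof.
move=> t01 fi gi fc gc; have mi := sqint_mix t fi gi.
have /andP[t0 t1] := t01.
apply: (@le_trans _ _ ((1 - t) * n2 f + t * n2 g)).
  rewrite /n2 -(RintegralZl _ measurableT fi.2) -(RintegralZl _ measurableT gi.2).
  have fi' := integrable_fZ (1 - t) fi.2; have gi' := integrable_fZ t gi.2.
  rewrite -RintegralD//.
  apply: le_Rintegral => //; [exact: mi.2|exact: integrable_fD fi' gi'|].
  move=> x _; rewrite /mix /fmix.
  have h1 : 0 <= (1 - t) * t by rewrite mulr_ge0//; lra.
  have := mulr_ge0 h1 (sqr_ge0 (f x - g x)); lra.
have h1 : 0 <= 1 - t by lra.
have := ler_wpM2l h1 fc; have := ler_wpM2l t0 gc; lra.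
Qed.

Lemma n2_upper h (eps : R) : sqint h -> 0 < eps -> exists2 del : R, 0 < del &
  forall v, sqint v -> n2 (v \- h) <= del -> n2 v <= n2 h + eps.
Proof.
move=> hi eps0; have h0 := n2_ge0 mu h.
pose e := eps / (2 * (n2 h + 1)).
have h1 : 0 < 2 * (n2 h + 1) by lra.
have e0 : 0 < e by rewrite divr_gt0.
have ei : 0 < e^-1 by rewrite invr_gt0.
have ei1 : 0 < 2 * (1 + e^-1) by lra.
exists (eps / (2 * (1 + e^-1))); first by rewrite divr_gt0.
move=> v vi; rewrite ler_pdivlMr// => vh.
have -> : n2 v = n2 (h \+ (v \- h)).
  by apply: eq_Rintegral => x _ /=; congr (_ ^+ 2); ring.
apply: (le_trans (n2_young e0 hi (sqintB vi hi))).
have : e * (2 * (n2 h + 1)) = eps by rewrite divfK// gt_eqF.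
lra.
Qed.

Lemma ip_bound (e : R) f g : 0 < e -> sqint f -> sqint g ->
  `|ip f g| <= e * n2 g + e^-1 * n2 f.
Proof.
move=> e0 fi gi.
have H (s : R) : s ^+ 2 = 1 -> s * ip f g <= e * n2 g + e^-1 * n2 f.
  move=> s1; have egi := sqintZ (s * e) gi.
  have := n2_ge0 mu (f \- (fun x => (s * e) * g x)).
  rewrite n2B// n2Z// ipZr// exprMn s1 mul1r => h.
  have ei : 0 < e^-1 by rewrite invr_gt0.
  rewrite -(ler_pM2l e0) mulrDr [e * (e^-1 * _)]mulrA divff ?gt_eqF// mul1r.
  have := n2_ge0 mu f; have := mulr_ge0 (sqr_ge0 e) (n2_ge0 mu g); lra.
have := H 1 (expr1n _ _); have := H (-1); rewrite sqrrN expr1n => /(_ erefl).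
by rewrite mul1r mulN1r => h1 h2; rewrite ler_norml; apply/andP; split; lra.
Qed.

Lemma ip_cvg (u : nat -> T -> R) f h : (forall n, sqint (u n)) -> sqint f ->
  sqint h ->
  (forall e, 0 < e -> exists N, forall n, (N <= n)%N -> n2 (u n \- f) <= e) ->
  ip (u n) h @[n --> \oo] --> ip f h.
Proof.
move=> ui fi hi uf; apply/cvgrPdist_le => eps eps0.
have h0 := n2_ge0 mu h.
pose e := eps / (2 * (n2 h + 1)).
have h1 : 0 < 2 * (n2 h + 1) by lra.
have e0 : 0 < e by rewrite divr_gt0.
have ee : e * (2 * (n2 h + 1)) = eps by rewrite divfK// gt_eqF.
have [N NP] := uf (e * (eps / 2)) (mulr_gt0 e0 (divr_gt0 eps0 (ltr0Sn _ 1))).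
exists N => // n /= /NP uN.
have ufi := sqintB (ui n) fi.
have -> : ip f h - ip (u n) h = - ip (u n \- f) h.
  by rewrite [ip (u n \- f) h]ipC ipBr// [ip h _]ipC [ip h f]ipC opprB.
rewrite normrN; apply: (le_trans (ip_bound e0 ufi hi)).
have : e^-1 * n2 (u n \- f) <= eps / 2.
  by rewrite mulrC ler_pdivrMr// mulrC.
have := ee; lra.
Qed.

Lemma dominated_Rintegral (D : set T) (F : nat -> T -> R) f g : measurable D ->
  (forall n, measurable_fun setT (F n)) -> measurable_fun setT f ->
  (forall x, D x -> F n x @[n --> \oo] --> f x) ->
  mu.-integrable setT (EFin \o g) -> (forall n x, `|F n x| <= g x) ->
  \int[mu]_(x in D) F n x @[n --> \oo] --> \int[mu]_(x in D) f x.
Proof.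
move=> mD mF mf Ff gi Fg.
have giD : mu.-integrable D (EFin \o g) by apply: integrableS gi.
have mFD n : measurable_fun D (EFin \o F n).
  by apply/measurable_EFinP; apply: measurable_funS (mF n).
have mfD : measurable_fun D (EFin \o f).
  by apply/measurable_EFinP; apply: measurable_funS mf.
have FfD x : D x -> (EFin \o F n) x @[n --> \oo] --> (EFin \o f) x.
  by move=> Dx; apply: cvg_EFin; [exact: nearW|exact: Ff].
have FgD : {ae mu, forall x n, D x -> (`|(EFin \o F n) x| <= (EFin \o g) x)%E}.
  by apply: aeW => x n _; rewrite /= lee_fin.
have [fi _ cv] := @dominated_convergence _ _ _ mu D mD (fun n => EFin \o F n)
  (EFin \o f) (EFin \o g) mFD mfD (aeW _ FfD) giD FgD.
apply: fine_cvg; rewrite fineK//; exact: integrable_fin_num.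
Qed.

Lemma n2_dominated_cvg (u : nat -> T -> R) f g : (forall n, sqint (u n)) ->
  sqint f -> sqint g -> (forall x, u n x @[n --> \oo] --> f x) ->
  (forall n x, `|u n x| <= `|g x|) -> n2 (u n) @[n --> \oo] --> n2 f.
Proof.
move=> ui fi gi uf ug.
apply: (@dominated_Rintegral _ _ _ (fun x => g x ^+ 2)) => //.
- by move=> n; apply: measurable_funX; exact: (ui n).1.
- by apply: measurable_funX; exact: fi.1.
- by move=> x _; exact: (cvgM (uf x) (uf x)).
- exact: gi.2.
- by move=> n x; rewrite ger0_norm ?sqr_ge0// sqr_le_abs.
Qed.

Lemma LnormE f : sqint f -> Lnorm mu 2%:E (EFin \o f) = (Num.sqrt (n2 f))%:E.
Proof.
move=> fi; rewrite unlock.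
have -> : (\int[mu]_x (`|(EFin \o f) x| `^ 2) = (n2 f)%:E)%E.
  rewrite -n2E//; apply: eq_integral => x _ /=.
  by rewrite powR_mulrn// sqr_abs.
by rewrite poweR_EFin powR12_sqrt// n2_ge0.
Qed.

Lemma Lnorm_le f g : sqint f -> sqint g ->
  (Lnorm mu 2%:E (EFin \o f) <= Lnorm mu 2%:E (EFin \o g))%E = (n2 f <= n2 g).
Proof. by move=> fi gi; rewrite !LnormE// lee_fin ler_sqrt// n2_ge0. Qed.

Lemma Lnorm_cvg0 (u : nat -> T -> R) : (forall n, sqint (u n)) ->
  Lnorm mu 2%:E (EFin \o u n) @[n --> \oo] --> 0%E <->
  forall e, 0 < e -> exists N, forall n, (N <= n)%N -> n2 (u n) <= e.
Proof.
move=> ui.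
have -> : (fun n => Lnorm mu 2%:E (EFin \o u n)) =
    (fun n => (Num.sqrt (n2 (u n)))%:E).
  by apply/funext => n; exact: LnormE.
split => [/fine_cvgP[_ /cvgrPdist_le h] e e0|h].
  have s0 : 0 < Num.sqrt e by rewrite sqrtr_gt0.
  have [N _ NP] := h _ s0; exists N => n /NP /=.
  rewrite sub0r normrN ger0_norm ?sqrtr_ge0// ler_sqrt//; exact: ltW.
apply: cvg_EFin; first exact: nearW.
apply/cvgrPdist_le => e e0; have [N NP] := h (e ^+ 2) (exprn_gt0 2 e0).
exists N => // n /NP un; rewrite sub0r normrN ger0_norm ?sqrtr_ge0//.
rewrite -[leRHS]ger0_norm ?(ltW e0)// -sqrtr_sqr ler_sqrt//; exact: sqr_ge0.
Qed.

End L2_complements.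

(** * Slopes as strong limits *)

Section strong_slopes.
Context (R : realType) (X : completeMetricType R).
Variable m : {measure set (borel X) -> \bar R}.
Implicit Types (f g h w G H : X -> R).
Local Notation Xm := (completion m).
Local Notation mu := (completed m).
Local Notation sqint := (@sqint R _ Xm mu).
Local Notation n2 := (@n2 R _ Xm mu).
Local Notation ip := (@ip R _ Xm mu).

Definition bounded_fun f : Prop := exists M : R, forall x, `|f x| <= M.

(* [lip] is only bounded from above by [w]: this makes these sets convex. *)
Definition slope_set f (n : nat) : set (X -> R) :=
  [set w | sqint w /\ exists g, [/\ LIP g, bounded_fun g, sqint g,
    n2 (g \- f) <= n.+1%:R^-1 & forall x, lip g x <= w x]].

(** The counterpart of [relaxed_slope] for norm limits, with upper bounds of [lip] in place of
    [lip]. Cutoff estimates can be made directly on the approximations, and weak limits are brought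
    to this form by convexity. *)
Definition strong_slope f : set (X -> R) :=
  [set G | sqint G /\ forall n, closure_L2 mu (slope_set f n) G].

Lemma LIP_sqint_lip f w : LIP f -> sqint w -> (forall x, lip f x <= w x) ->
  sqint (lip f).
Proof.
move=> fL wi fw; apply: (sqint_le _ wi); first exact: measurable_lip.
move=> x; rewrite ger0_norm ?lip_ge0//; exact: le_trans (fw x) (ler_norm _).
Qed.

Lemma slope_set_decr f n k : (n <= k)%N -> slope_set f k `<=` slope_set f n.
Proof.
move=> nk w [wi [g [gL gb gi gf gw]]]; split => //; exists g; split => //.
apply: (le_trans gf); rewrite lef_pV2 ?posrE ?ltr0n// ler_nat//.
Qed.

Lemma slope_set_convex f n : sqint f -> convex_L2 mu (slope_set f n).
Proof.
move=> fi; split=> [w []//|t w1 w2 t01].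
move=> [w1i [g1 [g1L [M1 g1M] g1i g1f g1w]]] [w2i [g2 [g2L [M2 g2M] g2i g2f g2w]]].
split; first exact: sqint_mix.
have cL := @LIP_cst R X t.
have mL : LIP (fmix (fun=> t) g1 g2).
  by apply: LIP_mix => //; [exists M1|exists M2].
have /andP[t0 t1] := t01.
exists (mix t g1 g2); split.
- exact: mL.
- exists (M1 + M2) => x; rewrite /mix /fmix; apply: (le_trans (ler_normD _ _)).
  apply: lerD; rewrite normrM.
    by apply: (le_trans _ (g1M x)); rewrite ger0_norm ?subr_ge0// ler_piMl//; lra.
  by apply: (le_trans _ (g2M x)); rewrite ger0_norm// ler_piMl.
- exact: sqint_mix.
- have -> : mix t g1 g2 \- f = mix t (g1 \- f) (g2 \- f).
    by apply/funext => x; rewrite /mix /fmix /=; ring.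
  by apply: n2_mix_le => //; exact: sqintB.
- move=> x; apply: (le_trans (lip_mix_le x cL (fun=> t01) g1L g2L mL)).
  rewrite lip_cst mul0r addr0 /mix /fmix; apply: lerD; apply: ler_wpM2l => //; lra.
Qed.

Lemma strong_slope_convex f : sqint f -> convex_L2 mu (strong_slope f).
Proof.
move=> fi; split=> [G []//|t G H t01 [Gi GC] [Hi HC]]; split.
  exact: sqint_mix.
by move=> n; apply: (closure_L2_convex (slope_set_convex n fi)).2.
Qed.

Lemma measurable_chi chi : LIP chi -> measurable_fun setT (chi : Xm -> R).
Proof. exact: measurable_LIP. Qed.

(** Mix the approximating functions themselves: the Leibniz rule costs [K |g2 - g1|], which is small
    in L^2 since [g1] and [g2] both approximate [f]. The boundedness required in [slope_set] makes
    the mixture Lipschitz. *)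
Lemma strong_slope_mix f G H chi : sqint f -> LIP chi ->
  (forall x, 0 <= chi x <= 1) -> strong_slope f G -> strong_slope f H ->
  strong_slope f (fmix chi G H).
Proof.
move=> fi cL c01 [Gi GC] [Hi HC].
have mc := measurable_chi cL.
have GHi : sqint (fmix chi G H) by apply: sqint_fmix.
split => // n; split => // e e0.
have /LIP_pos[K K0 cK] := cL.
have d1 : 0 < 1 + 8 * K ^+ 2 + 1 by have := sqr_ge0 K; lra.
(* [4 del] will bound [n2 (g2 - g1)], and the final error is at most [4 del + 8 K^2 del]. *)
pose del := Num.min (n.+1%:R^-1) (e / (1 + 8 * K ^+ 2 + 1)) / 4.
have del0 : 0 < del by rewrite divr_gt0// lt_min invr_gt0 ltr0n/= divr_gt0.
have del1 : del * 4 <= n.+1%:R^-1 by rewrite divfK ?pnatr_eq0// ge_min lexx.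
have del2 : del * 4 * (1 + 8 * K ^+ 2 + 1) <= e.
  by rewrite -ler_pdivlMr// divfK ?pnatr_eq0// ge_min lexx orbT.
have [k kP] := natSinv_lt del0.
have {}kP := kP k (leqnn k).
have [_ /(_ _ del0)[w1 [w1i [g1 [g1L g1b g1i g1f g1w]]] w1G]] := GC k.
have [_ /(_ _ del0)[w2 [w2i [g2 [g2L g2b g2i g2f g2w]]] w2H]] := HC k.
have mL : LIP (fmix chi g1 g2) by exact: LIP_mix.
pose w := fmix chi w1 w2 \+ (fun x => K * `|(g2 \- g1) x|).
have g21 : sqint (g2 \- g1) by exact: sqintB.
have ag21 : sqint (fun x => `|(g2 \- g1) x|).
  apply: (sqint_le _ g21); last by move=> x; rewrite normr_id.
  by apply: measurableT_comp => //; exact: g21.1.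
have mw12 : sqint (fmix chi w1 w2) by apply: sqint_fmix.
have n2g21 : n2 (fun x => `|(g2 \- g1) x|) <= 4 * del.
  have -> : n2 (fun x => `|(g2 \- g1) x|) = n2 (g2 \- g1).
    by apply: eq_Rintegral => x _; exact: sqr_abs.
  apply: (le_trans (n2_triangle g2i fi g1i)); rewrite [n2 (f \- g1)]n2C.
  move: g1f g2f kP; set a := k.+1%:R^-1; lra.
exists w.
  split; first by apply: sqintD => //; exact: sqintZ.
  exists (fmix chi g1 g2); split => //.
  - move: g1b g2b => [M1 g1M] [M2 g2M]; exists (M1 + M2) => x.
    have /andP[t0 t1] := c01 x; rewrite /fmix.
    apply: (le_trans (ler_normD _ _)); apply: lerD; rewrite normrM.
      by apply: (le_trans _ (g1M x)); rewrite ger0_norm ?subr_ge0// ler_piMl//; lra.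
    by apply: (le_trans _ (g2M x)); rewrite ger0_norm// ler_piMl.
  - by apply: sqint_fmix.
  - have -> : fmix chi g1 g2 \- f = fmix chi (g1 \- f) (g2 \- f).
      by apply/funext => x; rewrite /fmix /=; ring.
    apply: (le_trans (n2_fmix_le mc c01 (sqintB g1i fi) (sqintB g2i fi))).
    move: g1f g2f kP del1; set a := k.+1%:R^-1; set b := n.+1%:R^-1; lra.
  - move=> x; apply: (le_trans (lip_mix_le x cL c01 g1L g2L mL)).
    have /andP[t0 t1] := c01 x; rewrite /w /= /fmix; apply: lerD.
      by apply: lerD; apply: ler_wpM2l => //; lra.
    by apply: ler_wpM2r => //; exact: lip_le_const.
have -> : w \- fmix chi G H =
    fmix chi (w1 \- G) (w2 \- H) \+ (fun x => K * `|(g2 \- g1) x|).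
  by apply/funext => x; rewrite /w /fmix /=; ring.
have w1Gi := sqintB w1i Gi; have w2Hi := sqintB w2i Hi.
apply: (le_trans (n2D_le (sqint_fmix mc c01 w1Gi w2Hi) (sqintZ K ag21))).
rewrite n2Z//; have := n2_fmix_le mc c01 w1Gi w2Hi.
have := mulr_ge0 (sqr_ge0 K) (ltW del0).
have := ler_wpM2l (sqr_ge0 K) n2g21; lra.
Qed.

Lemma strong_slopeD f g G H : sqint f -> sqint g ->
  strong_slope f G -> strong_slope g H -> strong_slope (f \+ g) (G \+ H).
Proof.
move=> fi gi [Gi GC] [Hi HC]; have GHi := sqintD Gi Hi.
split => // n; split => // e e0.
pose del := Num.min (n.+1%:R^-1) e / 4.
have del0 : 0 < del by rewrite divr_gt0// lt_min invr_gt0 ltr0n.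
have del1 : del * 4 <= n.+1%:R^-1 by rewrite divfK ?pnatr_eq0// ge_min lexx.
have del2 : del * 4 <= e by rewrite divfK ?pnatr_eq0// ge_min lexx orbT.
have [k kP] := natSinv_lt del0.
have {}kP := kP k (leqnn k).
have [_ /(_ _ del0)[w1 [w1i [g1 [g1L [M1 g1M] g1i g1f g1w]]] w1G]] := GC k.
have [_ /(_ _ del0)[w2 [w2i [g2 [g2L [M2 g2M] g2i g2f g2w]]] w2H]] := HC k.
have split_sub (a b c d : X -> R) : (a \+ b) \- (c \+ d) = (a \- c) \+ (b \- d).
  by apply/funext => x /=; ring.
exists (w1 \+ w2).
  split; first exact: sqintD.
  exists (g1 \+ g2); split.
  - exact: LIPD.
  - exists (M1 + M2) => x /=; apply: (le_trans (ler_normD _ _)); exact: lerD.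
  - exact: sqintD.
  - rewrite split_sub; apply: (le_trans (n2D_le (sqintB g1i fi) (sqintB g2i gi))).
    move: g1f g2f kP del1; set a := k.+1%:R^-1; set b := n.+1%:R^-1; lra.
  - by move=> x; apply: (le_trans (lipD x g1L g2L)); apply: lerD.
rewrite split_sub; apply: (le_trans (n2D_le (sqintB w1i Gi) (sqintB w2i Hi))); lra.
Qed.

Lemma strong_slopeZ a f G : sqint f -> strong_slope f G ->
  strong_slope (fun x => a * f x) (fun x => `|a| * G x).
Proof.
move=> fi [Gi GC]; have aGi := sqintZ `|a| Gi.
split => // n; split => // e e0.
have a1 : 0 < a ^+ 2 + 1 by rewrite ltr_wpDl// sqr_ge0.
pose del := Num.min (n.+1%:R^-1) e / (a ^+ 2 + 1).
have del0 : 0 < del by rewrite divr_gt0// lt_min invr_gt0 ltr0n.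
have del1 : del * (a ^+ 2 + 1) <= n.+1%:R^-1 by rewrite divfK ?gt_eqF// ge_min lexx.
have del2 : del * (a ^+ 2 + 1) <= e by rewrite divfK ?gt_eqF// ge_min lexx orbT.
have [k kP] := natSinv_lt del0.
have {}kP := kP k (leqnn k).
have [_ /(_ _ del0)[w [wi [g [gL [M gM] gi gf gw]]] wG]] := GC k.
have split_sub (c : R) (u v : X -> R) :
    (fun x => c * u x) \- (fun x => c * v x) = (fun x => c * (u \- v) x).
  by apply/funext => x /=; ring.
have sq c v : a ^+ 2 * v <= a ^+ 2 * c -> 0 <= c -> c <= del ->
    a ^+ 2 * v <= del * (a ^+ 2 + 1).
  move=> h1 h2 h3; have := ler_wpM2l (sqr_ge0 a) h3; lra.
exists (fun x => `|a| * w x).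
  split; first exact: sqintZ.
  exists (fun x => a * g x); split.
  - exact: LIPZ.
  - by exists (`|a| * M) => x; rewrite normrM ler_wpM2l.
  - exact: sqintZ.
  - rewrite split_sub n2Z; last exact: sqintB.
    apply: le_trans del1; apply: (sq (n2 (g \- f))) => //; first exact: n2_ge0.
    exact: le_trans gf (ltW kP).
  - by move=> x; apply: (le_trans (lipZ a x gL)); rewrite ler_wpM2l.
rewrite split_sub n2Z; last exact: sqintB.
rewrite sqr_abs; apply: le_trans del2.
by apply: (sq (n2 (w \- G))) => //; exact: n2_ge0.
Qed.

Lemma strong_slope_ae f g : sqint f -> sqint g ->
  {ae mu, forall x : Xm, f x = g x} -> strong_slope f `<=` strong_slope g.
Proof.
move=> fi gi fg G [Gi GC]; split => // n; split => // e e0.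
have [_ /(_ _ e0)[w [wi [h [hL hb hi hf hw]]] wG]] := GC n.
exists w => //; split => //; exists h; split => //; apply: le_trans hf.
apply: n2_ae_le; [exact: sqintB|exact: sqintB|].
by apply: filterS fg => x /= ->.
Qed.

Lemma strong_slope_up f G H : sqint f -> sqint H -> strong_slope f G ->
  {ae mu, forall x : Xm, G x <= H x} -> strong_slope f H.
Proof.
move=> fi Hi [Gi GC] GH; split => // n; split => // e e0.
have [_ /(_ _ e0)[w [wi [h [hL hb hi hf hw]]] wG]] := GC n.
(* The positive part keeps [w'] above [w] at every point, as [slope_set] demands, although [G <= H]
   holds only almost everywhere; where it does, [w' - H = w - G]. *)
pose w' x := w x + Num.max 0 (H x - G x).
have w'i : sqint w'.
  apply: sqintD => //; apply: (sqint_le _ (sqintB Hi Gi)).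
    apply: measurable_maxr; first exact: measurable_cst.
    by apply: measurable_funB; [exact: Hi.1|exact: Gi.1].
  move=> x /=; rewrite ger0_norm ?le_max ?lexx// ge_max normr_ge0/=.
  exact: ler_norm.
exists w'.
  split => //; exists h; split => // x; apply: (le_trans (hw x)).
  by rewrite lerDl le_max lexx.
apply: le_trans wG; apply: n2_ae_le; [exact: sqintB|exact: sqintB|].
apply: filterS GH => x GHx /=; rewrite /w' max_r ?subr_ge0//.
by rewrite le_eqVlt; apply/orP; left; apply/eqP; congr `|_|; ring.
Qed.

(** The upper bounds [w] in [slope_set] are nonnegative, so the negative part of [G] is at most
    [|w - G|], whose norm is arbitrarily small. *)
Lemma strong_slope_ge0 f G : strong_slope f G ->
  {ae mu, forall x : Xm, 0 <= G x}.
Proof.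
move=> [Gi GC].
pose N x := Num.max 0 (- G x).
have Ni : sqint N.
  apply: (sqint_le _ Gi).
    apply: measurable_maxr; first exact: measurable_cst.
    by apply: measurableT_comp => //; exact: Gi.1.
  move=> x; rewrite ger0_norm ?le_max ?lexx// ge_max normr_ge0/=.
  by rewrite -normrN; exact: ler_norm.
have N0 : n2 N = 0.
  apply/eqP; rewrite eq_le n2_ge0 andbT; apply/ler_addgt0Pl => e e0.
  rewrite addr0; have [_ /(_ _ e0)[w [wi [h [hL hb hi hf hw]]] wG]] := GC 0%N.
  apply: (le_trans _ wG); apply: n2_le => //; first exact: sqintB.
  move=> x /=; rewrite ger0_norm ?le_max ?lexx// ge_max normr_ge0/=.
  apply: le_trans (ler_norm _); have := lip_ge0 x hL; have := hw x; lra.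
apply: filterS (n2_eq0 Ni N0) => x; rewrite /N => h.
have : - G x <= 0 by rewrite -h le_max lexx orbT.
by rewrite oppr_le0.
Qed.

(** Truncating [g] at a large height makes it bounded, does not increase [lip] and changes it little
    in L^2; the strict inequality absorbs the change. *)
Lemma lip_in_slope_set f g n : sqint f -> LIP g -> sqint g -> sqint (lip g) ->
  n2 (g \- f) < n.+1%:R^-1 -> slope_set f n (lip g).
Proof.
move=> fi gL gi lgi gf; split => //.
pose u (k : nat) x := truncate k%:R (g x).
have k0 (k : nat) : 0 <= k%:R :> R by exact: ler0n.
have uC k s t := truncate_contraction (k%:R : R) s t.
have uL k : LIP (u k) by apply: LIP_contraction.
have ui k : sqint (u k).
  by apply: (sqint_le _ gi) => [|x]; [exact: measurable_LIP|exact: truncate_le].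
have ai : sqint (fun x => `|g x| + `|f x|).
  suff : sqint ((fun x : Xm => `|g x|) \+ (fun x : Xm => `|f x|)) by [].
  apply: sqintD.
    apply: (sqint_le _ gi) => [|x]; last by rewrite normr_id.
    by apply: measurableT_comp => //; exact: gi.1.
  apply: (sqint_le _ fi) => [|x]; last by rewrite normr_id.
  by apply: measurableT_comp => //; exact: fi.1.
have lim : n2 (u k \- f) @[k --> \oo] --> n2 (g \- f).
  apply: (n2_dominated_cvg _ _ ai).
  - by move=> k; exact: sqintB.
  - exact: sqintB.
  - move=> x /=; apply: cvgB; last exact: cvg_cst.
    apply: cvg_near_cst; exists (Num.truncn `|g x|).+1 => // k /= gk.
    apply: truncate_id; apply: (le_trans (ltW (truncnS_gt _))).
    by rewrite ler_nat.
  - move=> k x; rewrite [X in _ <= X]ger0_norm ?addr_ge0//.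
    apply: (le_trans (ler_normB _ _)); rewrite lerD2r; exact: truncate_le.
have [k kP] : exists k, n2 (u k \- f) < n.+1%:R^-1.
  have e0 : 0 < n.+1%:R^-1 - n2 (g \- f) by rewrite subr_gt0.
  have /cvgrPdist_lt/(_ _ e0)[k _ /(_ k (leqnn k))] := lim.
  rewrite ltr_norml => /andP[h _]; exists k.
  by move: h; set a := n.+1%:R^-1; lra.
exists (u k); split => //.
- by exists k%:R => x; exact: truncate_bound.
- exact: ltW.
- by move=> x; exact: lip_contraction.
Qed.

End strong_slopes.

(** * Existence of the minimal slope, and localisation by cutoffs *)

Section minimal_slopes.
Context (R : realType) (X : completeMetricType R).
Variable m : {measure set (borel X) -> \bar R}.
Implicit Types (f g h w G H : X -> R).
Local Notation Xm := (completion m).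
Local Notation mu := (completed m).
Local Notation sqint := (@sqint R _ Xm mu).
Local Notation n2 := (@n2 R _ Xm mu).
Local Notation ip := (@ip R _ Xm mu).
Local Notation slope_set := (slope_set m).
Local Notation strong_slope := (strong_slope m).
Local Notation D := (minimal_slope m).

Lemma borel_measurable_completion (A : set (borel X)) :
  measurable A -> measurable (A : set Xm).
Proof.
move=> mA; rewrite measurable_completionE; exists A => //.
by exists set0; [exact: negligible_set0|rewrite setU0].
Qed.

Lemma L2P f : L2 m f <-> sqint f.
Proof. exact: Lfun2P. Qed.

Lemma L2_cvgP (u : nat -> X -> R) f : (forall n, sqint (u n)) -> sqint f ->
  L2_cvg m u f <->
  forall e, 0 < e -> exists N, forall n, (N <= n)%N -> n2 (u n \- f) <= e.
Proof.
move=> ui fi; apply: (@Lnorm_cvg0 _ _ _ mu (fun n => u n \- f)) => n.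
exact: sqintB.
Qed.

Lemma lip_approx_slope_set f (u : nat -> X -> R) n : sqint f ->
  lip_approx m f u -> exists N, forall k, (N <= k)%N -> sqint (lip (u k)) ->
    slope_set f n (lip (u k)).
Proof.
move=> fi [uL uf].
have ui k : sqint (u k) by apply/L2P; exact: (uL k).2.
have n0 : 0 < n.+2%:R^-1 :> R by rewrite invr_gt0.
have [N NP] := (L2_cvgP ui fi).1 uf _ n0.
exists N => k Nk lui; apply: lip_in_slope_set => //; first exact: (uL k).1.
by apply: (le_lt_trans (NP k Nk)); rewrite ltf_pV2 ?posrE ?ltr0n// ltr_nat.
Qed.

(** Mazur's lemma in the convex set [slope_set f n], for every [n], then enlargement from the weak
    limit to [G]. *)
Lemma relaxed_slope_strong f G : sqint f -> relaxed_slope m f G ->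
  strong_slope f G.
Proof.
move=> fi [/L2P Gi [u [G' [uf /= lu /L2P G'i wc G'G]]]].
have lui k : sqint (lip (u k)) by exact/L2P.
apply: (strong_slope_up fi Gi _ G'G); split => // n.
apply: (@weak_limit_in_closure R _ Xm mu (slope_set f n) (fun k => lip (u k)) G') => //.
- exact: slope_set_convex.
- have [N NP] := lip_approx_slope_set n fi uf.
  by exists N => // k /NP; apply.
- by move=> h hi; apply: wc; exact/L2P.
Qed.

(** [P] is the limit of near-minimisers [w n] of the norm over the shrinking slope sets. Since
    [lip (g n)] lies in the same set as [w n] and below it, near-minimality forces the two together
    in L^2; so [P] is a strong limit of genuine slopes, hence also a relaxed slope. *)
Lemma exists_minimal_slope f (M : R) : sqint f ->
  (forall n, exists2 w, slope_set f n w & n2 w <= M) ->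
  exists P (g : nat -> X -> R), [/\ strong_slope f P, relaxed_slope m f P,
    forall M', 0 <= M' -> (forall n, exists2 v, slope_set f n v & n2 v <= M') ->
      n2 P <= M',
    lip_approx m f g &
    forall n, sqint (lip (g n)) /\ n2 (lip (g n)) <= M + 1].
Proof.
move=> fi CM; have z := sqint0 mu.
have sub0 u : u \- (fun=> 0) = u :> (X -> R).
  by apply/funext => x /=; rewrite subr0.
have CM0 n : exists2 w, slope_set f n w & n2 (w \- (fun=> 0)) <= M.
  by have [w] := CM n; exists w; rewrite ?sub0.
have [w [P [Pi wP wlim Pmin]]] := decreasing_convex_min
  (fun n => slope_set_convex n fi) (fun n => @slope_set_decr _ _ m f n n.+1 (leqnSn n))
  z CM0.
have {}wP n : slope_set f n (w n) /\
    forall v, slope_set f n v -> n2 (w n) <= n2 v + n.+1%:R^-1.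
  have [h1 h2] := wP n; split => // v /h2.
  by rewrite !sub0.
have /choice[g gP] : forall n, exists g, [/\ LIP g, bounded_fun g, sqint g,
    n2 (g \- f) <= n.+1%:R^-1 & forall x, lip g x <= w n x].
  by move=> n; have [[_ [g gP]] _] := wP n; exists g.
have wi n : sqint (w n) := (wP n).1.1.
have lgi n : sqint (lip (g n)).
  by have [gL _ _ _ gw] := gP n; exact: (LIP_sqint_lip gL (wi n)).
have lgC n : slope_set f n (lip (g n)).
  by have [gL gb gi gf gw] := gP n; split => //; exists (g n); split.
have lgw n : n2 (lip (g n)) <= n2 (w n).
  have [gL _ _ _ gw] := gP n; apply: n2_le => // x.
  rewrite ger0_norm ?lip_ge0//; exact: le_trans (gw x) (ler_norm _).
(* From [0 <= l <= w] comes [(w - l)^2 <= w^2 - l^2], and near-minimality of [w n] bounds the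
   difference of the squared norms. *)
have lgw2 n : n2 (w n \- lip (g n)) <= n.+1%:R^-1.
  apply: (@le_trans _ _ (n2 (w n) - n2 (lip (g n)))).
    rewrite /n2 -RintegralB//; [|exact: (wi n).2|exact: (lgi n).2].
    apply: le_Rintegral => //; first exact: (sqintB (wi n) (lgi n)).2.
      have h := integrable_fD (wi n).2 (integrable_fZ (-1) (lgi n).2).
      by apply: eq_integrable h => // x _ /=; rewrite mulN1r.
    move=> x _ /=; have [gL _ _ _ /(_ x) gw] := gP n.
    have l0 := lip_ge0 x gL.
    have : 0 <= (w n x - lip (g n) x) * lip (g n) x by rewrite mulr_ge0// subr_ge0.
    lra.
  by have := (wP n).2 _ (lgC n); set a := n.+1%:R^-1; lra.
have gi n : sqint (g n) by have [] := gP n.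
have gapp : lip_approx m f g.
  split; first by move=> n; have [gL _ gi' _ _] := gP n; split => //; exact/L2P.
  apply/L2_cvgP => // e e0; have [N NP] := natSinv_lt e0.
  exists N => n /NP h; have [_ _ _ gf _] := gP n.
  by move: h gf; set a := n.+1%:R^-1; lra.
have lglim e : 0 < e -> exists N, forall n, (N <= n)%N -> n2 (lip (g n) \- P) <= e.
  move=> e0; have e4 : 0 < e / 4 by rewrite divr_gt0.
  have [N1 N1P] := wlim _ e4; have [N2 N2P] := natSinv_lt e4.
  exists (maxn N1 N2) => n; rewrite geq_max => /andP[/N1P h1 /N2P h2].
  have := n2_triangle (lgi n) (wi n) Pi; rewrite [n2 (lip _ \- w n)]n2C.
  by have := lgw2 n; move: h1 h2; set a := n.+1%:R^-1; lra.
exists P, g; split => //.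
- split => // n; split => // e /lglim[N NP].
  exists (lip (g (maxn n N))); last by apply: NP; exact: leq_maxr.
  exact: slope_set_decr (leq_maxl n N) _ (lgC _).
- split; first exact/L2P.
  exists g, P; split => //; [by move=> n; exact/L2P|exact/L2P| |exact: aeW].
  by move=> h /L2P hi; exact: ip_cvg.
- move=> M' M'0 CM'; have := Pmin M' M'0; rewrite sub0; apply => n.
  by have [v] := CM' n; exists v; rewrite ?sub0.
- move=> n; split => //; apply: (le_trans (lgw n)).
  have [v vC vM] := CM n; have := (wP n).2 v vC.
  have : n.+1%:R^-1 <= 1 :> R by rewrite invf_le1 ?ltr0n// ler1n.
  by set a := n.+1%:R^-1; lra.
Qed.

Lemma strong_slope_bound f H (M : R) : sqint f -> strong_slope f H -> n2 H < M ->
  forall n, exists2 w, slope_set f n w & n2 w <= M.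
Proof.
move=> fi [Hi HC] HM n.
have [|del del0 delP] := n2_upper Hi (_ : 0 < M - n2 H); first by rewrite subr_gt0.
have [_ /(_ _ del0)[w wC wH]] := HC n; exists w => //.
have := delP w wC.1 wH; lra.
Qed.

(** The [P] above is minimal among strong slopes and is itself a relaxed slope, so the
    representative chosen by [minimal_slope] has no larger norm and inherits the minimality. *)
Lemma minimal_slope_min f : sqint f -> strong_slope f !=set0 ->
  [/\ strong_slope f (D f), forall H, strong_slope f H -> n2 (D f) <= n2 H &
    forall M, 0 <= M -> (forall n, exists2 v, slope_set f n v & n2 v <= M) ->
      n2 (D f) <= M].
Proof.
move=> fi [H0 H0S].
have lt1 H : n2 H < n2 H + 1 by rewrite ltrDl.
have [P [_ [PS Pr Pmin _ _]]] :=
  exists_minimal_slope fi (strong_slope_bound fi H0S (lt1 H0)).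
have PH H : strong_slope f H -> n2 P <= n2 H.
  move=> HS; apply/ler_addgt0Pl => e e0; apply: Pmin.
    by rewrite addr_ge0 ?n2_ge0// ltW.
  by apply: (strong_slope_bound fi HS); rewrite ltrDr.
have [Dr DP] : relaxed_slope m f (D f) /\
    forall H, relaxed_slope m f H -> (L2_norm m (D f) <= L2_norm m H)%E.
  apply: (@xgetPex _ _ [set G | relaxed_slope m f G /\
    forall H, relaxed_slope m f H -> (L2_norm m G <= L2_norm m H)%E]).
  exists P; split => // H Hr; have HS := relaxed_slope_strong fi Hr.
  by rewrite /L2_norm Lnorm_le; [exact: PH|exact: PS.1|exact: HS.1].
have DS := relaxed_slope_strong fi Dr.
have DPle : n2 (D f) <= n2 P.
  have := DP P Pr; rewrite /L2_norm Lnorm_le//; [exact: DS.1|exact: PS.1].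
split => // [H HS|M M0 CM]; first exact: le_trans DPle (PH H HS).
exact: le_trans DPle (Pmin M M0 CM).
Qed.

Definition dist_set (K : set X) (x : X) : R := inf [set mdist x y | y in K].

Lemma dist_set_le K x y : K y -> dist_set K x <= mdist x y.
Proof.
move=> Ky; apply: ge_inf; last by exists y.
by exists 0 => _ [z _ <-]; exact: mdist_ge0.
Qed.

Lemma dist_set_ge K x c : K !=set0 -> (forall y, K y -> c <= mdist x y) ->
  c <= dist_set K x.
Proof.
move=> [y Ky] h; apply: lb_le_inf; first by exists (mdist x y), y.
by move=> _ [z Kz <-]; exact: h.
Qed.

Lemma dist_set_lip K x y : K !=set0 ->
  `|dist_set K x - dist_set K y| <= mdist x y.
Proof.
move=> K0.
have h u v : dist_set K u - mdist u v <= dist_set K v.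
  apply: dist_set_ge => // z Kz; rewrite lerBlDl.
  apply: (le_trans (dist_set_le u Kz)); exact: metric_triangle.
rewrite ler_norml; have := h x y; have := h y x.
by rewrite [mdist y x]metric_sym => h1 h2; apply/andP; split; lra.
Qed.

(** For a closed nonempty [K], Lipschitz functions tending to its indicator. *)
Definition cutoff K (j : nat) (x : X) : R := Num.max 0 (1 - j%:R * dist_set K x).

Lemma cutoff01 K j x : K !=set0 -> 0 <= cutoff K j x <= 1.
Proof.
move=> K0; rewrite /cutoff le_max lexx/= ge_max ler01/= gerBl mulr_ge0//.
by apply: dist_set_ge => // y _; exact: mdist_ge0.
Qed.

Lemma cutoff_LIP K j : K !=set0 -> LIP (cutoff K j).
Proof.
move=> K0; exists j%:R => x y; have h := dist_set_lip x y K0.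
have mh : `|j%:R * dist_set K x - j%:R * dist_set K y| <= j%:R * mdist x y.
  by rewrite -mulrBr normrM ger0_norm// ler_wpM2l.
move: mh; rewrite /cutoff; set a := j%:R * dist_set K x.
set b := j%:R * dist_set K y; set r := j%:R * mdist x y => mh.
have r0 : 0 <= r by rewrite mulr_ge0// mdist_ge0.
move: mh; rewrite !ler_norml => /andP[h1 h2]; rewrite /Num.max.
by case: (ltP 0 (1 - a)) => ?; case: (ltP 0 (1 - b)) => ?; apply/andP; split; lra.
Qed.

Lemma cutoff_cvg K x : K !=set0 -> closed K ->
  cutoff K j x @[j --> \oo] --> (\1_K x : R).
Proof.
move=> K0 cK; rewrite indicE; have [/set_mem Kx|/negP nKx] := boolP (x \in K).
  have -> : (fun j => cutoff K j x) = fun=> 1.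
    apply/funext => j; have d0 : dist_set K x = 0.
      apply/eqP; rewrite eq_le -{1}(mdistxx x) dist_set_le//=.
      by apply: dist_set_ge => // y _; exact: mdist_ge0.
    by rewrite /cutoff d0 mulr0 subr0 max_r.
  exact: cvg_cst.
have [r r0 rP] : exists2 r, 0 < r & forall y, K y -> r <= mdist x y.
  have : nbhs x (~` K).
    apply: open_nbhs_nbhs; split; first exact: closed_openC.
    by move=> Kx; apply: nKx; exact: mem_set.
  rewrite -metricType_numDomainType.filter_from_mdist_nbhs => -[r /= r0 rP].
  exists r => // y Ky; rewrite leNgt; apply/negP => xy.
  exact: (rP y xy Ky).
have dr : r <= dist_set K x by exact: dist_set_ge.
apply: cvg_near_cst; exists (Num.truncn r^-1).+1 => // j /= jr.
rewrite /cutoff max_l// subr_le0.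
apply: (@le_trans _ _ (j%:R * r)); last by rewrite ler_wpM2l.
rewrite -ler_pdivrMr// mul1r; apply: (le_trans (ltW (truncnS_gt _))).
by rewrite ler_nat.
Qed.

Hypothesis radon_m : radon m.

(* By inner regularity, if [phi] were negative on a set of positive measure, it
   would be so on a compact one, which is a decreasing limit of cutoffs. *)
Lemma ae_ge0_of_cutoff (phi : X -> R) : measurable_fun setT (phi : Xm -> R) ->
  mu.-integrable setT (EFin \o (phi : Xm -> R)) ->
  (forall chi, LIP chi -> (forall x, 0 <= chi x <= 1) ->
     0 <= \int[mu]_x (chi x * phi x)) ->
  {ae mu, forall x : Xm, 0 <= phi x}.
Proof.
move=> mphi iphi pos.
have mA : measurable ([set x | phi x < 0] : set Xm).
  have -> : [set x | phi x < 0] = phi @^-1` `]-oo, 0[%classic.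
    by apply/seteqP; split => x /=; rewrite in_itv.
  by rewrite -[_ @^-1` _]setTI; apply: mphi.
(* Inner regularity concerns Borel sets, so the negligible part is split off. *)
move: (mA); rewrite measurable_completionE => -[A' mA' [N [F [mF F0 NF]]] A'N].
have mN : mu.-negligible (N : set Xm).
  exists F; split => //.
    exact: borel_measurable_completion.
  by rewrite completedE.
suff mA'0 : m A' = 0%E.
  have : mu.-negligible ([set x | phi x < 0] : set Xm).
    rewrite -A'N; apply: negligibleU => //; exists A'; split => //.
      exact: borel_measurable_completion.
    exact: (etrans (completedE m mA') mA'0).
  apply: negligibleS => x /= /negP; rewrite -ltNge; exact.
apply/eqP; rewrite eq_le measure_ge0 andbT leNgt; apply/negP => A'0.
have [_ [K [cK KA'] <-] mK0] : exists2 y : \bar R,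
    [set m K | K in [set K : set X | compact K /\ K `<=` A']] y & (0 < y)%E.
  by apply: ereal_sup_gt; rewrite -(radon_m.2 A' mA').
have clK : closed K.
  by apply: compact_closed => //; exact: metric_hausdorff.
have mKb : measurable (K : set (borel X)).
  rewrite -[K]setCK; apply: measurableC; apply: sub_sigma_algebra.
  exact: closed_openC.
have mK : measurable (K : set Xm) by exact: borel_measurable_completion.
have K0 : K !=set0.
  apply/set0P/eqP => K0; move: mK0; rewrite K0.
  by have /= -> := measure0 m; rewrite ltxx.
have phiK x : K x -> phi x < 0.
  by move=> /KA' A'x; have : [set x | phi x < 0] x by rewrite -A'N; left.
have aphi : mu.-integrable setT (EFin \o (fun x : Xm => `|phi x|)).
  have := integrable_abse iphi.
  by apply: eq_integrable => // x _.
have mcut j : measurable_fun setT (cutoff K j : Xm -> R).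
  by apply: measurable_LIP; exact: cutoff_LIP.
have m1K : measurable_fun setT (\1_K : Xm -> R) by exact: measurable_indic.
have lim : \int[mu]_x (cutoff K j x * phi x) @[j --> \oo] -->
    \int[mu]_x (\1_K x * phi x).
  apply: (@dominated_Rintegral _ _ _ _ _ _ _ (fun x : Xm => `|phi x|)) => //.
  - by move=> j; exact: measurable_funM.
  - exact: measurable_funM.
  - by move=> x _; apply: cvgM; [exact: cutoff_cvg|exact: cvg_cst].
  - move=> j x; have /andP[c0 c1] := cutoff01 j x K0.
    by rewrite normrM (ger0_norm c0) ler_piMl.
have intK : 0 <= \int[mu]_(x in K) phi x.
  have -> : \int[mu]_(x in K) phi x = \int[mu]_x (\1_K x * phi x).
    rewrite Rintegral_mkcond; apply: eq_Rintegral => x _.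
    rewrite /patch indicE; case: ifP => _; by rewrite ?mul1r ?mul0r.
  apply: (ler_cvg_to (cvg_cst 0) lim); apply: nearW => j.
  by apply: pos; [exact: cutoff_LIP|move=> x; exact: cutoff01].
have iK : mu.-integrable K (EFin \o (phi : Xm -> R)) by exact: integrableS iphi.
(* [phi] is negative on [K] while its integral there is nonnegative. *)
have abs0 : (\int[mu]_(x in K) `|(EFin \o phi) x| = 0)%E.
  have aK : mu.-integrable K (EFin \o (fun x : Xm => `|phi x|)).
    exact: integrableS aphi.
  have -> : (\int[mu]_(x in K) `|(EFin \o phi) x|)%E =
      (\int[mu]_(x in K) `|phi x|)%:E.
    by rewrite /Rintegral fineK//; exact: integrable_fin_num.
  congr (_%:E); apply/eqP; rewrite eq_le Rintegral_ge0 ?andbT//.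
  have -> : \int[mu]_(x in K) `|phi x| = \int[mu]_(x in K) (-1 * phi x).
    apply: eq_Rintegral => x /set_mem Kx.
    by rewrite ltr0_norm ?mulN1r//; exact: phiK.
  by rewrite RintegralZl// mulN1r oppr_le0.
have mphiK : measurable_fun (K : set Xm) (EFin \o (phi : Xm -> R)).
  by apply/measurable_EFinP; exact: measurable_funS mphi.
have ae0 := (ae_eq_integral_abs mu mK mphiK).1 abs0.
have negK : mu.-negligible (K : set Xm).
  case: ae0 => N' [mN' N'0 KN']; exists N'; split => // x Kx; apply: KN' => /=.
  by move=> /(_ Kx)[] phi0; have := phiK x Kx; rewrite phi0 ltxx.
have mKz := etrans (esym (completedE m mKb)) ((negligibleP mu mK).1 negK).
by move: mK0; rewrite mKz ltxx.
Qed.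

End minimal_slopes.

(** * Calculus of the minimal relaxed slope *)

Lemma limn_einf_lt (R : realType) (u : nat -> \bar R) (c : \bar R) (N : nat) :
  (limn_einf u < c)%E -> exists2 k, (N <= k)%N & (u k < c)%E.
Proof.
move=> uc; have h : (einfs u N <= limn_einf u)%E.
  rewrite limn_einf_lim; apply: lime_ge; first exact: is_cvg_einfs.
  by exists N => // n /= Nn; exact: nondecreasing_einfs.
have /ereal_inf_lt[_ [k Nk <-] ukc] := le_lt_trans h uc.
by exists k.
Qed.

Section sobolev_functions.
Context (R : realType) (X : completeMetricType R).
Variable m : {measure set (borel X) -> \bar R}.
Implicit Types (f g h w G H : X -> R).
Local Notation Xm := (completion m).
Local Notation mu := (completed m).
Local Notation sqint := (@sqint R _ Xm mu).
Local Notation n2 := (@n2 R _ Xm mu).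
Local Notation ip := (@ip R _ Xm mu).
Local Notation slope_set := (slope_set m).
Local Notation strong_slope := (strong_slope m).
Local Notation D := (minimal_slope m).

Definition sobolev f : Prop := sqint f /\ (Ch m f < +oo)%E.

Lemma Ch_slope_set f (c : R) : sqint f -> (Ch m f < c%:E)%E ->
  forall n, exists2 w, slope_set f n w & n2 w <= c.
Proof.
move=> fi /ereal_inf_lt[_ [u uf <-] uc] n.
have [N NP] := lip_approx_slope_set n fi uf.
have [k Nk ukc] := limn_einf_lt N uc.
have uL := (uf.1 k).1.
(* This is not part of [lip_approx]; it comes from the bound on the integral. *)
have li : sqint (lip (u k)).
  split; first exact: measurable_lip.
  apply/integrableP; split.
    by apply/measurable_EFinP; apply: measurable_funX; exact: measurable_lip.
  under eq_integral do rewrite gee0_abs ?lee_fin ?sqr_ge0//.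
  exact: lt_trans ukc (ltry _).
exists (lip (u k)); first exact: NP.
by rewrite -lee_fin -n2E//; exact: ltW.
Qed.

(** Finite energy is traded for a condition that passes to sums and multiples by the rules for
    strong slopes. In both directions the witnesses come from [exists_minimal_slope]. *)
Lemma sobolevP f : sobolev f <-> sqint f /\ strong_slope f !=set0.
Proof.
split => [[fi fC]|[fi [H HS]]]; split => //.
  have [c fc] : exists c : R, (Ch m f < c%:E)%E.
    case: (Ch m f) fC => [r| |] //; last by exists 0; rewrite ltNyr.
    by exists (r + 1); rewrite lte_fin ltrDl.
  have [P [_ [PS _ _ _ _]]] := exists_minimal_slope fi (Ch_slope_set fi fc).
  by exists P.
have lt1 : n2 H < n2 H + 1 by rewrite ltrDl.
have [P [g [_ _ _ gf gM]]] :=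
  exists_minimal_slope fi (strong_slope_bound fi HS lt1).
apply: (@le_lt_trans _ _ (n2 H + 1 + 1)%:E); last exact: ltry.
apply: (@le_trans _ _ (limn_einf (fun n => \int[mu]_x ((lip (g n) x) ^+ 2)%:E)%E)).
  by apply: ereal_inf_lbound; exists g.
rewrite limn_einf_lim; apply: lime_le; first exact: is_cvg_einfs.
apply: nearW => n; apply: (@le_trans _ _ (\int[mu]_x ((lip (g n) x) ^+ 2)%:E)%E).
  by apply: ereal_inf_lbound; exists n => /=.
by rewrite n2E ?lee_fin; have [] := gM n.
Qed.

Lemma sobolev_minimal_slope f : sobolev f ->
  strong_slope f (D f) /\ forall H, strong_slope f H -> n2 (D f) <= n2 H.
Proof.
by move=> /sobolevP[fi fS]; have [h1 h2 _] := minimal_slope_min fi fS.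
Qed.

Lemma minimal_slope_sqint f : sobolev f -> sqint (D f).
Proof. by move=> /sobolev_minimal_slope[[]]. Qed.

Lemma minimal_slope_ge0 f : sobolev f -> {ae mu, forall x : Xm, 0 <= D f x}.
Proof. by move=> /sobolev_minimal_slope[/strong_slope_ge0]. Qed.

Lemma minimal_slope_le_Ch f (c : R) : sobolev f -> 0 <= c ->
  (Ch m f < c%:E)%E -> n2 (D f) <= c.
Proof.
move=> /sobolevP[fi fS] c0 fc; have [_ _ h] := minimal_slope_min fi fS.
by apply: h => //; exact: Ch_slope_set.
Qed.

(** The two functions have the same relaxed slopes, so [xget] picks the same representative, and the
    equality holds at every point. *)
Lemma minimal_slope_ae f g : sobolev f -> sobolev g ->
  {ae mu, forall x : Xm, f x = g x} -> D f = D g.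
Proof.
move=> [fi _] [gi _] fg; congr xget; apply/funext => G; apply/propext.
suff E : relaxed_slope m f = relaxed_slope m g by rewrite E.
apply/funext => H; apply/propext.
have h f1 f2 : sqint f1 -> sqint f2 -> {ae mu, forall x : Xm, f1 x = f2 x} ->
    relaxed_slope m f1 H -> relaxed_slope m f2 H.
  move=> f1i f2i f12 [HL [u [G' [[uL uf] h1 h2 h3 h4]]]].
  have ui k : sqint (u k) by apply/L2P; exact: (uL k).2.
  split => //; exists u, G'; split => //; split => //.
  apply/(L2_cvgP ui f2i) => e e0; have [N NP] := (L2_cvgP ui f1i).1 uf e e0.
  exists N => n Nn; apply: le_trans (NP n Nn).
  apply: n2_ae_le; [exact: sqintB|exact: sqintB|].
  by apply: filterS f12 => x /= ->.
split; apply: h => //.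
by apply: filterS fg => x ->.
Qed.

Lemma sobolev_lin (a : R) f g : sobolev f -> sobolev g ->
  sobolev (fun x => a * f x + g x).
Proof.
move=> /sobolevP[fi [F FS]] /sobolevP[gi [G GS]]; apply/sobolevP.
have afi := sqintZ a fi.
split; first exact: (sqintD afi gi).
exists ((fun x => `|a| * F x) \+ G).
exact: (strong_slopeD afi gi (strong_slopeZ a fi FS) GS).
Qed.

Lemma sobolev0 : sobolev (fun=> 0).
Proof.
apply/sobolevP; split; first exact: sqint0.
exists (fun=> 0); split; first exact: sqint0.
have z : n2 ((fun=> 0) \- (fun=> 0)) = 0.
  rewrite /n2; under eq_Rintegral do rewrite /= subrr expr0n/=.
  by rewrite Rintegral_cst// mul0r.
move=> n; split; first exact: sqint0.
move=> e e0; exists (fun=> 0); last by rewrite z ltW.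
split; first exact: sqint0.
exists (fun=> 0); split => //.
- exact: LIP_cst.
- by exists 0 => x; rewrite normr0.
- exact: sqint0.
- by rewrite z invr_ge0.
- by move=> x; rewrite lip_cst.
Qed.

Lemma sobolevZ a f : sobolev f -> sobolev (fun x => a * f x).
Proof.
move=> fS; have := sobolev_lin a fS sobolev0; congr sobolev.
by apply/funext => x; rewrite addr0.
Qed.

Lemma sobolevB f g : sobolev f -> sobolev g -> sobolev (f \- g).
Proof.
move=> fS gS; have := sobolev_lin (-1) gS fS; congr sobolev.
by apply/funext => x; rewrite mulN1r addrC.
Qed.

Hypothesis radon_m : radon m.

(* Strong slopes are stable under mixing with a Lipschitz function [chi] with
   values in [0, 1]; the first variation of the norm at [D f] in the direction
   [chi * (H - D f)] gives [0 <= \int chi * D f * (H - D f)] for all [chi]. *)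
Lemma minimal_slope_le f H : sobolev f -> strong_slope f H ->
  {ae mu, forall x : Xm, D f x <= H x}.
Proof.
move=> fS HS; have [DS Dmin] := sobolev_minimal_slope fS.
have fi := fS.1; have Di := DS.1; have Hi := HS.1.
pose phi x := D f x * (H x - D f x).
have HDi := sqintB Hi Di.
have := @ae_ge0_of_cutoff R X m radon_m phi.
have mphi : measurable_fun setT (phi : Xm -> R).
  by apply: measurable_funM; [exact: Di.1|exact: HDi.1].
move=> /(_ mphi (sqint_mul Di HDi)) key.
have ae_phi : {ae mu, forall x : Xm, 0 <= phi x}.
  apply: key => chi cL c01.
  have QS := strong_slope_mix fi cL c01 DS HS.
  have sub0 (u : X -> R) : u \- (fun=> 0) = u :> (X -> R).
    by apply/funext => x /=; rewrite subr0.
  have := variational_inequality (strong_slope_convex fi) DS (sqint0 mu).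
  rewrite sub0 => /(_ _ _ QS) h; apply: le_trans (h _) _.
    by move=> Q QQ; rewrite sub0; exact: Dmin.
  rewrite le_eqVlt; apply/orP; left; apply/eqP.
  by apply: eq_Rintegral => x _; rewrite /phi /fmix /=; ring.
(* Where [H < D f], the sign of [H] would make [D f] positive and the product [phi] negative. *)
apply: filterS2 (strong_slope_ge0 HS) ae_phi => x H0 p0.
rewrite leNgt; apply/negP => HD; move: p0; rewrite /phi leNgt => /negP; apply.
have D0 : 0 < D f x by exact: le_lt_trans H0 HD.
by rewrite pmulr_rlt0// subr_lt0.
Qed.

Lemma minimal_slope_lin (a : R) f g : sobolev f -> sobolev g ->
  {ae mu, forall x : Xm, D (fun x => a * f x + g x) x <= `|a| * D f x + D g x}.
Proof.
move=> fS gS; apply: minimal_slope_le; first exact: sobolev_lin.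
have fi := fS.1; have gi := gS.1; have afi := sqintZ a fi.
exact: (strong_slopeD afi gi (strong_slopeZ a fi (sobolev_minimal_slope fS).1)
  (sobolev_minimal_slope gS).1).
Qed.

Lemma minimal_slope0 : {ae mu, forall x : Xm, D (fun=> 0) x = 0}.
Proof.
have h : {ae mu, forall x : Xm, D (fun=> 0) x <= 0}.
  apply: (@minimal_slope_le (fun=> 0) (fun=> 0)); first exact: sobolev0.
  have /sobolev_minimal_slope[DS _] := sobolev0.
  have := strong_slopeZ 0 (sqint0 mu) DS.
  congr (strong_slope _ _); apply/funext => x; first by rewrite mul0r.
  by rewrite normr0 mul0r.
apply: filterS2 h (minimal_slope_ge0 sobolev0) => x h1 h2.
by apply/eqP; rewrite eq_le h1.
Qed.

Lemma minimal_slopeD f g : sobolev f -> sobolev g ->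
  {ae mu, forall x : Xm, D (f \+ g) x <= D f x + D g x}.
Proof.
move=> fS gS; have -> : f \+ g = (fun x => 1 * f x + g x).
  by apply/funext => x; rewrite mul1r.
by apply: filterS (minimal_slope_lin 1 fS gS) => x; rewrite normr1 mul1r.
Qed.

(** The upper bound, used for [a] and for [a^-1], gives equality; [a = 0] is apart. *)
Lemma minimal_slopeZ (a : R) f : sobolev f ->
  {ae mu, forall x : Xm, D (fun x => a * f x) x = `|a| * D f x}.
Proof.
move=> fS.
have le b g : sobolev g ->
    {ae mu, forall x : Xm, D (fun x => b * g x) x <= `|b| * D g x}.
  move=> gS; have -> : (fun x => b * g x) = (fun x => b * g x + 0).
    by apply/funext => x; rewrite addr0.
  apply: filterS2 (minimal_slope_lin b gS sobolev0) minimal_slope0 => x h1 h2.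
  by rewrite h2 addr0 in h1.
have [->|a0] := eqVneq a 0.
  have -> : (fun x => 0 * f x) = fun=> 0 by apply/funext => x; rewrite mul0r.
  by apply: filterS minimal_slope0 => x ->; rewrite normr0 mul0r.
have := le a^-1 _ (sobolevZ a fS).
have -> : (fun x => a^-1 * (a * f x)) = f.
  by apply/funext => x; rewrite mulrA mulVf// mul1r.
apply: filterS2 (le a f fS) => x h1 h2; apply/eqP; rewrite eq_le h1/=.
by move: h2; rewrite normfV mulrC ler_pdivlMr ?normr_gt0// mulrC.
Qed.

End sobolev_functions.

Lemma countable_range (T : Type) (t0 : T) (A : set T) : countable A ->
  exists u : nat -> T, A `<=` range u.
Proof.
move=> /countable_injP[code inj].
have /choice[u uP] n : exists y : T, forall x, A x -> code x = n -> x = y.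
  have [[y [Ay yn]]|no] := pselect (exists y, A y /\ code y = n).
    by exists y => x Ax xn; apply: inj; rewrite ?inE// yn.
  by exists t0 => x Ax xn; case: no; exists x.
by exists u => x Ax; exists (code x) => //; rewrite -(uP _ x).
Qed.

Lemma ae_forall_countable d (T : measurableType d) (R : realType)
    (mu : {measure set T -> \bar R}) (I : countType) (P : I -> T -> Prop) :
  (forall i, {ae mu, forall x, P i x}) -> {ae mu, forall x, forall i, P i x}.
Proof.
move=> h.
have : {ae mu, forall x, forall n, forall i, unpickle n = Some i -> P i x}.
  apply: ae_foralln => n; case E : (unpickle n) => [i|]; last exact: aeW.
  by apply: filterS (h i) => x Pi j [<-].
by apply: filterS => x Px i; apply: (Px (pickle i)); rewrite pickleK.
Qed.

Section Lspace_elements.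
Context (R : realType) d (T : measurableType d).
Variable mu : {measure set T -> \bar R}.
Local Open Scope quotient_scope.

Lemma Lspace_sqint (f : LspaceType mu (lee1n 2)) : sqint mu (f : T -> R).
Proof.
apply/Lfun2P; rewrite inE; apply/andP; split; rewrite inE/=.
  have h := @measurable_funPT _ _ _ _ (repr (LebesgueSpace.sort f)).
  exact: h.
exact: Lebesgue_finite.
Qed.

Lemma sqint_Lspace (f : T -> R) : sqint mu f ->
  exists g : LspaceType mu (lee1n 2), {ae mu, forall x, (g : T -> R) x = f x}.
Proof.
move=> fi.
pose f' : {mfun T >-> measurableTypeR R} :=
  HB.pack_for {mfun T >-> measurableTypeR R} f
    (@isMeasurableFun.Build _ _ T (measurableTypeR R) f fi.1).
pose g : {mfun_ mu, T >-> measurableTypeR R} := \pi f'.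
have gf : {ae mu, forall x, (g : T -> R) x = f x}.
  have : ae_eq_op mu (repr g) f' by rewrite -[ae_eq_op _ _ _]eqmodE reprK.
  by move=> /asboolP; apply: filterS => x; exact.
have mg : measurable_fun setT (g : T -> R).
  by have h := @measurable_funPT _ _ _ _ (repr g); exact: h.
have gi : sqint mu (g : T -> R).
  split => //; apply/integrableP; split.
    by apply/measurable_EFinP; exact: measurable_funX.
  have [_ /integrableP[_ ]] := fi; congr (_ < _)%E.
  apply: ae_eq_integral => //.
  - apply/measurableT_comp => //.
    by apply/measurable_EFinP; apply: measurable_funX; exact: fi.1.
  - apply/measurableT_comp => //.
    by apply/measurable_EFinP; exact: measurable_funX.
  - by apply: filterS gf => x /= ->.
have gfin : finite_norm mu 2%:E (g : T -> R).
  by have /Lfun2P := gi; rewrite inE => /andP[_]; rewrite inE.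
pose G : LspaceType mu (lee1n 2) := HB.pack_for (LspaceType mu (lee1n 2)) g
    (@isFinLebesgue.Build _ T R mu 2%:E (lee1n 2) g gfin).
by exists G.
Qed.

End Lspace_elements.

Section W12_elements.
Context (R : realType) (X : completeMetricType R).
Variable m : {measure set (borel X) -> \bar R}.
Implicit Types (f g h : X -> R).
Local Notation Xm := (completion m).
Local Notation mu := (completed m).
Local Notation sqint := (@sqint R _ Xm mu).
Local Notation n2 := (@n2 R _ Xm mu).
Local Notation D := (minimal_slope m).
Local Notation sobolev := (sobolev m).

Lemma sobolev_W12 (f : W12 m) : sobolev f.
Proof. by split; [exact: Lspace_sqint|exact: (svalP f)]. Qed.

Lemma W12_of_sobolev f : sobolev f ->
  exists F : W12 m, {ae mu, forall x : Xm, F x = f x}.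
Proof.
move=> fS; have [g gf] := sqint_Lspace fS.1.
have gi := Lspace_sqint g.
have [_ gC] : sobolev (g : X -> R).
  have [fi [G fG]] := (sobolevP m f).1 fS.
  apply/sobolevP; split => //; exists G; apply: strong_slope_ae fG => //.
  by apply: filterS gf => x ->.
by exists (exist _ g gC).
Qed.

(** Only the energy part of the Sobolev norm is retained: the fibers see a function through [D]
    alone. *)
Lemma W12_dense_approx (Ds : set (W12 m)) (f : W12 m) (e : R) :
  W12_dense Ds -> 0 < e -> exists2 g, Ds g & n2 (D (f \- g)) <= e.
Proof.
move=> dD e0; pose r := Num.sqrt e.
have r0 : 0 < r by rewrite sqrtr_gt0.
have [g Dg fg] := dD f r r0; exists g => //.
have BS := sobolevB (sobolev_W12 f) (sobolev_W12 g).
apply: minimal_slope_le_Ch => //; first exact: ltW.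
move: fg; rewrite /W12_norm.
have -> : (f \- g)%R = (fun x => f x - g x) by [].
rewrite n2E; last exact: BS.1.
set a := n2 _; set b := Ch m _ => h.
have a0 : 0 <= a by exact: n2_ge0.
have ab : (0 <= a%:E + b)%E.
  apply: adde_ge0; first by rewrite lee_fin.
  apply: le_ereal_inf_tmp => _ [u _ <-].
  rewrite limn_einf_lim; apply: lime_ge; first exact: is_cvg_einfs.
  apply: nearW => n; apply: le_ereal_inf_tmp => _ [k _ <-].
  by apply: integral_ge0 => x _; rewrite lee_fin sqr_ge0.
have : (a%:E + b < (r ^+ 2)%:E)%E.
  rewrite ltNge; apply/negP => h2; move: h; rewrite ltNge => /negP; apply.
  have -> : r%:E = ((r ^+ 2)%:E `^ 2^-1)%E.
    by rewrite poweR_EFin -powR_mulrn ?ltW// -powRrM divff// powRr1// ltW.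
  by rewrite gt0_ler_poweR// ?in_itv/= ?leey ?lee_fin ?sqr_ge0 ?ab.
rewrite sqr_sqrtr; last exact: ltW.
apply: le_lt_trans; rewrite leeDr// lee_fin; exact: a0.
Qed.

Lemma W12_dense_seq : W12_separable m ->
  exists f_ : nat -> W12 m, W12_dense (range f_).
Proof.
move=> [Ds cD dD].
have [F0 _] := W12_of_sobolev (sobolev0 m).
have [f_ Df] := countable_range F0 cD.
exists f_ => f e e0; have [g Dg fg] := dD f e e0.
by exists g => //; exact: Df.
Qed.

End W12_elements.

(** * Maps of Banach bundles *)

Lemma separable_dense_seq (R : realType) (B : completeNormedModType R) :
  separable B ->
  exists b : nat -> B, forall (v : B) (e : R), 0 < e -> exists n, `|v - b n| < e.
Proof.
move=> [D cD dD]; have [b Db] := countable_range (0 : B) cD.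
exists b => v e e0.
have [y [ve /Db[n _ ny]]] := dD (ball v e)
  (ex_intro _ v (ballxx v e0)) (ball_open v e).
by exists n; move: ve; rewrite ny -ball_normE.
Qed.

(** The norm identities between two couples hold almost everywhere for countably many coefficients
    at once; continuity in [a] gives the real ones at the same points. *)
Lemma norm_line_rat (R : realType) (B : completeNormedModType R) (u v u' v' : B) :
  (forall q : rat, `|ratr q *: u + v| = `|ratr q *: u' + v'|) ->
  forall a : R, `|a *: u + v| = `|a *: u' + v'|.
Proof.
move=> h a; apply/eqP; rewrite -subr_eq0 -normr_le0.
apply/ler_addgt0Pr => e e0; rewrite add0r.
pose M := `|u| + `|u'| + 1.
have M0 : 0 < M by rewrite /M; have := normr_ge0 u; have := normr_ge0 u'; lra.
have d0 : a - e / M < a by rewrite ltrBlDr ltrDl divr_gt0.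
have [q] := rat_in_itvoo d0; rewrite in_itv/= => /andP[q1 q2].
have lip (w z : B) : `| `|a *: w + z| - `|ratr q *: w + z| | <= (a - ratr q) * `|w|.
  apply: le_trans (ler_dist_dist _ _) _.
  by rewrite opprD addrACA subrr addr0 -scalerBl normrZ gtr0_norm ?subr_gt0.
have -> : `|a *: u + v| - `|a *: u' + v'| =
    (`|a *: u + v| - `|ratr q *: u + v|) - (`|a *: u' + v'| - `|ratr q *: u' + v'|).
  by rewrite h; ring.
apply: le_trans (ler_normB _ _) _.
apply: le_trans (lerD (lip u v) (lip u' v')) _.
rewrite -mulrDr; apply: (@le_trans _ _ ((a - ratr q) * M)).
  by rewrite ler_wpM2l ?subr_ge0 ?ltW// /M; lra.
by rewrite -ler_pdivlMr// ltW//; lra.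
Qed.

Section isometric_sequences.
Context (R : realType) (B : completeNormedModType R).
Implicit Types (s t : nat -> B) (v w : B).

Lemma closure_range_approx (T : Type) (s : T -> B) v (e : R) :
  closure (range s) v -> 0 < e -> exists n, `|s n - v| < e.
Proof.
move=> sv e0; have [_ [[n _ <-]]] := sv _ (nbhsx_ballx v _ e0).
by rewrite -ball_normE/= distrC => h; exists n.
Qed.

Lemma approx_closure_range (T : Type) (s : T -> B) v :
  (forall e : R, 0 < e -> exists n, `|s n - v| < e) -> closure (range s) v.
Proof.
move=> sv U /= /nbhs_ballP[e e0 eU]; have [n sn] := sv e e0.
by exists (s n); split; [exists n|apply: eU; rewrite -ball_normE/= distrC].
Qed.

(** Along indices with [s (nk k)] tending to [v] the [t (nk k)] are Cauchy, and [w] is their limit.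
    Its distances to all [t n] characterise it without reference to these indices, which is the form
    used afterwards. *)
Lemma isometric_limit s t v : (forall i j, `|s i - s j| = `|t i - t j|) ->
  closure (range s) v ->
  exists2 w, closure (range t) w & forall n, `|t n - w| = `|s n - v|.
Proof.
move=> st sv; pose e k : R := k.+1%:R^-1.
have ecv : e k @[k --> \oo] --> 0 by exact: cvg_harmonic.
have /choice[nk nkP] k : exists n, `|s n - v| < e k.
  by apply: closure_range_approx sv _; rewrite /e invr_gt0.
have [w wP] : exists w : B, forall k, `|t (nk k) - w| <= e k.
  have [i j|w [_ wP]] := @cauchy_rate R B (fun k => t (nk k)) e ecv _.
    rewrite -st; apply: le_trans (ler_distD v _ _) _.
    by rewrite (distrC v); apply: lerD; exact: ltW.
  by exists w.
have small (d : R) : 0 < d -> exists k, e k < d.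
  move=> d0; exists (Num.truncn d^-1); rewrite /e.
  by rewrite -[ltRHS]invrK ltf_pV2 ?posrE ?invr_gt0// truncnS_gt.
exists w => [|n].
  apply: approx_closure_range => d d0; have [k kd] := small _ d0.
  by exists (nk k); exact: le_lt_trans (wP k) kd.
apply/eqP; rewrite -subr_eq0 -normr_le0; apply/ler_addgt0Pr => d d0.
have d20 : 0 < d / 2 by rewrite divr_gt0.
have [k kd] := small _ d20; rewrite add0r.
have h1 := ler_dist_dist (t n - w) (t n - t (nk k)).
have h2 := ler_dist_dist (s n - s (nk k)) (s n - v).
have e1 (a b c : B) : (a - b) - (a - c) = c - b.
  by rewrite opprB addrC addrA subrK.
rewrite e1 in h1; rewrite e1 (distrC v) in h2; rewrite st in h2.
have -> : `|t n - w| - `|s n - v| = (`|t n - w| - `|t n - t (nk k)|) +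
  (`|t n - t (nk k)| - `|s n - v|) by ring.
apply: le_trans (ler_normD _ _) _; have := wP k; have := nkP k.
move: h1 h2 kd.
set x1 := `|_ - `|t n - t _| |; set x2 := `| _ - `|s n - v| |.
by move=> h1 h2 h3 h4 h5; lra.
Qed.

Lemma isometric_limit_norm s t v w : (forall i, `|s i| = `|t i|) ->
  closure (range s) v -> (forall n, `|t n - w| = `|s n - v|) -> `|w| <= `|v|.
Proof.
move=> st sv tw; apply/ler_addgt0Pr => d d0.
have d20 : 0 < d / 2 by rewrite divr_gt0.
have [n nd] := closure_range_approx sv d20.
have h1 := ler_distD (t n) w 0; have h2 := ler_distD v (s n) 0.
by rewrite !subr0 distrC tw -st in h1; rewrite !subr0 in h2; lra.
Qed.

Lemma isometric_limit_linear s t (a : R) v1 v2 v3 w1 w2 w3 :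
  (forall i j k, `|a *: s i + s j - s k| = `|a *: t i + t j - t k|) ->
  closure (range s) v1 -> closure (range s) v2 -> closure (range s) v3 ->
  (forall n, `|t n - w1| = `|s n - v1|) ->
  (forall n, `|t n - w2| = `|s n - v2|) ->
  (forall n, `|t n - w3| = `|s n - v3|) ->
  v3 = a *: v1 + v2 -> w3 = a *: w1 + w2.
Proof.
move=> st c1 c2 c3 t1 t2 t3 vE; symmetry.
apply/eqP; rewrite -subr_eq0 -normr_le0; apply/ler_addgt0Pr => e e0.
rewrite add0r.
(* Three approximations within [d], used once for [s] and once for [t], cost [2 (|a| + 2) d = e]. *)
pose d := e / (2 * `|a| + 4).
have a0 := normr_ge0 a.
have d0 : 0 < d by rewrite divr_gt0//; lra.
have dE : d * (2 * `|a| + 4) = e by rewrite divfK// gt_eqF//; lra.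
have [i si] := closure_range_approx c1 d0.
have [j sj] := closure_range_approx c2 d0.
have [k sk] := closure_range_approx c3 d0.
have tri (x1 x2 x3 y1 y2 y3 : B) : `|a *: x1 + x2 - x3| <=
    `|a *: y1 + y2 - y3| + (`|a| * `|y1 - x1| + `|y2 - x2| + `|y3 - x3|).
  have -> : a *: x1 + x2 - x3 = (a *: y1 + y2 - y3) -
      (a *: (y1 - x1) + (y2 - x2) - (y3 - x3)).
    rewrite scalerBr opprB addrA subrKA [RHS]addrAC; congr (_ - _).
    by rewrite opprD addrACA !subKr.
  apply: le_trans (ler_normB _ _) _; rewrite lerD2l.
  apply: le_trans (ler_normB _ _) _; rewrite lerD2r.
  by apply: le_trans (ler_normD _ _) _; rewrite normrZ.
have h1 := tri w1 w2 w3 (t i) (t j) (t k).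
have h2 := tri (s i) (s j) (s k) v1 v2 v3.
rewrite t1 t2 t3 -st in h1.
rewrite -vE subrr normr0 add0r (distrC v1) (distrC v2) (distrC v3) in h2.
have h3 : `|a| * `|s i - v1| <= `|a| * d by rewrite ler_wpM2l// ltW.
move: dE; rewrite mulrDr mulrCA => dE.
by lra.
Qed.

End isometric_sequences.

(* MathComp-Analysis has another [proj], on product topologies. *)
Local Notation proj := Defs.proj.

Section bundle_maps.
Context (R : realType) (X : completeMetricType R).
Variable m : {measure set (borel X) -> \bar R}.
Variable B : completeNormedModType R.
Implicit Types E F : bundle m B.
Local Notation Xm := (completion m).
Local Notation mu := (completed m).

Definition total_point E x v (Exv : E x v) : total_space E :=
  exist _ (x : Xm, v : borel B) Exv.

Lemma total_ext E (p q : total_space E) :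
  proj p = proj q -> vect p = vect q -> p = q.
Proof.
case: p q => [[x v] p] [[y w] q]; rewrite /proj /vect/= => xy vw.
by move: p q; rewrite /= xy vw => p q; congr exist; exact: Prop_irrelevance.
Qed.

Lemma vect_proj_in E (p : total_space E) : E (proj p) (vect p).
Proof. exact: vect_in. Qed.

Lemma fiber_lin E x (a : R) (u v : B) : E x u -> E x v -> E x (a *: u + v).
Proof. exact: gr_linear. Qed.

Lemma bmap_dist E F (phi : bundle_map E F) (p q : total_space E) :
  proj p = proj q -> `|vect (phi p) - vect (phi q)| <= `|vect p - vect q|.
Proof.
move=> pq.
have h : E (proj q) ((-1) *: vect q + vect p).
  by apply: fiber_lin; [exact: vect_proj_in|rewrite -pq; exact: vect_proj_in].
pose r := total_point h.
have := @bmap_linear _ _ _ _ _ _ phi 1 r q p _ _ _.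
rewrite pq scale1r => /(_ erefl erefl) ->; last first.
  by rewrite [vect r]/(_ *: _ + _) scaleN1r addrAC addNr add0r.
rewrite scale1r addrK; apply: le_trans (bmap_contraction _ _) _.
by rewrite /= /vect/= scaleN1r addrC.
Qed.

Lemma bmap_unique E F (phi psi : bundle_map E F) (s : nat -> bsection E) :
  {ae mu, forall x : Xm, gr_set (E x) `<=` closure (range (fun n => s n x))} ->
  (forall n, {ae mu, forall x : Xm,
    vect (phi (graph (s n) x)) = vect (psi (graph (s n) x))}) ->
  {ae mu, forall x : Xm, forall p, proj p = x -> phi p = psi p}.
Proof.
move=> dE /ae_foralln agree; apply: filterS2 dE agree => x dx ax p px.
apply: total_ext; first by rewrite !bmap_proj.
apply/eqP; rewrite -subr_eq0 -normr_le0; apply/ler_addgt0Pr => e e0.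
have e20 : 0 < e / 2 by rewrite divr_gt0.
have [_ [[n _ <-]]] := dx _ (vect_in px) _ (nbhsx_ballx (vect p) _ e20).
rewrite -ball_normE/= add0r => pn.
have h (chi : bundle_map E F) :
    `|vect (chi p) - vect (chi (graph (s n) x))| < e / 2.
  exact: le_lt_trans (@bmap_dist _ _ chi p (graph (s n) x) px) pn.
have -> : vect (phi p) - vect (psi p) =
    (vect (phi p) - vect (phi (graph (s n) x))) -
    (vect (psi p) - vect (psi (graph (s n) x))).
  by rewrite ax opprB addrA subrK.
apply: le_trans (ler_normB _ _) _; rewrite [leRHS]splitr.
by apply: lerD; exact: ltW.
Qed.

Lemma measurable_proj E :
  measurable_fun setT (@proj _ _ _ _ E : total_measurable E -> Xm).
Proof.
move=> _ Y mY; rewrite setTI; exists (Y `*` setT); first exact: measurableX.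
by rewrite setTI; apply/seteqP; split => [p []|p].
Qed.

Hypothesis sepB : separable B.

(** With a dense sequence [b] the condition becomes a countable union: some [b n] is within
    [1 / (k + 1)] of the section and within [r - 1 / (k + 1)] of the vector. *)
Lemma measurable_section_dist E (s : bsection E) (r : R) :
  measurable ([set p | `|s (proj p) - vect p| < r] : set (total_measurable E)).
Proof.
have [b bP] := separable_dense_seq sepB.
pose k_ k : R := k.+1%:R^-1.
have mball n c : measurable ([set v : B | `|v - b n| < c] : set (borel B)).
  have -> : [set v : B | `|v - b n| < c] = ball (b n) c.
    by apply/seteqP; split => v; rewrite -ball_normE/= distrC.
  apply: sub_sigma_algebra; have [c0|c0] := ltP 0 c; first exact: ball_open.
  have -> : ball (b n) c = set0; last exact: open0.
  apply/seteqP; split => // v; rewrite -ball_normE/= => h.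
  by have := normr_ge0 (b n - v); lra.
have -> : [set p | `|s (proj p) - vect p| < r] =
    \bigcup_n \bigcup_k (([set x | `|s x - b n| < k_ k] \o @proj _ _ _ _ E) `&`
      [set p | `|vect p - b n| < r - k_ k]).
  apply/seteqP; split => p /=.
    set x := proj p; set v := vect p => sv.
    pose e := (r - `|s x - v|) / 2.
    have e0 : 0 < e by rewrite divr_gt0// subr_gt0.
    have [k kP] : exists k, k_ k < e.
      exists (Num.truncn e^-1); rewrite /k_.
      by rewrite -[ltRHS]invrK ltf_pV2 ?posrE ?invr_gt0// truncnS_gt.
    have k0 : 0 < k_ k by rewrite /k_.
    have [n nP] := bP (s x) (k_ k) k0.
    exists n => //; exists k => //; split => //=.
    have := ler_distD (s x) v (b n); rewrite (distrC v (s x)) (distrC v (b n)) => h.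
    by move: kP; rewrite /e; lra.
  move=> [n _ [k _ [/= h1 h2]]].
  have := ler_distD (b n) (s (proj p)) (vect p).
  by rewrite (distrC (b n)); lra.
apply: bigcup_measurable => n _; apply: bigcup_measurable => k _.
apply: measurableI.
  rewrite -[_ \o _]/(@proj _ _ _ _ E @^-1` _) -[X in measurable X]setTI.
  apply: (@measurable_proj E) => //.
  have := @bsection_measurable _ _ _ _ _ s measurableT _ (mball n (k_ k)).
  by rewrite setTI.
have := @measurable_vect _ _ m _ E measurableT _ (mball n (r - k_ k)).
by rewrite setTI.
Qed.

(** Over [A] the map sends a limit of terms of [s] to the limit of the corresponding terms of [t];
    elsewhere it is [0], so that it is defined and linear on every fiber. *)
Lemma bmap_of_sections E F (s : nat -> bsection E) (t : nat -> bsection F)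
    (A : set X) : measurable (A : set Xm) ->
  (forall x, A x -> gr_set (E x) `<=` closure (range (fun n => s n x))) ->
  (forall x, A x -> forall (a : R) i j k,
    `|a *: s i x + s j x - s k x| = `|a *: t i x + t j x - t k x|) ->
  exists phi : bundle_map E F, forall p, A (proj p) ->
    forall n, `|t n (proj p) - vect (phi p)| = `|s n (proj p) - vect p|.
Proof.
move=> mA dA stA.
(* Equality of norms is the case [a = 1], [i = j = k]; equality of distances is the case [a = 0]. *)
have st1 x : A x -> forall i, `|s i x| = `|t i x|.
  by move=> Ax i; have := stA x Ax 1 i i i; rewrite !scale1r !addrK.
have st0 x : A x -> forall i j, `|s i x - s j x| = `|t i x - t j x|.
  by move=> Ax i j; have := stA x Ax 0 i i j; rewrite !scale0r !add0r.
have /choice[phi phiP] (p : total_space E) : exists q : total_space F,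
    [/\ proj q = proj p, ~ A (proj p) -> vect q = 0 & A (proj p) ->
    forall n, `|t n (proj p) - vect q| = `|s n (proj p) - vect p|].
  have [Ax|nAx] := pselect (A (proj p)); last first.
    by exists (total_point (gr_0 (F (proj p)))).
  have [w tw wP] := isometric_limit (st0 _ Ax) (dA _ Ax _ (vect_proj_in p)).
  have Fw : F (proj p) w.
    apply: gr_closed; apply: closureS tw => _ [n _ <-].
    exact: bsection_in.
  by exists (total_point Fw).
have dP x (Ax : A x) (p : total_space E) : proj p = x ->
    closure (range (fun n => s n x)) (vect p).
  by move=> px; apply: dA => //; exact: vect_in.
have phi_proj p : proj (phi p) = proj p by have [] := phiP p.
have phi_cont p : `|vect (phi p)| <= `|vect p|.
  have [_ p0 pA] := phiP p.
  have [Ax|/p0 ->] := pselect (A (proj p)); last by rewrite normr0.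
  exact: isometric_limit_norm (st1 _ Ax) (dP _ Ax _ erefl) (pA Ax).
have phi_lin (a : R) p q r : proj p = proj r -> proj q = proj r ->
    vect r = a *: vect p + vect q ->
    vect (phi r) = a *: vect (phi p) + vect (phi q).
  have [_ p0 pA] := phiP p; have [_ q0 qA] := phiP q.
  have [_ r0 rA] := phiP r.
  move=> pr qr; rewrite pr in p0 pA; rewrite qr in q0 qA.
  have [Ax|nAx] := pselect (A (proj r)).
    by move=> vE; apply: (@isometric_limit_linear _ _ (fun n => s n (proj r))
      (fun n => t n (proj r)) _ _ _ _ _ _ _ (stA _ Ax a) _ _ _ (pA Ax) (qA Ax)
      (rA Ax) vE); apply: dP.
  by rewrite p0// q0// r0// scaler0 addr0.
have mphi_vect : measurable_fun setT
    ((fun p => vect (phi p)) : total_measurable E -> borel B).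
  apply: measurable_fun_borel => U oU.
  pose e k : R := k.+1%:R^-1.
  pose V k : set B := \bigcup_(z in ~` U) ball z (e k).
  have oV k : open (V k) by apply: bigcup_open => z _; exact: ball_open.
  have mAE : measurable (@proj _ _ _ _ E @^-1` A : set (total_measurable E)).
    by rewrite -[X in measurable X]setTI; exact: (@measurable_proj E).
  (* Over the complement of [A] the map is [0], so there the preimage of [U] is everything or
     nothing. *)
  pose Z := ((@proj _ _ _ _ E @^-1` (~` A)) `&` [set _ | U 0]) : set (total_measurable E).
  have mZ : measurable Z.
    apply: measurableI; first by rewrite preimage_setC; exact: measurableC.
    have [U0|U0] := pselect (U 0).
      by rewrite [X in measurable X](_ : _ = setT)//; apply/seteqP; split.
    by rewrite [X in measurable X](_ : _ = set0)//; apply/seteqP; split.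
  (* [t n] is as close to [phi p] as [s n] is to [p], so [phi p] lies in [U] when
     some such [t n] is deep enough inside [U]. *)
  have -> : (fun p => vect (phi p)) @^-1` U =
      Z `|` ((@proj _ _ _ _ E @^-1` A) `&` \bigcup_n \bigcup_k
        ([set p | `|s n (proj p) - vect p| < e k] `&`
         (@proj _ _ _ _ E @^-1` (t n @^-1` (~` V k))))).
    apply/seteqP; split => p; have [_ p0 pA] := phiP p.
      move=> /= Up; have [Ax|nAx] := pselect (A (proj p)); last first.
        by left; split => //=; rewrite -p0.
      right; split => //.
      have /nbhs_ballP[d /= d0 dU] := open_nbhs_nbhs (conj oU Up).
      have d20 : 0 < d / 2 by rewrite divr_gt0.
      have [k kd] : exists k, e k < d / 2.
        exists (Num.truncn (d / 2)^-1); rewrite /e.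
        by rewrite -[ltRHS]invrK ltf_pV2 ?posrE ?invr_gt0// truncnS_gt.
      have ek0 : 0 < e k by rewrite /e.
      have [n nk] := closure_range_approx (dP _ Ax p erefl) ek0.
      exists n => //; exists k => //; split => //= -[z nUz].
      rewrite -ball_normE/= => zk; apply: nUz; apply: dU.
      rewrite -ball_normE/=; apply: le_lt_trans (ler_distD (t n (proj p)) _ _) _.
      rewrite distrC pA// (distrC _ z) [ltRHS]splitr.
      by apply: ltrD; apply: lt_trans kd.
    move=> [[/= nAx U0]|[/= Ax [n _ [k _ [/= nk nV]]]]]; first by rewrite p0.
    apply: contrapT => nU; apply: nV; exists (vect (phi p)) => //.
    by rewrite -ball_normE/= distrC pA.
  apply: measurableU => //; apply: measurableI => //.
  apply: bigcup_measurable => n _; apply: bigcup_measurable => k _.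
  apply: measurableI; first exact: measurable_section_dist.
  rewrite -[X in measurable X]setTI; apply: (@measurable_proj E) => //.
  rewrite preimage_setC; apply: measurableC.
  exact: measurable_borel_preimage (bsection_measurable _) (oV k).
have mphi : measurable_fun setT (phi : total_measurable E -> total_measurable F).
  move=> _ _ [Y mY <-]; rewrite !setTI.
  have mg : measurable_fun setT
      ((fun p => (proj p, vect (phi p))) : total_measurable E -> (Xm * borel B)%type).
    by apply/measurable_fun_pairP; split => //; exact: measurable_proj.
  have := mg measurableT _ mY; rewrite setTI; congr measurable.
  apply/seteqP; split => p; rewrite /= -phi_proj /proj /vect;
    by case: (sval (phi p)).
exists (Build_bundle_map mphi phi_proj phi_lin phi_cont) => p Ax.
by have [_ _] := phiP p; exact.
Qed.

End bundle_maps.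

(** * Uniqueness of the cotangent bundle *)

Section cotangent_couples.
Context (R : realType) (X : completeMetricType R).
Variable m : {measure set (borel X) -> \bar R}.
Variable B : completeNormedModType R.
Implicit Types E F : bundle m B.
Local Notation Xm := (completion m).
Local Notation mu := (completed m).
Local Notation n2 := (@n2 R _ Xm mu).
Local Notation D := (minimal_slope m).
Local Notation sobolev := (sobolev m).

(** Approximation at the rate [fast] makes the slopes of the differences tend to [0] almost
    everywhere, not only in L^2. *)
Lemma W12_dense_cvg (f_ : nat -> W12 m) (f : X -> R) :
  W12_dense (range f_) -> sobolev f -> exists k : nat -> nat,
  (forall n, n2 (D (f \- f_ (k n))) <= fast R n) /\
  {ae mu, forall x : Xm, D (f \- f_ (k n)) x @[n --> \oo] --> 0}.
Proof.
move=> f_d fS; have [F Ff] := W12_of_sobolev fS.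
have /choice[k kP] n : exists k, n2 (D (f \- f_ k)) <= fast R n.
  have [_ [k _ <-] h] := W12_dense_approx F f_d (fast_gt0 R n).
  exists k; rewrite (_ : D (f \- f_ k) = D (F \- f_ k))//.
  apply: minimal_slope_ae; last by apply: filterS Ff => x /= ->.
    exact: sobolevB (sobolev_W12 _).
  by apply: sobolevB; exact: sobolev_W12.
exists k; split => //.
have vi n : sqint mu (D (f \- f_ (k n)) : Xm -> R).
  by apply: minimal_slope_sqint; exact: sobolevB (sobolev_W12 _).
apply: filterS (fast_ae vi kP) => x [M M0 MP].
apply/norm_cvg0P.
have M0' : M * 2^-1 ^+ n @[n --> \oo] --> (M * 0 : R).
  by apply: cvgM; [exact: cvg_cst|apply: cvg_expr; rewrite gtr0_norm; lra].
rewrite mulr0 in M0'; apply: (squeeze_cvgr _ (cvg_cst 0) M0').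
by apply: nearW => n; rewrite normr_ge0 MP.
Qed.

(** The right-hand side does not mention the couple: two couples have the same norms on three-term
    combinations, which is the isometry behind uniqueness. *)
Lemma couple_norm E (d : W12 m -> Gamma E) (a : R) (f g k : W12 m) :
  cotangent_couple d -> {ae mu, forall x : Xm,
    `|a *: d f x + d g x - d k x| = D (fun y => a * f y + g y - k y) x}.
Proof.
move=> [lin dD _].
have [h1 h1P] := W12_of_sobolev
  (sobolev_lin a (sobolev_W12 f) (sobolev_W12 g)).
have [h hP] := W12_of_sobolev
  (sobolev_lin (-1) (sobolev_W12 k) (sobolev_W12 h1)).
have -> : D (fun y => a * f y + g y - k y) = D h.
  apply: minimal_slope_ae; last first.
  - by apply: filterS2 h1P hP => x e1 e2; rewrite e2 e1 mulN1r addrC.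
  - exact: sobolev_W12.
  - exact: (sobolevB (sobolev_lin a (sobolev_W12 f) (sobolev_W12 g)) (sobolev_W12 k)).
apply: filterS3 (lin _ _ _ _ h1P) (lin _ _ _ _ hP) (dD h) => x e1 e2 <-.
by rewrite e2 e1 scaleN1r addrC.
Qed.

Lemma couple_dist E (d : W12 m -> Gamma E) (f g : W12 m) :
  cotangent_couple d ->
  {ae mu, forall x : Xm, `|d f x - d g x| = D (f \- g) x}.
Proof.
move=> dC; apply: filterS (couple_norm 0 f f g dC) => x.
rewrite scale0r add0r => ->; congr (D _ x).
by apply/funext => y; rewrite mul0r add0r.
Qed.

Hypothesis sepB : separable B.
Hypothesis sepW : W12_separable m.

Lemma couple_map E F (d : W12 m -> Gamma E) (d' : W12 m -> Gamma F) :
  cotangent_couple d -> cotangent_couple d' ->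
  exists phi : bundle_map E F, forall f,
    {ae mu, forall x : Xm, vect (phi (graph (d f) x)) = d' f x}.
Proof.
move=> dC d'C; have [f_ f_d] := W12_dense_seq sepW.
pose T := (rat * nat * nat * nat)%type.
pose P (q : T) (x : Xm) := let: (a, i, j, k) := q in
  `|ratr a *: d (f_ i) x + d (f_ j) x - d (f_ k) x| =
  `|ratr a *: d' (f_ i) x + d' (f_ j) x - d' (f_ k) x|.
have Pae : {ae mu, forall x : Xm, forall q, P q x}.
  apply: ae_forall_countable => -[[[a i] j] k].
  apply: filterS2 (couple_norm (ratr a) (f_ i) (f_ j) (f_ k) dC)
    (couple_norm (ratr a) (f_ i) (f_ j) (f_ k) d'C) => x h1 h2.
  by rewrite /P h1 h2.
have [_ _ dense_d] := dC.
(* The exceptional set is enlarged to a measurable null set [N], as [bmap_of_sections] works over a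
   measurable set. *)
have [N [mN N0 NP]] : mu.-negligible (~` [set x : Xm | (forall q, P q x) /\
    gr_set (E x) `<=` closure (range (fun n => d (f_ n) x))]).
  by apply: filterS2 Pae (dense_d _ f_d) => x h1 h2; split.
have NA x : (~` N) x -> (forall q, P q x) /\
    gr_set (E x) `<=` closure (range (fun n => d (f_ n) x)).
  by move=> Nx; apply: contrapT => /NP.
have mA : measurable (~` N : set Xm) by exact: measurableC.
have [x /NA[]//|x /NA[xP _] a i j k|phi phiP] := @bmap_of_sections _ _ _ _ sepB
  E F (fun n => d (f_ n)) (fun n => d' (f_ n)) (~` N) mA _ _.
  rewrite -!addrA; apply: norm_line_rat => q; rewrite !addrA.
  exact: (xP (q, i, j, k)).
exists phi => f.
have [kn [_ kP]] := W12_dense_cvg f_d (sobolev_W12 f).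
have NAae : {ae mu, forall x : Xm, (~` N) x}.
  by exists N; split => // x /= /contrapT.
have dist1 : {ae mu, forall x : Xm, forall n,
    `|d f x - d (f_ n) x| = D (f \- f_ n) x}.
  by apply: ae_foralln => n; exact: couple_dist.
have dist2 : {ae mu, forall x : Xm, forall n,
    `|d' f x - d' (f_ n) x| = D (f \- f_ n) x}.
  by apply: ae_foralln => n; exact: couple_dist.
apply: filterS2 (filterI dist1 dist2) (filterI NAae kP) => x [h1 h2] [nNx cv].
set w := vect _.
(* [d' f x] has the same distances to the [d' (f_ n) x]; along [kn] these tend to [0], so it
   coincides with [w]. *)
have wP n : `|d' (f_ n) x - w| = D (f \- f_ n) x.
  by rewrite -h1 [RHS]distrC; exact: (phiP (graph (d f) x) nNx n).
apply/eqP; rewrite -subr_eq0 -normr_le0.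
have cv2 : 2 * D (f \- f_ (kn n)) x @[n --> \oo] --> (2 * 0 : R).
  by apply: cvgM => //; exact: cvg_cst.
rewrite -(mulr0 2); apply: (ler_cvg_to (cvg_cst _) cv2); apply: nearW => n.
apply: le_trans (ler_distD (d' (f_ (kn n)) x) _ _) _.
by rewrite (distrC w) wP distrC h2; lra.
Qed.

Lemma couple_map_unique E F (d : W12 m -> Gamma E) (phi psi : bundle_map E F) :
  cotangent_couple d ->
  (forall f, {ae mu, forall x : Xm,
    vect (phi (graph (d f) x)) = vect (psi (graph (d f) x))}) ->
  {ae mu, forall x : Xm, forall p, proj p = x -> phi p = psi p}.
Proof.
move=> [_ _ dD] h; have [f_ f_d] := W12_dense_seq sepW.
exact: bmap_unique (dD _ f_d) (fun n => h (f_ n)).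
Qed.

Lemma vect_graph E (p : total_space E) (s : bsection E) x :
  proj p = x -> vect p = s x -> p = graph s x.
Proof. by move=> px ps; exact: total_ext. Qed.

(** The composition fixes every [d f] almost everywhere, and these values determine a morphism. *)
Lemma couple_inverse E F (d : W12 m -> Gamma E) (d' : W12 m -> Gamma F)
    (phi : bundle_morphism E F) (psi : bundle_morphism F E) :
  cotangent_couple d ->
  (forall f, {ae mu, forall x : Xm, vect (phi (graph (d f) x)) = d' f x}) ->
  (forall f, {ae mu, forall x : Xm, vect (psi (graph (d' f) x)) = d f x}) ->
  morphism_comp psi phi = morphism_id E.
Proof.
move=> dC phid psid; apply/morphism_eqP.
have h : {ae mu, forall x : Xm, forall p, proj p = x ->
    bmap_comp psi phi p = bmap_id E p}.
  apply: (couple_map_unique dC) => f.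
  apply: filterS2 (phid f) (psid f) => x h1 h2.
  rewrite /= -[RHS]h2; congr (vect (psi _)).
  by apply: vect_graph => //; rewrite bmap_proj.
apply: filterS3 h (morphism_pi (bmap_comp psi phi)) (morphism_pi (bmap_id E)).
by move=> x h1 h2 h3 p px; rewrite /morphism_comp /morphism_id h2// h3// h1.
Qed.

Lemma Gamma_mapP E F (d : W12 m -> Gamma E) (d' : W12 m -> Gamma F)
    (phi : bundle_morphism E F) f : Gamma_map phi (d f) = d' f <->
  {ae mu, forall x : Xm, vect (phi (graph (d f) x)) = d' f x}.
Proof.
rewrite Gamma_eqP; have H := Gamma_pi (bsection_map phi (d f)).
split => h; first by apply: filterS2 H h => x e1 e2; exact: etrans (esym e1) e2.
by apply: filterS2 H h => x e1 e2; exact: etrans e1 e2.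
Qed.

Theorem couple_unique_isomorphism E F (d : W12 m -> Gamma E)
    (d' : W12 m -> Gamma F) : cotangent_couple d -> cotangent_couple d' ->
  exists! phi : bundle_morphism E F,
    isomorphism phi /\ forall f : W12 m, Gamma_map phi (d f) = d' f.
Proof.
move=> dC d'C.
have lift E1 E2 (d1 : W12 m -> Gamma E1) (d2 : W12 m -> Gamma E2) :
    cotangent_couple d1 -> cotangent_couple d2 ->
    exists phi : bundle_morphism E1 E2, forall f,
      {ae mu, forall x : Xm, vect (phi (graph (d1 f) x)) = d2 f x}.
  move=> c1 c2; have [phi phiP] := couple_map c1 c2.
  exists (\pi_(bundle_morphism E1 E2) phi)%qT => f.
  by apply: filterS2 (phiP f) (morphism_pi phi) => x h1 h2; rewrite h2.
have [phi phiP] := lift _ _ _ _ dC d'C.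
have [psi psiP] := lift _ _ _ _ d'C dC.
exists phi; split.
  split; last by move=> f; apply/Gamma_mapP.
  exists psi; split; first exact: (couple_inverse dC phiP psiP).
  exact: (couple_inverse d'C psiP phiP).
move=> chi [_ chiP]; apply/morphism_eqP/(couple_map_unique dC) => f.
have /Gamma_mapP h := chiP f.
by apply: filterS2 h (phiP f) => x -> ->.
Qed.

End cotangent_couples.

(** * Existence of the cotangent bundle *)

Section rational_combinations.
Context (R : realType) (T : Type) (f : nat -> T -> R).

(** The monomial ['X^i] stands for [f i], so the combinations are indexed by a countable module over
    [rat]. *)
Definition rat_comb (c : {poly rat}) (x : T) : R :=
  \sum_(i < size c) ratr c`_i * f i x.

Lemma rat_combE (c : {poly rat}) n x : (size c <= n)%N ->
  rat_comb c x = \sum_(i < n) ratr c`_i * f i x.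
Proof.
move=> cn; rewrite /rat_comb (big_ord_widen n (fun i => ratr c`_i * f i x))//.
rewrite big_mkcond; apply: eq_bigr => i _; case: ltnP => // ci.
by rewrite nth_default// rmorph0 mul0r.
Qed.

Lemma rat_combD (c c' : {poly rat}) : rat_comb (c + c') = rat_comb c \+ rat_comb c'.
Proof.
apply/funext => x /=; pose n := maxn (size c) (size c').
rewrite !(@rat_combE _ n) ?leq_maxl ?leq_maxr ?size_polyD// -big_split/=.
by apply: eq_bigr => i _; rewrite coefD rmorphD mulrDl.
Qed.

Lemma rat_combZ (a : rat) (c : {poly rat}) :
  rat_comb (a *: c) = fun x => ratr a * rat_comb c x.
Proof.
apply/funext => x /=; rewrite (@rat_combE _ (size c)) ?size_scale_leq//.
by rewrite mulr_sumr; apply: eq_bigr => i _; rewrite coefZ rmorphM mulrA.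
Qed.

Lemma rat_comb0 : rat_comb 0 = fun=> 0.
Proof. by apply/funext => x; rewrite /rat_comb size_poly0 big_ord0. Qed.

Lemma rat_combB (c c' : {poly rat}) : rat_comb (c - c') = rat_comb c \- rat_comb c'.
Proof.
rewrite rat_combD -scaleN1r rat_combZ; apply/funext => x /=.
by rewrite rmorphN rmorph1 mulN1r.
Qed.

Lemma rat_combXn n : rat_comb 'X^n = f n.
Proof.
apply/funext => x; rewrite (@rat_combE _ n.+1) ?size_polyXn// big_ord_recr/=.
rewrite coefXn eqxx rmorph1 mul1r big1 ?add0r// => i _.
by rewrite coefXn ltn_eqF// rmorph0 mul0r.
Qed.

End rational_combinations.

Section cotangent_bundle.
Context (R : realType) (X : completeMetricType R).
Variable m : {measure set (borel X) -> \bar R}.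
Variable B : completeNormedModType R.
Local Notation Xm := (completion m).
Local Notation mu := (completed m).
Local Notation sqint := (@sqint R _ Xm mu).
Local Notation n2 := (@n2 R _ Xm mu).
Local Notation D := (minimal_slope m).
Local Notation sobolev := (sobolev m).

Hypothesis radon_m : radon m.

Lemma minimal_slopeN f : sobolev f ->
  {ae mu, forall x : Xm, D (\- f) x = D f x}.
Proof.
move=> fS; have := minimal_slopeZ radon_m (-1) fS.
have -> : (fun x => -1 * f x) = \- f by apply/funext => x; rewrite mulN1r.
by apply: filterS => x ->; rewrite normrN1 mul1r.
Qed.

Lemma minimal_slope_dist f g : sobolev f -> sobolev g ->
  {ae mu, forall x : Xm, `|D f x - D g x| <= D (f \- g) x}.
Proof.
move=> fS gS; have BS := sobolevB fS gS.
have e1 : f = (f \- g) \+ g by apply/funext => x /=; rewrite subrK.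
have e2 : g = \- (f \- g) \+ f.
  by apply/funext => x /=; rewrite opprB subrK.
have NS : sobolev (\- (f \- g)).
  have := sobolevZ (-1) BS; congr sobolev.
  by apply/funext => x; rewrite mulN1r.
have h1 := minimal_slopeD radon_m BS gS.
have h2 := minimal_slopeD radon_m NS fS.
rewrite -e1 in h1; rewrite -e2 in h2.
apply: filterS3 h1 h2 (minimal_slopeN BS) => x k1 k2 k3.
by rewrite k3 in k2; rewrite ler_norml; apply/andP; split; lra.
Qed.

Lemma sobolev_rat_comb (f_ : nat -> X -> R) (c : {poly rat}) :
  (forall n, sobolev (f_ n)) -> sobolev (rat_comb f_ c).
Proof.
move=> f_S.
have h n : sobolev (fun x => \sum_(i < n) ratr c`_i * f_ i x).
  elim: n => [|n IH].
    by have := sobolev0 m; congr sobolev; apply/funext => x; rewrite big_ord0.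
  have := sobolev_lin (ratr c`_n) (f_S n) IH; congr sobolev.
  by apply/funext => x; rewrite big_ord_recr/= addrC.
exact: h.
Qed.

(** The countably many seminorm rules hold outside one null set, on which [P] is set to [0], so that
    it is a seminorm at every point. *)
Lemma slope_seminorms (f_ : nat -> X -> R) : (forall n, sobolev (f_ n)) ->
  exists P : X -> {poly rat} -> R,
    [/\ forall x, qseminorm (P x),
        forall c, measurable_fun setT (fun x : Xm => P x c) &
        forall c, {ae mu, forall x : Xm, P x c = D (rat_comb f_ c) x}].
Proof.
move=> f_S; pose F := rat_comb f_.
have FS c : sobolev (F c) by exact: sobolev_rat_comb.
have subadd : {ae mu, forall x : Xm, forall cc : {poly rat} * {poly rat},
    D (F (cc.1 + cc.2)) x <= D (F cc.1) x + D (F cc.2) x}.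
  apply: ae_forall_countable => -[c c'] /=; rewrite /F rat_combD.
  exact: minimal_slopeD.
have homog : {ae mu, forall x : Xm, forall ac : rat * {poly rat},
    D (F (ac.1 *: ac.2)) x = `|ratr ac.1| * D (F ac.2) x}.
  apply: ae_forall_countable => -[a c] /=; rewrite /F rat_combZ.
  exact: minimal_slopeZ.
have [N [mN N0 NP]] : mu.-negligible (~` [set x : Xm |
   (forall cc : {poly rat} * {poly rat},
     D (F (cc.1 + cc.2)) x <= D (F cc.1) x + D (F cc.2) x) /\
   (forall ac : rat * {poly rat},
     D (F (ac.1 *: ac.2)) x = `|ratr ac.1| * D (F ac.2) x)]).
  by apply: filterS2 subadd homog => x h1 h2; split.
pose P x c := \1_(~` N) x * D (F c) x.
have mNC : measurable (~` N : set Xm) by exact: measurableC.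
exists P; split.
- move=> x; rewrite /P indicE; case: (boolP (x \in _)) => [xN|_]; last first.
    have -> : (fun c => 0%:R * D (F c) x) = fun=> 0 :> R.
      by apply/funext => c; rewrite mul0r.
    by split; [split => *; rewrite ?addr0 ?mulr0|].
  have -> : (fun c => 1%:R * D (F c) x) = fun c => D (F c) x.
    by apply/funext => c; rewrite mul1r.
  have [h1 h2] : (forall cc : {poly rat} * {poly rat},
     D (F (cc.1 + cc.2)) x <= D (F cc.1) x + D (F cc.2) x) /\
   (forall ac : rat * {poly rat},
     D (F (ac.1 *: ac.2)) x = `|ratr ac.1| * D (F ac.2) x).
    by apply: contrapT => /NP; move: xN; rewrite inE.
  split; first split.
  + by move=> c c'; exact: (h1 (c, c')).
  + by move=> a c a0; rewrite (h2 (a, c)) gtr0_norm// ltr0q.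
  + by move=> c; rewrite -scaleN1r (h2 (-1, c)) rmorphN rmorph1 normrN1 mul1r.
- move=> c; apply: measurable_funM; first exact: measurable_indic.
  exact: (minimal_slope_sqint (FS c)).1.
- move=> c; exists N; split => // x /= Px; apply: contrapT => xN; apply: Px.
  by rewrite /P indicE mem_set// mul1r.
Qed.

Lemma minimal_slope_triangle f g h : sobolev f -> sobolev g -> sobolev h ->
  {ae mu, forall x : Xm, D (g \- h) x <= D (f \- g) x + D (f \- h) x}.
Proof.
move=> fS gS hS; have fg := sobolevB fS gS; have fh := sobolevB fS hS.
have NS : sobolev (\- (f \- g)).
  have := sobolevZ (-1) fg; congr sobolev.
  by apply/funext => x; rewrite mulN1r.
have := minimal_slopeD radon_m NS fh.
have -> : \- (f \- g) \+ (f \- h) = g \- h.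
  by apply/funext => x /=; rewrite opprB subrKA.
by move=> h1; apply: filterS2 h1 (minimal_slopeN fg) => x + <-.
Qed.

End cotangent_bundle.

Section existence.
Context (R : realType) (X : completeMetricType R).
Variable m : {measure set (borel X) -> \bar R}.
Variable B : completeNormedModType R.
Local Notation Xm := (completion m).
Local Notation mu := (completed m).
Local Notation n2 := (@n2 R _ Xm mu).
Local Notation D := (minimal_slope m).
Local Notation sobolev := (sobolev m).

(** Only rational multiples stay in the range, so [a] is replaced by a nearby [r]; each of three
    errors is at most [e / 3]. The tolerance [d'] depends on [r] and is chosen after it. *)
Lemma closure_additive_linear (l : {poly rat} -> B) (a : R) (v w : B) :
  (forall c c', l (c + c') = l c + l c') ->
  closure (range l) v -> closure (range l) w -> closure (range l) (a *: v + w).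
Proof.
move=> lD lv lw; apply: approx_closure_range => e e0.
pose d := e / (3 * (`|v| + 1)).
have v0 := normr_ge0 v.
have v1 : 0 < 3 * (`|v| + 1) by lra.
have d0 : 0 < d by rewrite divr_gt0.
have da : a < a + d by rewrite ltrDl.
have [r] := rat_in_itvoo da; rewrite in_itv/= => /andP[r1 r2].
have dE : d * (3 * (`|v| + 1)) = e by rewrite divfK// gt_eqF.
pose d' := e / (3 * (`|ratr r : R| + 1)).
have ar0 := normr_ge0 (ratr r : R).
have r3 : 0 < 3 * (`|ratr r : R| + 1) by lra.
have d'0 : 0 < d' by rewrite divr_gt0.
have d'E : d' * (3 * (`|ratr r : R| + 1)) = e by rewrite divfK// gt_eqF.
have e3 : 0 < e / 3 by rewrite divr_gt0.
have [c cv] := closure_range_approx lv d'0.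
have [c' c'w] := closure_range_approx lw e3.
exists (r *: c + c'); rewrite lD (additive_scale lD).
have -> : ratr r *: l c + l c' - (a *: v + w) =
    (ratr r - a) *: v + ratr r *: (l c - v) + (l c' - w).
  by rewrite scalerBl scalerBr [X in _ = X + _]addrC subrKA opprD addrACA.
apply: le_lt_trans (ler_normD _ _) _.
apply: le_lt_trans (_ : _ <= `|ratr r - a| * `|v| + `|ratr r| * `|l c - v| +
  `|l c' - w|) _; first by rewrite lerD2r -!normrZ ler_normD.
have -> : `|ratr r - a| = ratr r - a by rewrite gtr0_norm ?subr_gt0.
have h1 : (ratr r - a) * `|v| <= d * `|v| by rewrite ler_wpM2r//; lra.
have h2 : `|ratr r| * `|l c - v| <= `|ratr r| * d' by rewrite ler_wpM2l// ltW.
have h3 : 0 <= `|ratr r| * d' by rewrite mulr_ge0// ltW.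
by lra.
Qed.

Section from_embedding.
Variables (f_ : nat -> W12 m) (u : {poly rat} -> X -> B).
Hypothesis radon_m : radon m.
Hypothesis f_d : W12_dense (range f_).
Hypothesis um : forall c, measurable_fun setT (u c : Xm -> borel B).
Hypothesis uD : forall x c c', u (c + c') x = u c x + u c' x.
Local Notation F := (rat_comb (fun n => f_ n : X -> R)).
Hypothesis uF : forall c, {ae mu, forall x : Xm, `|u c x| = D (F c) x}.

Let FS c : sobolev (F c).
Proof. by apply: sobolev_rat_comb => n; exact: sobolev_W12. Qed.

Let u0 x : u 0 x = 0.
Proof. by apply: (addrI (u 0 x)); rewrite -uD !addr0. Qed.

Let uZ x (a : rat) c : u (a *: c) x = ratr a *: u c x.
Proof. exact: (additive_scale (l := fun c => u c x)). Qed.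

Let uB c c' : {ae mu, forall x : Xm, `|u c x - u c' x| = D (F c \- F c') x}.
Proof.
rewrite -rat_combB; apply: filterS (uF (c - c')) => x <-.
by rewrite uD -[- c']scaleN1r uZ rmorphN rmorph1 scaleN1r.
Qed.

Let cotangent_fiber (x : X) : Gr B.
Proof.
refine (@Build_Gr R B (closure (range (u ^~ x))) _ _ _).
- exact: closed_closure.
- by apply: subset_closure; exists 0.
- by move=> a v w; apply: closure_additive_linear.
Defined.

(** An open set meets the closure of the countable set of values [u c x] exactly when it contains
    one of them. *)
Let cotangent_measurable (U : set B) : open U ->
  measurable ([set x | (gr_set (cotangent_fiber x) `&` U !=set0)] : set Xm).
Proof.
move=> oU.
have -> : [set x | (gr_set (cotangent_fiber x) `&` U !=set0)] =
    \bigcup_(c in [set: {poly rat}]) (u c @^-1` U).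
  apply/seteqP; split => x /=.
    move=> [v [xv Uv]].
    have [_ [[c _ <-] Uc]] := xv _ (open_nbhs_nbhs (conj oU Uv)).
    by exists c.
  by move=> [c _ Uc]; exists (u c x); split => //; apply: subset_closure; exists c.
apply: countable_bigcupT_measurable => [|c]; first exact: countableP.
exact: measurable_borel_preimage.
Qed.

Let TX : bundle m B := Build_bundle cotangent_measurable.

(** The section is pinned down by its distances to all [u c x]; the norm, linearity and density
    properties of the differential are derived from this formula. *)
Lemma exists_differential_section (f : W12 m) : exists s : bsection TX,
  forall c, {ae mu, forall x : Xm, `|s x - u c x| = D (f \- F c) x}.
Proof.
have [k [kfast kP]] := W12_dense_cvg f_d (sobolev_W12 f).
have vi n : sqint mu (D (f \- f_ (k n)) : Xm -> R).
  by apply: minimal_slope_sqint; apply: sobolevB; exact: sobolev_W12.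
pose w n : X -> B := u 'X^(k n).
have wf n c : {ae mu, forall x : Xm, `|w n x - u c x| = D (f_ (k n) \- F c) x}.
  by have := uB 'X^(k n) c; rewrite rat_combXn.
have wcvg : {ae mu, forall x : Xm, cvg (w n x @[n --> \oo])}.
  (* Consecutive terms are compared through [f]; both slopes decay like [2^-n], so the increments
     are summable. *)
  have step : {ae mu, forall x : Xm, forall n, `|w n.+1 x - w n x| <=
      D (f \- f_ (k n.+1)) x + D (f \- f_ (k n)) x}.
    apply: ae_foralln => n.
    have := minimal_slope_triangle radon_m (sobolev_W12 f)
      (sobolev_W12 (f_ (k n.+1))) (sobolev_W12 (f_ (k n))).
    have := wf n.+1 'X^(k n); rewrite rat_combXn => h1 h2.
    by apply: filterS2 h1 h2 => x ->.
  apply: filterS2 (fast_ae vi kfast) step => x [M M0 MP] xw.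
  have M2 : 0 <= 2 * M by lra.
  have [n|l wl _] := @geometric_cauchy _ _ (fun n => w n x) _ M2 _; last first.
    by apply/cvg_ex; exists l.
  apply: le_trans (xw n) _.
  have := le_trans (ler_norm _) (MP n); have := le_trans (ler_norm _) (MP n.+1).
  have : 0 <= M * 2^-1 ^+ n by rewrite mulr_ge0// exprn_ge0.
  rewrite exprS mulrCA -mulrA; set t := M * _ => t0 h1 h2; lra.
have [N [mN N0 NP]] := wcvg.
have NA x : (~` N) x -> cvg (w n x @[n --> \oo]).
  by move=> xN; apply: contrapT => h; apply: xN; exact: NP.
have mNC : measurable (~` N : set Xm) by exact: measurableC.
(* Setting the sequence to [0] on [N] makes it converge everywhere, with limits in the fibers. *)
pose wN n x : B := \1_(~` N) x *: w n x.
pose s x : B := lim (wN n x @[n --> \oo]).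
have wNE x : (~` N) x -> wN ^~ x = w ^~ x.
  by move=> Nx; apply/funext => n; rewrite /wN indicE mem_set// scale1r.
have wN0 x : N x -> wN ^~ x = fun=> 0.
  move=> Nx; apply/funext => n; rewrite /wN indicE memNset ?scale0r// => /(_ Nx).
have scv x : wN n x @[n --> \oo] --> s x.
  rewrite /s; have [Nx|Nx] := pselect (N x).
    by rewrite (wN0 _ Nx); exact: is_cvg_cst.
  by rewrite (wNE _ Nx); exact: NA.
have ms : measurable_fun setT (s : Xm -> borel B).
  apply: measurable_fun_cvg_borel scv => n; apply: measurable_fun_borel => U oU.
  have -> : wN n @^-1` U = (~` N `&` w n @^-1` U) `|` (N `&` [set _ | U 0]).
    apply/seteqP; split => x /=.
      have [Nx|Nx] := pselect (N x).
        by have /= -> := congr1 (@^~ n) (wN0 _ Nx); right.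
      by have /= -> := congr1 (@^~ n) (wNE _ Nx); left.
    move=> [[Nx Ux]|[Nx Ux]].
      by have /= -> := congr1 (@^~ n) (wNE _ Nx).
    by have /= -> := congr1 (@^~ n) (wN0 _ Nx).
  apply: measurableU; apply: measurableI => //.
    exact: measurable_borel_preimage (um _) oU.
  have [U0|U0] := pselect (U 0).
    by rewrite [X in measurable X](_ : _ = setT)//; apply/seteqP; split.
  by rewrite [X in measurable X](_ : _ = set0)//; apply/seteqP; split.
have sTX x : TX x (s x).
  apply: approx_closure_range => e e0.
  have [Nx|Nx] := pselect (N x).
    exists 0; rewrite u0 sub0r normrN.
    have -> : s x = 0; last by rewrite normr0.
    by rewrite /s (wN0 _ Nx); exact: lim_cst.
  have := scv x; rewrite (wNE _ Nx) => /cvgrPdist_lt/(_ e e0)[n _ /(_ n (leqnn n))].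
  by rewrite distrC => h; exists 'X^(k n).
exists (@Build_bsection _ _ _ _ TX s ms sTX) => c /=.
have dist : {ae mu, forall x : Xm, forall n,
    `|D (f \- F c) x - D (f_ (k n) \- F c) x| <= D (f \- f_ (k n)) x}.
  apply: ae_foralln => n.
  have := minimal_slope_dist radon_m (sobolevB (sobolev_W12 f) (FS c))
    (sobolevB (sobolev_W12 (f_ (k n))) (FS c)).
  apply: filterS => x; congr (_ <= D _ x).
  by apply/funext => y /=; rewrite opprB addrA subrK.
have NAae : {ae mu, forall x : Xm, (~` N) x}.
  by exists N; split => // x /= /contrapT.
have wfc : {ae mu, forall x : Xm, forall n,
    `|w n x - u c x| = D (f_ (k n) \- F c) x} by exact: ae_foralln.
apply: filterS2 (filterI dist NAae) (filterI kP wfc) => x [h1 xN] [h2 h3].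
have c1 : `|w n x - u c x| @[n --> \oo] --> `|s x - u c x|.
  have := scv x; rewrite (wNE _ xN) => sc.
  by apply: cvg_norm; apply: cvgB => //; exact: cvg_cst.
have c2 : `|w n x - u c x| @[n --> \oo] --> D (f \- F c) x.
  apply/cvgrPdist_le => e e0.
  move/cvgrPdist_le : h2 => /(_ e e0); apply: filterS => n.
  rewrite sub0r normrN h3 => h; apply: le_trans (h1 n) _.
  exact: le_trans (ler_norm _) h.
exact: cvg_unique c1 c2.
Qed.

Lemma exists_cotangent_couple :
  exists (T : bundle m B) (d : W12 m -> Gamma T), cotangent_couple d.
Proof.
have [s sP] := choice exists_differential_section.
pose d f : Gamma TX := (\pi_(Gamma TX) (s f))%qT.
have dP f c : {ae mu, forall x : Xm, `|d f x - u c x| = D (f \- F c) x}.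
  by apply: filterS2 (sP f c) (Gamma_pi (s f)) => x <- ->.
(* The combination [0] turns the distance formula into the norm. *)
have dn f : {ae mu, forall x : Xm, `|d f x| = D f x}.
  have := dP f 0; rewrite rat_comb0; apply: filterS => x.
  rewrite u0 subr0 => ->; congr (D _ x).
  by apply/funext => y /=; rewrite subr0.
exists TX, d; split => //.
- move=> a f g h hE.
  have [k1 [_ k1P]] := W12_dense_cvg f_d (sobolev_W12 f).
  have [k2 [_ k2P]] := W12_dense_cvg f_d (sobolev_W12 g).
  (* The real [a] is approached by rationals [r], because [u] only knows rational combinations. The
     first term is the price of this, the others vanish along [n]. *)
  pose bound (r : rat) n x : R := `|a - ratr r| * D f x +
    (`|ratr r| * D (f \- f_ (k1 n)) x + D (g \- f_ (k2 n)) x).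
  pose cc (r : rat) n : {poly rat} := r *: 'X^(k1 n) + 'X^(k2 n).
  have b1 : {ae mu, forall x : Xm, forall rn : rat * nat,
      `|d h x - u (cc rn.1 rn.2) x| <= bound rn.1 rn.2 x}.
    apply: ae_forall_countable => -[r n] /=.
    have S1 := sobolevB (sobolev_W12 f) (sobolev_W12 (f_ (k1 n))).
    have S2 := sobolevB (sobolev_W12 g) (sobolev_W12 (f_ (k2 n))).
    have S3 := sobolev_lin (ratr r) S1 S2.
    have S4 := sobolev_lin (a - ratr r) (sobolev_W12 f) S3.
    have e : D (h \- F (cc r n)) = D (fun x => (a - ratr r) * f x +
        (ratr r * (f \- f_ (k1 n)) x + (g \- f_ (k2 n)) x)).
      apply: minimal_slope_ae => //.
        by apply: sobolevB => //; exact: sobolev_W12.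
      apply: filterS hE => x /= ->.
      by rewrite /cc rat_combD rat_combZ !rat_combXn/=; ring.
    have := dP h (cc r n); rewrite e => h1.
    apply: filterS3 h1 (minimal_slope_lin radon_m (a - ratr r) (sobolev_W12 f) S3)
      (minimal_slope_lin radon_m (ratr r) S1 S2) => x -> h2 h3.
    by apply: le_trans h2 _; rewrite /bound lerD2l.
  have b2 : {ae mu, forall x : Xm, forall rn : rat * nat,
      `|a *: d f x + d g x - u (cc rn.1 rn.2) x| <= bound rn.1 rn.2 x}.
    apply: ae_forall_countable => -[r n] /=.
    have := dP f 'X^(k1 n); have := dP g 'X^(k2 n); rewrite !rat_combXn => h2 h1.
    apply: filterS3 h1 h2 (dn f) => x e1 e2 e3.
    rewrite /cc uD uZ /bound -e1 -e2 -e3 -!normrZ.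
    have -> : a *: d f x + d g x - (ratr r *: u 'X^(k1 n) x + u 'X^(k2 n) x) =
        (a - ratr r) *: d f x + (ratr r *: (d f x - u 'X^(k1 n) x) +
          (d g x - u 'X^(k2 n) x)).
      by rewrite scalerBl scalerBr addrA subrKA opprD addrACA.
    apply: le_trans (ler_normD _ _) _; rewrite lerD2l; exact: ler_normD.
  apply: filterS2 (filterI (dn f) (filterI b1 b2)) (filterI k1P k2P) => x.
  move=> [xdn [xb1 xb2]] [xk1 xk2].
  have main (r : rat) : `|d h x - (a *: d f x + d g x)| <= 2 * (`|a - ratr r| * D f x).
    have cv : 2 * bound r n x @[n --> \oo] -->
        2 * (`|a - ratr r| * D f x + (`|ratr r| * 0 + 0)).
      apply: cvgM; first exact: cvg_cst.
      apply: cvgD; first exact: cvg_cst.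
      by apply: cvgD => //; apply: cvgM => //; exact: cvg_cst.
    rewrite mulr0 !addr0 in cv.
    apply: (ler_cvg_to (cvg_cst _) cv); apply: nearW => n.
    apply: le_trans (ler_distD (u (cc r n) x) _ _) _.
    rewrite (distrC (u _ x)); have := xb1 (r, n); have := xb2 (r, n).
    by rewrite /=; lra.
  apply/eqP; rewrite -subr_eq0 -normr_le0; apply/ler_addgt0Pr => e e0.
  rewrite add0r.
  have Df0 : 0 <= D f x by rewrite -xdn.
  have Df1 : 0 < 2 * (D f x + 1) by lra.
  have ea : a - e / (2 * (D f x + 1)) < a by rewrite ltrBlDr ltrDl divr_gt0.
  have [r] := rat_in_itvoo ea; rewrite in_itv/= => /andP[r1 r2].
  apply: le_trans (main r) _; rewrite gtr0_norm ?subr_gt0//.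
  have r3 : (a - ratr r) * (2 * (D f x + 1)) <= e.
    by rewrite -ler_pdivlMr// ltW//; lra.
  by move: r3; lra.
- move=> g_ g_d.
  (* It is enough to reach the [u c x], whose closure is the fiber; [F c] is approximated by the
     dense sequence [g_]. *)
  have key : {ae mu, forall x : Xm, forall c : {poly rat},
      closure (range (fun n => d (g_ n) x)) (u c x)}.
    apply: ae_forall_countable => c.
    have [k [_ kP]] := W12_dense_cvg g_d (FS c).
    have dist : {ae mu, forall x : Xm, forall n,
        `|d (g_ n) x - u c x| = D (F c \- g_ n) x}.
      apply: ae_foralln => n.
      have := minimal_slopeN radon_m (sobolevB (FS c) (sobolev_W12 (g_ n))).
      have -> : \- (F c \- g_ n) = g_ n \- F c.
        by apply/funext => x /=; rewrite opprB.
      by apply: filterS2 (dP (g_ n) c) => x -> ->.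
    apply: filterS2 dist kP => x xd /cvgrPdist_lt xk.
    apply: approx_closure_range => e e0; have [n _ /(_ n (leqnn n))] := xk e e0.
    rewrite sub0r normrN -xd normr_id => h; by exists (k n).
  apply: filterS key => x xc.
  apply: (@subset_trans _ (closure (closure (range (fun n => d (g_ n) x))))).
    by apply: closureS => _ [c _ <-].
  by rewrite -(closure_id _).1//; exact: closed_closure.
Qed.

End from_embedding.
End existence.

Theorem theoremB1 (R : realType) (X : completeMetricType R)
    (m : {measure set (borel X) -> \bar R}) (B : completeNormedModType R) :
  separable X -> radon m -> W12_separable m -> universal_separable_banach B ->
  exists (TX : bundle m B) (d : W12 m -> Gamma TX),
    cotangent_couple d /\
    forall (E : bundle m B) (d' : W12 m -> Gamma E), cotangent_couple d' ->
      exists! phi : bundle_morphism TX E,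
        isomorphism phi /\ forall f : W12 m, Gamma_map phi (d f) = d' f.
Proof.
move=> _ radon_m sepW univB.
have [f_ f_d] := W12_dense_seq sepW.
have f_S n : sobolev m (f_ n) by exact: sobolev_W12.
have [P [PS mP PD]] := slope_seminorms radon_m f_S.
have [u [um uD uP]] := measurable_isometric_embedding (X := completion m) PS mP univB.
have uF c : {ae completed m, forall x : completion m,
    `|u c x| = minimal_slope m (rat_comb (fun n => f_ n) c) x}.
  by apply: filterS (PD c) => x <-.
have [TX [d dC]] := exists_cotangent_couple radon_m f_d um uD uF.
exists TX, d; split => // E d' d'C.
have h := couple_unique_isomorphism univB.1 sepW dC d'C.
exact: h.
Qed.
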